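(* Let $p\in\{\mathcal C,\mathcal R\}$, $q\in\{\mathcal U,\mathcal D\}$ and let $k\ge 1$ be an integer. Let $J_{n,k}^{p,q}(r)$ denote the number of isolated nodes in the graph $G_k^{p,q}(\mathcal P_n,r)$. Then for any $\epsilon\in(0,1)$, as $n\to\infty$, $$\mathbb P\{J_{n,k}^{p,q}(r_n)=0\}\to\begin{cases}0 & \text{if } n\,m_k^{p,q}\,r_n^d=(1-\epsilon)\log n,\\ 1 & \text{if } n\,m_k^{p,q}\,r_n^d=(1+\epsilon)\log n.\end{cases}$$ Moreover, if $n\,m_k^{p,q}\,r_n^d=(1-\epsilon)\log n$, then $J_{n,k}^{p,q}(r_n)\to\infty$ in probability as $n\to\infty$.
   Context: Let $d\ge 2$ be an integer and let $U=[0,1]^d$ with the toroidal metric $d(x,y)=\inf\{\|x-y+z\|: z\in\mathbb Z^d\}$. For $n\ge 1$, $\mathcal P_n$ is a homogeneous Poisson point process of intensity $n$ on $U$. Complexes and graphs. For a finite set $\mathcal X\subset U$ and $r>0$, with closed balls $B_x(r)$ in the toroidal metric: the Čech complex $\mathcal C(\mathcal X,r)$ has as $k$-faces the sets of $k+1$ distinct points $x_1,\dots,x_{k+1}\in\mathcal X$ with $\bigcap_{j=1}^{k+1}B_{x_j}(r)\ne\emptyset$; the Vietoris-Rips complex $\mathcal R(\mathcal X,r)$ has as $k$-faces the sets of $k+1$ distinct points of $\mathcal X$ whose balls of radius $r$ intersect pairwise. For $p\in\{\mathcal C,\mathcal R\}$ let $G_k^{p,\mathcal U}(\mathcal X,r)$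 be the graph whose nodes are the $k$-faces of the corresponding complex ($\mathcal C$: Čech, $\mathcal R$: Vietoris-Rips), with an edge between distinct $k$-faces $\sigma,\tau$ iff $\sigma\cup\tau$ is a $(k+1)$-face (up-connectivity); let $G_k^{p,\mathcal D}(\mathcal X,r)$ be the graph with the same nodes and with an edge between distinct $\sigma,\tau$ iff $\sigma\cap\tau$ is a $(k-1)$-face (down-connectivity). An isolated node is a node with no neighbours. Constants. In $\mathbb R^d$ (Euclidean closed balls, $O$ the origin, $\oplus$ Minkowski sum, $|\cdot|$ Lebesgue measure) and for $\mathbf x=(x_1,\dots,x_{k+1})\in(\mathbb R^d)^{k+1}$ let $h_k^{\mathcal C}(\mathbf x)=\mathbf 1[\bigcap_j B_{x_j}(1)\neq\emptyset]$, $h_k^{\mathcal R}(\mathbf x)=\prod_{j<m}\mathbf 1[B_{x_j}(1)\cap B_{x_m}(1)\ne\emptyset]$, and $Q_k^{\mathcal C,\mathcal U}(\mathbf x)=\big(\bigcap_{j}B_{x_j}(1)\big)\oplus B_O(1)$, $Q_k^{\mathcal C,\mathcal D}(\mathbf x)=\bigcup_{i}\big[\big(\bigcap_{j\ne i}B_{x_j}(1)\big)\oplus B_O(1)\big]$, $Q_k^{\mathcal R,\mathcal U}(\mathbf x)=\bigcap_{j}B_{x_j}(2)$, $Q_k^{\mathcal R,\mathcal D}(\mathbf x)=\bigcup_{i}\bigcap_{j\neq i}B_{x_j}(2)$, with indices in $\{1,\dots,k+1\}$. Let $A_k^p=\{\mathbf y\in(\mathbb R^d)^k: h_k^p(O,\mathbf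 y)=1\}$ and $m_k^{p,q}=\inf\{|Q_k^{p,q}(O,\mathbf y)|:\mathbf y\in A_k^p\}$. *)

(* Defs.v *)
From HB Require Import structures.
From mathcomp Require Import all_boot all_order all_algebra finmap.
From mathcomp Require Import all_classical all_reals all_analysis.
Set Implicit Arguments.
Unset Strict Implicit.
Unset Printing Implicit Defensive.
Import Order.TTheory GRing.Theory Num.Theory.
Import numFieldNormedType.Exports.
Local Open Scope classical_set_scope.
Local Open Scope ring_scope.

(* R^d is d.-tuple R, which carries the product (= Borel) sigma-algebra; the
   library norm on 'rV[R]_d is the sup norm, whereas the metric below must be
   Euclidean. *)

Section euclidean.
Context {R : realType}.

Definition enorm d (x : d.-tuple R) : R :=
  Num.sqrt (\sum_(i < d) tnth x i ^+ 2).

Definition vadd d (x y : d.-tuple R) : d.-tuple R :=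
  [tuple tnth x i + tnth y i | i < d].

Definition vsub d (x y : d.-tuple R) : d.-tuple R :=
  [tuple tnth x i - tnth y i | i < d].

Definition vzero d : d.-tuple R := [tuple 0 | i < d].

Definition eball d (x : d.-tuple R) (r : R) : set (d.-tuple R) :=
  [set y | enorm (vsub x y) <= r].

Definition minkowski_sum d (A B : set (d.-tuple R)) : set (d.-tuple R) :=
  [set vadd a b | a in A & b in B].

(* Iterated product of the one-dimensional Lebesgue measure, transported along
   R * R^d -> R^(d+1). *)
Fixpoint lebesgue_tuple (d : nat) : set (d.-tuple R) -> \bar R :=
  match d with
  | 0 => \d_[tuple]
  | d'.+1 =>
      pushforward (lebesgue_measure \x @lebesgue_tuple d')%E
        (fun p : R * d'.-tuple R => [tuple of p.1 :: p.2])
  end.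

End euclidean.

Section torus.
Context {R : realType} (d : nat).

Definition cube : set (d.-tuple R) :=
  [set x | forall i, 0 <= tnth x i <= 1].

Definition torus_dist (x y : d.-tuple R) : R :=
  inf [set enorm (vadd (vsub x y) [tuple (z i)%:~R | i < d])
      | z in [set: 'I_d -> int]].

Definition tball (x : d.-tuple R) (r : R) : set (d.-tuple R) :=
  [set y | cube y /\ torus_dist x y <= r].

End torus.

Inductive complex_kind := Cech | Rips.
Inductive connectivity := Up | Down.

Section face_graphs.
Context {R : realType} (d : nat).
Local Notation pt := (d.-tuple R).
Implicit Types (p : complex_kind) (q : connectivity).
Implicit Types (X s t : {fset pt}) (r : R) (k : nat).

Definition simplex_cond p r s : Prop :=
  match p with
  | Cech => \bigcap_(x in [set` s]) tball x r !=set0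
  | Rips => forall x y, x \in s -> y \in s -> x <> y ->
              tball x r `&` tball y r !=set0
  end.

Definition is_face p X r k s : Prop :=
  [/\ (s `<=` X)%fset, #|` s| = k.+1 & simplex_cond p r s].

(* Edge relation on k-faces; the Down case is meant for 0 < k. *)
Definition face_adjacent p q X r k s t : Prop :=
  s <> t /\
  match q with
  | Up => is_face p X r k.+1 (s `|` t)%fset
  | Down => is_face p X r k.-1 (s `&` t)%fset
  end.

Definition isolated_face p q X r k s : Prop :=
  is_face p X r k s /\
  forall t, is_face p X r k t -> ~ face_adjacent p q X r k s t.

Definition num_isolated p q X r k : nat :=
  #|` [fset s in fpowerset X | `[< isolated_face p q X r k s >]]%fset |.

End face_graphs.

Section constants.
Context {R : realType} (d k : nat).
Local Notation pt := (d.-tuple R).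
Implicit Types (p : complex_kind) (q : connectivity) (x : 'I_k.+1 -> pt).

Definition h_cond p x : Prop :=
  match p with
  | Cech => \bigcap_(j in [set: 'I_k.+1]) eball (x j) 1 !=set0
  | Rips => forall j m : 'I_k.+1, (j < m)%N ->
              eball (x j) 1 `&` eball (x m) 1 !=set0
  end.

Definition Qset p q x : set pt :=
  match p, q with
  | Cech, Up =>
      minkowski_sum (\bigcap_(j in [set: 'I_k.+1]) eball (x j) 1)
                (eball (vzero d) 1)
  | Cech, Down =>
      \bigcup_(i in [set: 'I_k.+1])
        minkowski_sum (\bigcap_(j in [set j | j != i]) eball (x j) 1)
                  (eball (vzero d) 1)
  | Rips, Up => \bigcap_(j in [set: 'I_k.+1]) eball (x j) 2
  | Rips, Down =>
      \bigcup_(i in [set: 'I_k.+1])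
        \bigcap_(j in [set j | j != i]) eball (x j) 2
  end.

(* (y_1, ..., y_k) |-> (O, y_1, ..., y_k) *)
Definition cons_origin (y : 'I_k -> pt) : 'I_k.+1 -> pt :=
  fun i => if unlift ord0 i is Some j then y j else vzero d.

Definition Aset p : set ('I_k -> pt) := [set y | h_cond p (cons_origin y)].

Definition mconst p q : \bar R :=
  ereal_inf [set lebesgue_tuple (Qset p q (cons_origin y)) | y in Aset p].

End constants.

Section poisson_process.
Context {R : realType} (d : nat) {dT} {T : measurableType dT}.
Local Notation pt := (d.-tuple R).

Definition npoints (X : T -> {fset pt}) (B : set pt) (w : T) : nat :=
  #|` [fset x in X w | x \in B]%fset |.

(* The second explicit argument of [poisson_prob] is a dummy. [poisson_prob]
   with rate 0 is the Dirac measure at 0. *)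
Record poisson_process (P : probability T R) (lambda : R)
    (X : T -> {fset pt}) : Prop := {
  pp_cube : forall w x, x \in X w -> cube x ;
  pp_measurable : forall B, measurable B -> B `<=` @cube R d ->
    measurable_fun setT (npoints X B) ;
  pp_poisson : forall B, measurable B -> B `<=` @cube R d ->
    forall D : set nat, P (npoints X B @^-1` D) =
      poisson_prob (lambda * fine (lebesgue_tuple B)) 0 D ;
  pp_independent : forall (m : nat) (B : 'I_m -> set pt),
    (forall i, measurable (B i)) -> (forall i, B i `<=` @cube R d) ->
    (forall i j, i != j -> B i `&` B j = set0) ->
    forall D : 'I_m -> set nat,
      P (\bigcap_(i in [set: 'I_m]) npoints X (B i) @^-1` D i) =
      (\prod_(i < m) P (npoints X (B i) @^-1` D i))%E }.

End poisson_process.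

(* Main.v *)
From HB Require Import structures.
Require Import Defs.
From mathcomp Require Import all_boot all_order all_algebra finmap.
From mathcomp Require Import all_classical all_reals all_analysis.
From mathcomp Require Import measurable_realfun zify ring lra.
Import Order.TTheory GRing.Theory Num.Theory.
Import numFieldNormedType.Exports.
Local Open Scope classical_set_scope.
Local Open Scope ring_scope.
Set Implicit Arguments.
Unset Strict Implicit.
Unset Printing Implicit Defensive.

(** In the supercritical regime, round the base point of an isolated face to a
    grid of mesh [r n] and its rescaled shape to a fixed finite net of feasible
    shapes.  The point process then has to miss one of [O((r n)^-d)] fixed
    regions whose volume is almost [m * (r n) ^+ d], an event of probability
    about [n^-(1 + eps)], and a union bound gives [O(1 / ln n)].

    In the subcritical regime, put [O((r n)^-d)] disjoint places on the torus.
    Around each of them look for a face of almost optimal shape: exactly one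
    point in each of [k + 1] small boxes and no other point in a slight
    enlargement of the corresponding [Q] region.  These events are independent
    and have probability at least [n^-(1 - eps / 2)], so that, when the places
    are split into [M] groups, each group contains such a face with probability
    tending to [1].  This bounds from below the number of isolated faces without
    any second moment.

    Both halves rest on the stability of [Q] under perturbations of a feasible
    shape among feasible shapes: up to a homothety of ratio close to [1], the
    regions of two close feasible shapes contain each other.

    A probability takes junk values on non-measurable sets, so the measurability
    of the number of isolated faces is also needed. *)

(** * Euclidean geometry of simplices *)

(** The volume of [Q] is never shown to be continuous, nor its infimum to be attained. An
    arbitrarily small perturbation of two tangent unit balls empties their intersection, and with it
    the Cech [Up] region; hence nets consist of feasible shapes only. Shapes are compared by
    inclusion after a homothety of ratio [1 - s]: the inclusion carries points of one region to
    points of the other, and the volume changes by the factor [(1 - s) ^+ d] alone. Crude counting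
    is affordable because [r n ^+ d] is of order [ln n / n], so that there are only about [n / ln n]
    grid cells or places. Above the threshold all of [eps] may be spent on the homothety, the net
    and the excised vertices: a void probability of [1 / n] suffices, and the factor [1 / ln n]
    remains. Below it, the expected number of good places is still of order at least
    [n^(eps/2) / ln n]. Occupied boxes are no dearer than empty ones: once their mean [t] is at
    least [1], the probability [t * exp (- t)] of exactly one point is at least [exp (- t)]. *)

Section fnorm.
Context {R : realType} {I : finType}.
Implicit Types f g : I -> R.

Definition fnorm f : R := Num.sqrt (\sum_i f i ^+ 2).

Lemma fnorm_sum_ge0 f : 0 <= \sum_i f i ^+ 2.
Proof. by apply: sumr_ge0 => i _; exact: sqr_ge0. Qed.

Lemma fnorm_ge0 f : 0 <= fnorm f.
Proof. exact: sqrtr_ge0. Qed.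

Lemma fnorm_sqr f : fnorm f ^+ 2 = \sum_i f i ^+ 2.
Proof. by rewrite sqr_sqrtr ?fnorm_sum_ge0. Qed.

Lemma eq_fnorm f g : f =1 g -> fnorm f = fnorm g.
Proof. by move=> fg; congr Num.sqrt; apply: eq_bigr => i _; rewrite fg. Qed.

Lemma fnormZ (a : R) f : fnorm (fun i => a * f i) = `|a| * fnorm f.
Proof.
rewrite -sqrtr_sqr -sqrtrM ?sqr_ge0//; congr Num.sqrt.
by rewrite mulr_sumr; apply: eq_bigr => i _; rewrite exprMn.
Qed.

Lemma fnormN f : fnorm (fun i => - f i) = fnorm f.
Proof.
by rewrite -[RHS]mul1r -(normrN1 R) -fnormZ; apply: eq_fnorm => i; rewrite mulN1r.
Qed.

Lemma fnorm_coord f i : `|f i| <= fnorm f.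
Proof.
rewrite -(@ler_pXn2r _ 2) ?nnegrE ?fnorm_ge0// fnorm_sqr real_normK ?num_real//.
by rewrite (bigD1 i)//= lerDl; apply: sumr_ge0 => j _; exact: sqr_ge0.
Qed.

(** Cauchy-Schwarz, by expanding the squares of [b * f i - a * g i] with [a] and [b] the two norms;
    zero norms are set aside so that [a * b] can be cancelled. *)
Lemma fnorm_dot f g : \sum_i f i * g i <= fnorm f * fnorm g.
Proof.
have [f0|f0] := eqVneq (fnorm f) 0.
  rewrite f0 mul0r big1// => i _.
  by have := fnorm_coord f i; rewrite f0 normr_le0 => /eqP ->; rewrite mul0r.
have [g0|g0] := eqVneq (fnorm g) 0.
  rewrite g0 mulr0 big1// => i _.
  by have := fnorm_coord g i; rewrite g0 normr_le0 => /eqP ->; rewrite mulr0.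
set a := fnorm f; set b := fnorm g.
have ab : 0 < a * b by rewrite mulr_gt0 // lt_neqAle eq_sym ?f0 ?g0 fnorm_ge0.
have : 0 <= \sum_i (b * f i - a * g i) ^+ 2 by apply: sumr_ge0 => i _; exact: sqr_ge0.
rewrite (eq_bigr (fun i => b ^+ 2 * f i ^+ 2 + (- 2 * (a * b)) * (f i * g i) + a ^+ 2 * g i ^+ 2)); last first.
  by move=> i _; ring.
rewrite !big_split /= -!mulr_sumr -!fnorm_sqr -/a -/b.
set S := \sum_i _ => H.
have : 0 <= (a * b) * (a * b - S) by nra.
by rewrite pmulr_rge0// subr_ge0.
Qed.

Lemma fnormD f g : fnorm (fun i => f i + g i) <= fnorm f + fnorm g.
Proof.
rewrite -(@ler_pXn2r _ 2) ?nnegrE ?addr_ge0 ?fnorm_ge0// fnorm_sqr.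
rewrite (eq_bigr (fun i => f i ^+ 2 + 2 * (f i * g i) + g i ^+ 2)); last by move=> i _; ring.
rewrite !big_split /= -mulr_sumr -!fnorm_sqr.
have := fnorm_dot f g; set S := \sum_i _; nra.
Qed.

Lemma fnorm_le_sum f : fnorm f <= \sum_i `|f i|.
Proof.
rewrite -(@ler_pXn2r _ 2) ?nnegrE ?fnorm_ge0 ?sumr_ge0// fnorm_sqr.
suff : forall s : seq I, 0 <= \sum_(i <- s) `|f i| /\ \sum_(i <- s) f i ^+ 2 <= (\sum_(i <- s) `|f i|) ^+ 2.
  by move=> /(_ (index_enum I))[].
elim=> [|i s [IH1 IH2]]; first by rewrite !big_nil expr0n.
rewrite !big_cons; split; first by rewrite addr_ge0.
have := normr_ge0 (f i); rewrite -(real_normK (num_real (f i))).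
set a := `|f i|; move: IH1 IH2; set S := \sum_(j <- s) `|f j|; nra.
Qed.

(** The negative last term, the strict convexity of the squared norm, is the gain on which the
    recentring of Cech simplices feeds. *)
Lemma fnorm_stewart (t : R) f g :
  fnorm (fun i => (1 - t) * f i + t * g i) ^+ 2 =
  (1 - t) * fnorm f ^+ 2 + t * fnorm g ^+ 2
  - t * (1 - t) * fnorm (fun i => f i - g i) ^+ 2.
Proof.
rewrite !fnorm_sqr !mulr_sumr -big_split /= -sumrN -big_split /=.
by apply: eq_bigr => i _; ring.
Qed.

Lemma fnorm_convex (t : R) f g : 0 <= t <= 1 ->
  fnorm (fun i => (1 - t) * f i + t * g i) <= (1 - t) * fnorm f + t * fnorm g.
Proof.
move=> /andP[t0 t1]; apply: (le_trans (fnormD _ _)).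
by rewrite !fnormZ !ger0_norm ?subr_ge0.
Qed.

End fnorm.

Section dist.
Context {R : realType} {d : nat}.
Local Notation pt := (d.-tuple R).
Implicit Types x y z u v c : pt.

Definition vcomb (s : R) x y : pt := [tuple (1 - s) * tnth x i + s * tnth y i | i < d].

Definition eudist x y := enorm (vsub x y).

Lemma eudistE x y : eudist x y = fnorm (fun i => tnth x i - tnth y i).
Proof. by apply: eq_fnorm => i; rewrite tnth_mktuple. Qed.

Lemma eudist_ge0 x y : 0 <= eudist x y. Proof. exact: sqrtr_ge0. Qed.

Lemma eudistC x y : eudist x y = eudist y x.
Proof. by rewrite !eudistE -fnormN; apply: eq_fnorm => i; rewrite opprB. Qed.

Lemma eudistxx x : eudist x x = 0.
Proof.
rewrite eudistE (eq_fnorm (g := fun i => 0 * tnth x i)); last by move=> i; rewrite subrr mul0r.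
by rewrite fnormZ normr0 mul0r.
Qed.

Lemma eudist_triangle y x z : eudist x z <= eudist x y + eudist y z.
Proof.
rewrite !eudistE; apply: le_trans (fnormD _ _); rewrite le_eqVlt; apply/orP; left.
by apply/eqP; apply: eq_fnorm => i; ring.
Qed.

Lemma eudist_coord x y i : `|tnth x i - tnth y i| <= eudist x y.
Proof. by rewrite eudistE (fnorm_coord (fun i => tnth x i - tnth y i)). Qed.

Lemma eudist_le_max x y (e : R) : (forall i, `|tnth x i - tnth y i| <= e) ->
  eudist x y <= d%:R * e.
Proof.
move=> xy; rewrite eudistE (le_trans (fnorm_le_sum _))//.
by rewrite (le_trans (ler_sum _ (fun i _ => xy i)))// sumr_const card_ord mulr_natl.
Qed.

Lemma eudist_vcombl s x y z : 0 <= s <= 1 ->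
  eudist (vcomb s x y) z <= (1 - s) * eudist x z + s * eudist y z.
Proof.
move=> s01; rewrite !eudistE; apply: le_trans (fnorm_convex _ _ s01).
by rewrite le_eqVlt; apply/orP; left; apply/eqP; apply: eq_fnorm => i; rewrite tnth_mktuple; ring.
Qed.

Lemma eudist_stewart s x y z :
  eudist (vcomb s x y) z ^+ 2 =
  (1 - s) * eudist x z ^+ 2 + s * eudist y z ^+ 2 - s * (1 - s) * eudist x y ^+ 2.
Proof.
rewrite !eudistE (eq_fnorm (g := fun i => (1 - s) * (tnth x i - tnth z i) + s * (tnth y i - tnth z i))).
  rewrite fnorm_stewart; congr (_ - _ * _ ^+ 2); apply: eq_fnorm => i; ring.
by move=> i; rewrite tnth_mktuple; ring.
Qed.

Lemma eudist_vcomb_vcomb s x y z : 0 <= s <= 1 ->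
  eudist (vcomb s x z) (vcomb s y z) = (1 - s) * eudist x y.
Proof.
move=> /andP[s0 s1]; rewrite !eudistE -[X in X * _]ger0_norm ?subr_ge0// -fnormZ.
by apply: eq_fnorm => i; rewrite !tnth_mktuple; ring.
Qed.

Lemma eudist_vcombx s x y : 0 <= s -> eudist (vcomb s x y) x = s * eudist x y.
Proof.
move=> s0; rewrite eudistC !eudistE -[X in X * _]ger0_norm// -fnormZ.
by apply: eq_fnorm => i; rewrite !tnth_mktuple; ring.
Qed.

End dist.

Section simplex.
Context {R : realType} {d : nat}.
Local Notation pt := (d.-tuple R).
Implicit Types (p : complex_kind) (q : connectivity) (S : set pt) (r : R) (x y z u v c : pt).

(** Phrased for arbitrary sets of vertices, so that dropping vertices and adding a further point
    become an image and a union. The Rips case speaks of distances at most [2 * r], which is the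
    same as intersecting balls by way of midpoints. *)
Definition esimplex p r S : Prop :=
  match p with
  | Cech => exists c, forall x, S x -> eudist x c <= r
  | Rips => forall x y, S x -> S y -> eudist x y <= 2 * r
  end.

Lemma esimplexS p r S S' : S `<=` S' -> esimplex p r S' -> esimplex p r S.
Proof.
move=> SS'; case: p => /=; first by move=> [c H]; exists c => x /SS'; exact: H.
by move=> H x y /SS' Sx /SS' Sy; exact: H.
Qed.

Lemma esimplex_diam p r S x y : esimplex p r S -> S x -> S y -> eudist x y <= 2 * r.
Proof.
case: p => /= [[c H] Sx Sy|]; last by apply.
by rewrite (le_trans (eudist_triangle c _ _))// [eudist c y]eudistC mulr_natl mulr2n lerD// H.
Qed.

(* The vertex sets of a face that a further point must complete to a simplex
   to break isolation: all vertices (Up), or all but one (Down). *)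
Definition kept q (n : nat) : set (set 'I_n) :=
  match q with
  | Up => [set setT]
  | Down => [set J | exists i, J = [set j | j != i]]
  end.

Section family.
Context {k : nat}.
Implicit Types w : 'I_k.+1 -> pt.

(** On feasible shapes this is [Q], in a form common to the four cases and directly tied to
    isolation: a point of the process lying here breaks it. *)
Definition witness p q w : set pt :=
  [set u | exists2 J, @kept q k.+1 J & esimplex p 1 (w @` J `|` [set u])].

Lemma h_condE p w : h_cond p w <-> esimplex p 1 (range w).
Proof.
case: p => /=; split.
- move=> [c Hc]; exists c => x [j _ <-]; exact: Hc.
- by move=> [c Hc]; exists c => j _; apply: Hc; exists j.
- have H1 : (forall j m : 'I_k.+1, (j < m)%N -> eball (w j) 1 `&` eball (w m) 1 !=set0) ->
    forall j m : 'I_k.+1, (j < m)%N -> eudist (w j) (w m) <= 2 * 1.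
    move=> H j m /H [c [/= c1 c2]].
    rewrite (le_trans (eudist_triangle c _ _))// [eudist c _]eudistC mulr_natl mulr2n lerD//.
  move=> H x y [j _ <-] [m _ <-]; case: (ltngtP j m) => jm.
  + exact: H1.
  + by rewrite eudistC; exact: H1.
  + by rewrite (val_inj jm) eudistxx.
- move=> H j m _; exists (vcomb 2^-1 (w j) (w m)).
  have h01 : 0 <= (2^-1 : R) by [].
  have D : eudist (w j) (w m) <= 2 * 1 by apply: H; [exists j|exists m].
  split; rewrite /eball/= -/(eudist _ _) eudistC.
  + by rewrite eudist_vcombx//; lra.
  + rewrite (le_trans (eudist_vcombl _ _ _ _))//; first by apply/andP; split => //; lra.
    by rewrite eudistxx; lra.
Qed.

(** For Cech, a point of the Minkowski sum is one within distance [1] of a common centre, which then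
    serves the enlarged set. For Rips, [Q] only controls the distances from [u] to the vertices;
    feasibility supplies those among the kept vertices. *)
Lemma Qset_witness p q w : h_cond p w -> Qset p q w = witness p q w.
Proof.
have eb0 (b : pt) : eball (vzero d) 1 b = (eudist (vzero d) b <= 1) by [].
have mink (A : set pt) u : minkowski_sum A (eball (vzero d) 1) u <->
    exists2 c, A c & eudist u c <= 1.
  split.
    move=> [a Aa [b b1 <-]]; exists a => //; move: b1; rewrite eb0.
    rewrite eudistC !eudistE => b1; apply: le_trans b1.
    rewrite le_eqVlt; apply/orP; left; apply/eqP; apply: eq_fnorm => i.
    by rewrite !tnth_mktuple; ring.
  move=> [c Ac uc]; exists c => //; exists (vsub u c).
    rewrite eb0 eudistC; apply: le_trans uc; rewrite !eudistE.
    rewrite le_eqVlt; apply/orP; left; apply/eqP; apply: eq_fnorm => i.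
    by rewrite !tnth_mktuple; ring.
  by apply/eq_from_tnth => i; rewrite !tnth_mktuple; ring.
move=> /h_condE hw; apply/seteqP; split => u.
- case: p hw => hw; case: q => /=.
  + move=> /mink[c cw uc]; exists setT => //=; exists c => x [[j _ <-]|->//].
    exact: cw.
  + move=> [i _ /mink[c cw uc]]; exists [set j | j != i]; first by exists i.
    by exists c => x [[j ji <-]|->//]; exact: cw.
  + move=> H; exists setT => //= x y [[j _ <-]|->] [[m _ <-]|->].
    * by apply: hw; [exists j|exists m].
    * by rewrite mulr1; exact: H.
    * by rewrite mulr1 eudistC; exact: H.
    * by rewrite eudistxx mulr1.
  + move=> [i _ H]; exists [set j | j != i]; first by exists i.
    move=> x y [[j ji <-]|->] [[m mi <-]|->].
    * by apply: hw; [exists j|exists m].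
    * by rewrite mulr1; exact: H.
    * by rewrite mulr1 eudistC; exact: H.
    * by rewrite eudistxx mulr1.
- case: p hw => hw; case: q => /= -[J].
  + move=> -> [c Hc]; apply/mink; exists c; last by apply: Hc; right.
    by move=> j _; apply: Hc; left; exists j.
  + move=> [i ->] [c Hc]; exists i => //; apply/mink; exists c; last by apply: Hc; right.
    by move=> j ji; apply: Hc; left; exists j.
  + move=> -> H j _; rewrite /eball/= -[2]mulr1; apply: H; last by right.
    by left; exists j.
  + move=> [i ->] H; exists i => // j ji; rewrite /eball/= -[2]mulr1; apply: H; last by right.
    by left; exists j.
Qed.

End family.

End simplex.

(** * Lebesgue measure on tuples *)

Definition vaff (R : realType) d (b : d.-tuple R) (a : R) (x : d.-tuple R) : d.-tuple R :=
  [tuple tnth b i + a * tnth x i | i < d].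

Section cons_measure.
Context {R : realType} (d : nat).
Variable mu : {sigma_finite_measure set (d.-tuple R) -> \bar R}.

Definition cons_pair (p : R * d.-tuple R) : d.+1.-tuple R := [tuple of p.1 :: p.2].

Let mcons : measurable_fun [set: measurableTypeR R * d.-tuple R] cons_pair.
Proof.
have := @measurable_cons _ _ (measurableTypeR R * d.-tuple R)%type R fst d snd.
by apply.
Qed.

Definition cons_measure : set (d.+1.-tuple R) -> \bar R :=
  pushforward (@lebesgue_measure R \x mu)%E cons_pair.

Let cons_measure0 : cons_measure set0 = 0%E.
Proof. by rewrite /cons_measure /pushforward preimage_set0 measure0. Qed.

Let cons_measure_ge0 (A : set (d.+1.-tuple R)) : (0 <= cons_measure A)%E.
Proof. by apply: integral_ge0 => x _; exact: measure_ge0. Qed.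

Let cons_measure_sa : semi_sigma_additive cons_measure.
Proof.
move=> F mF tF mUF; rewrite /cons_measure /pushforward preimage_bigcup.
apply: measure_semi_sigma_additive.
- by move=> n; rewrite -[X in measurable X]setTI; exact: mcons.
- apply/trivIsetP => /= i j _ _ ij; rewrite -preimage_setI.
  by move/trivIsetP : tF => /(_ _ _ _ _ ij) ->//; rewrite preimage_set0.
- by rewrite -preimage_bigcup -[X in measurable X]setTI; exact: mcons.
Qed.

HB.instance Definition _ := isMeasure.Build _ _ _ cons_measure
  cons_measure0 cons_measure_ge0 cons_measure_sa.

Lemma cons_measureX (A : set R) (B : set (d.-tuple R)) :
  measurable A -> measurable B ->
  cons_measure [set x | A (thead x) /\ B [tuple of behead x]] =
  (lebesgue_measure A * mu B)%E.
Proof.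
move=> mA mB; rewrite -product_measure1E//; congr product_measure1.
have bE (x : R) (t : d.-tuple R) : [tuple of behead [tuple of x :: t]] = t :> d.-tuple R.
  exact/val_inj.
by apply/seteqP; split => [[x t]|[x t]]; rewrite /cons_pair/= theadE bE.
Qed.

Let cons_measure_sf : sigma_finite setT cons_measure.
Proof.
have /sigma_finiteP[F [TF ndF Foo]] := sigma_finiteT (@lebesgue_measure R).
have /sigma_finiteP[G [TG ndG Goo]] := sigma_finiteT mu.
exists (fun n => [set x | F n (thead x) /\ G n [tuple of behead x]]).
  apply/seteqP; split => // x _.
  have [n _ Fn] : (\bigcup_i F i) (thead x) by rewrite -TF.
  have [m _ Gm] : (\bigcup_i G i) [tuple of behead x] by rewrite -TG.
  exists (maxn n m) => //; split.
  - by move: Fn; exact/subsetPset/ndF/leq_maxl.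
  - by move: Gm; exact/subsetPset/ndG/leq_maxr.
move=> k; have [? ?] := Foo k; have [? ?] := Goo k.
split; last by rewrite cons_measureX// lte_mul_pinfty// ge0_fin_numE.
rewrite (_ : [set x | _] = (@thead d R) @^-1` (F k) `&`
    (fun x : d.+1.-tuple R => [tuple of behead x]) @^-1` (G k))//.
apply: measurableI; rewrite -[X in measurable X]setTI.
  exact: measurable_tnth.
exact: measurable_behead.
Qed.

HB.instance Definition _ := Measure_isSigmaFinite.Build _ _ _ cons_measure
  cons_measure_sf.

End cons_measure.

Section lebesgue_tuple.
Context {R : realType}.

(** The product construction of the next dimension asks for a sigma-finite factor, so the induction
    carries sigma-finiteness along with the measure property. *)
Lemma lebesgue_tuple_is_measure d :
  exists mu : {sigma_finite_measure set (d.-tuple R) -> \bar R},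
    @lebesgue_tuple R d = mu :> (set _ -> \bar R).
Proof.
elim: d => [|d [mu IH]]; first by exists (\d_([tuple])).
by exists (cons_measure mu); rewrite /= IH.
Qed.

Definition lebesgue_tuple_measure d :
    {sigma_finite_measure set (d.-tuple R) -> \bar R} :=
  sval (cid (lebesgue_tuple_is_measure d)).

Lemma lebesgue_tupleE d : @lebesgue_tuple R d = lebesgue_tuple_measure d.
Proof. by rewrite /lebesgue_tuple_measure; case: cid. Qed.

Lemma lebesgue_tupleS d : @lebesgue_tuple R d.+1 = cons_measure (lebesgue_tuple_measure d).
Proof. by rewrite /= lebesgue_tupleE. Qed.

Lemma measurable_box d (B : 'I_d -> set R) : (forall i, measurable (B i)) ->
  measurable [set x : d.-tuple R | forall i, B i (tnth x i)].
Proof.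
move=> mB.
rewrite (_ : [set x | _] = \bigcap_(i in [set: 'I_d]) (fun x => tnth x i) @^-1` B i); last first.
  by apply/seteqP; split => x /= Bx i; [move=> _; exact: Bx|exact: Bx].
apply: fin_bigcap_measurable => // i _; rewrite -[X in measurable X]setTI.
exact: measurable_tnth.
Qed.

Lemma lebesgue_tuple_box d (B : 'I_d -> set R) : (forall i, measurable (B i)) ->
  lebesgue_tuple [set x : d.-tuple R | forall i, B i (tnth x i)] =
  (\prod_(i < d) lebesgue_measure (B i))%E.
Proof.
elim: d B => [|d IH] B mB.
  by rewrite big_ord0 /= diracE mem_set//= => -[].
rewrite lebesgue_tupleS big_ord_recl -IH// lebesgue_tupleE.
rewrite -(@cons_measureX _ _ _ (B ord0) [set x | forall i, B (lift ord0 i) (tnth x i)])//; last exact: (measurable_box (fun i => mB (lift ord0 i))).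
congr (cons_measure _ _); apply/seteqP; split => x /=.
  move=> Bx; split; first exact: Bx.
  by move=> i; have := Bx (lift ord0 i); rewrite {1}(tuple_eta x) tnthS.
move=> [B0 Bx] i; case: (unliftP ord0 i) => [j ->|->]; last exact: B0.
by rewrite (tuple_eta x) tnthS.
Qed.

(** By uniqueness of Lebesgue measure: [a] times the pushforward along [x |-> b + a * x] agrees with
    it on half-open intervals. *)
Lemma lebesgue_measure_affine (a b : R) (A : set R) : 0 < a -> measurable A ->
  lebesgue_measure [set x | A (b + a * x)] = (a^-1%:E * lebesgue_measure A)%E.
Proof.
move=> a0 mA.
pose f : measurableTypeR R -> measurableTypeR R := fun x => b + a * x.
have mf : measurable_fun setT f.
  apply: (@measurable_funD _ _ _ setT (cst b) (fun x : measurableTypeR R => a * x)).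
    exact: measurable_cst.
  exact: mulrl_measurable.
have [m' m'E] : exists m' : {measure set (measurableTypeR R) -> \bar R},
    forall B, m' B = lebesgue_measure (f @^-1` B).
  by exists (measure_function_pushforward__canonical__measure_function_Measure
               (@lebesgue_measure R) mf).
suff -> : lebesgue_measure A = mscale (NngNum (ltW a0)) m' A.
  by rewrite /mscale m'E muleA -EFinM mulVf ?mul1e// gt_eqF.
apply: lebesgue_measure_unique => //= _ [[u v]] _ <-.
rewrite /mscale m'E /=.
rewrite (_ : f @^-1` _ = `]((u - b) / a), ((v - b) / a)]%classic); last first.
  apply/seteqP; split => x; rewrite /f /= !in_itv /=;
  by rewrite ltr_pdivrMr// ler_pdivlMr// ltrBlDl lerBrDl [x * a]mulrC.
rewrite !lebesgue_measure_itv /= !lte_fin.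
rewrite ltr_pM2r ?invr_gt0// ltrD2r; case: ifPn => _; last by rewrite mule0.
by rewrite -!EFinD -EFinM; congr EFin; field; rewrite gt_eqF.
Qed.

Lemma measurable_vaff d (b : d.-tuple R) (a : R) :
  measurable_fun setT (vaff b a).
Proof.
apply/measurable_fun_tnthP => i.
rewrite (_ : _ \o _ = (cst (tnth b i)) \+ (fun x => a * tnth x i)); last first.
  by apply/funext => x; rewrite /= tnth_mktuple.
apply: measurable_funD; first exact: measurable_cst.
apply: measurable_funM; first exact: measurable_cst.
exact: measurable_tnth.
Qed.

Lemma measurable_vaff_preimage d (b : d.-tuple R) (a : R) (A : set (d.-tuple R)) :
  measurable A -> measurable [set x | A (vaff b a x)].
Proof.
by move=> mA; rewrite -[X in measurable X]setTI; exact: measurable_vaff.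
Qed.

(** Induction on the dimension, by sections: the section of the preimage at [x] is an affine
    preimage of the section of [A] at [thead b + a * x]. The induction hypothesis gives [d] factors
    and the one-dimensional change of variables the last one. *)
Lemma lebesgue_tuple_vaff d (b : d.-tuple R) (a : R) (A : set (d.-tuple R)) :
  0 < a -> measurable A ->
  lebesgue_tuple [set x | A (vaff b a x)] = ((a^-1 ^+ d)%:E * lebesgue_tuple A)%E.
Proof.
move=> a0; elim: d b A => [|d IH] b A mA.
  rewrite expr0 mul1e; congr lebesgue_tuple; apply/seteqP.
  by split => x /=; rewrite (_ : vaff b a x = x)//; apply/eq_from_tnth => -[].
rewrite lebesgue_tupleS /cons_measure /pushforward /product_measure1.
pose phi (x : R) := lebesgue_tuple [set t : d.-tuple R | A [tuple of x :: t]].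
have sec (S : set (d.+1.-tuple R)) (x : R) :
    xsection (@cons_pair R d @^-1` S) x = [set t : d.-tuple R | S [tuple of x :: t]].
  by apply/seteqP; split => t; rewrite /xsection /= inE.
have vS (x : R) (t : d.-tuple R) :
   vaff b a [tuple of x :: t] = [tuple of (thead b + a * x) :: vaff [tuple of behead b] a t].
  apply/eq_from_tnth => i; rewrite tnth_mktuple; case: (unliftP ord0 i) => [j ->|->].
    by rewrite !tnthS tnth_mktuple; congr (_ + _); rewrite {1}(tuple_eta b) tnthS.
  by rewrite !tnth0.
pose f : measurableTypeR R -> measurableTypeR R := fun x => thead b + a * x.
have mf : measurable_fun setT f.
  apply: (@measurable_funD _ _ _ setT (cst (thead b)) (fun x : measurableTypeR R => a * x)).
    exact: measurable_cst.
  exact: mulrl_measurable.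
have mc : measurable (@cons_pair R d @^-1` A).
  have := @measurable_cons _ _ (measurableTypeR R * d.-tuple R)%type R fst d snd.
  move=> /(_ measurable_fst measurable_snd measurableT _ mA).
  by rewrite setTI.
have mphi : measurable_fun [set: measurableTypeR R] phi.
  have := @measurable_fun_xsection _ _ (measurableTypeR R) (d.-tuple R) R (lebesgue_tuple_measure d) _ mc.
  rewrite (_ : (lebesgue_tuple_measure d \o _) = phi)//.
  by apply/funext => x /=; rewrite sec /phi lebesgue_tupleE.
have phi0 x : (0 <= phi x)%E by rewrite /phi lebesgue_tupleE; exact: measure_ge0.
rewrite (eq_integral (fun x => ((a^-1 ^+ d)%:E * (phi \o f) x)%E)); last first.
  move=> x _ /=; rewrite -lebesgue_tupleE sec /phi -(IH [tuple of behead b]).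
    by congr lebesgue_tuple; apply/seteqP; split => t /=; rewrite vS.
  have /(_ (f x)) := measurable_xsection _ mc.
  by rewrite sec.
rewrite ge0_integralZl//=; last 2 first.
- exact: (measurableT_comp mphi mf).
- by rewrite lee_fin exprn_ge0// invr_ge0 ltW.
rewrite -(@ge0_integral_pushforward _ _ _ _ _ f mf (@lebesgue_measure R) setT phi)//; last first.
rewrite exprSr EFinM -muleA; congr (_ * _)%E.
have ai0 : 0 <= a^-1 by rewrite invr_ge0 ltW.
rewrite (@eq_measure_integral _ _ _ setT (mscale (NngNum ai0) (@lebesgue_measure R))); last first.
  by move=> B mB _; exact: lebesgue_measure_affine.
rewrite ge0_integral_mscale//=; congr (_ * _)%E.
by apply: eq_integral => x _; rewrite -lebesgue_tupleE /= sec.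
Qed.

End lebesgue_tuple.

(** * Compactness and stability of the witness regions *)

Section compactness.
Context {R : realType} {d : nat}.
Local Notation pt := (d.-tuple R).

Lemma invS_small (e : R) : 0 < e -> exists N, forall n : nat, (N <= n)%N -> n.+1%:R^-1 < e.
Proof.
move=> e0; have [N _ HN] := near_infty_natSinv_lt (PosNum e0).
by exists N => n /HN.
Qed.

Lemma le_by_invS (a b : R) (C : R) :
  (forall N : nat, exists2 n : nat, (N <= n)%N & a <= b + C * n.+1%:R^-1) -> a <= b.
Proof.
move=> H; apply/ler_addgt0Pr => e e0.
have C0 : 0 < `|C| + 1 by rewrite ltr_wpDl.
have [N HN] := invS_small (divr_gt0 e0 C0).
have [n Nn /le_trans] := H N; apply; rewrite lerD2l.
have := HN _ Nn; rewrite ltr_pdivlMr// => h.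
have : 0 < n.+1%:R^-1 :> R by rewrite invr_gt0.
set x := n.+1%:R^-1 in h * => x0; have := ler_norm C; nra.
Qed.

(** Approximate common centres confined to a box accumulate, and the Lipschitz bound carries the
    inequality to the limit point. The function [f] is left general to serve both the Euclidean and
    the toroidal distance. *)
Lemma lipschitz_compact (I : Type) (S : set I) (f : I -> pt -> R) (a b rho : R) :
  (forall x c c', f x c <= f x c' + eudist c c') ->
  (forall m : nat, exists c : pt, (forall i, a <= tnth c i <= b) /\
      forall x, S x -> f x c <= rho + m.+1%:R^-1) ->
  exists c : pt, (forall i, a <= tnth c i <= b) /\ forall x, S x -> f x c <= rho.
Proof.
move=> flip /choice[c Hc].
pose F : set_system 'rV[R]_d := (fun m => \row_i tnth (c m) i) @ \oo.
have := @rV_compact R d (fun=> `[a, b]%classic) (fun=> @segment_compact R a b).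
move=> /(_ F _) []; first by exists 0%N => // m _ i /=; rewrite mxE in_itv/=; exact: (Hc m).1.
move=> p [pab clp].
exists [tuple p ord0 i | i < d]; split.
  by move=> i; rewrite tnth_mktuple; have := pab i; rewrite /= in_itv.
move=> x Sx; apply: (@le_by_invS _ _ (1 + d%:R)) => N.
pose e : R := N.+1%:R^-1.
have e0 : 0 < e by rewrite /e invr_gt0.
pose A : set 'rV[R]_d := [set v | exists2 m : nat, (N <= m)%N & v = \row_i tnth (c m) i].
have [||v [[m Nm ->]] [_ pv]] := clp A (ball p e).
- by exists N => // m Nm; exists m.
- exact: nbhsx_ballx.
exists N => //; apply: (le_trans (flip _ _ (c m))).
have h1 : f x (c m) <= rho + N.+1%:R^-1.
  apply: (le_trans ((Hc m).2 _ Sx)); rewrite lerD2l lef_pV2 ?posrE//.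
  by rewrite ler_nat.
have h2 : eudist [tuple p ord0 i | i < d] (c m) <= d%:R * e.
  apply: eudist_le_max => i; rewrite tnth_mktuple.
  by have := pv ord0 i; rewrite mxE /ball/= => /ltW.
by rewrite mulrDl mul1r addrA lerD.
Qed.

Definition seq_closed (A : set pt) :=
  forall x, (forall m : nat, exists2 y, A y & eudist x y <= m.+1%:R^-1) -> A x.

Lemma countable_bigcup_measurable (T : countType) (F : T -> set pt) :
  (forall g, measurable (F g)) -> measurable (\bigcup_g F g).
Proof.
move=> mF.
rewrite (_ : \bigcup_g F g = \bigcup_(n in [set: nat])
   (if @choice.unpickle T n is Some g then F g else set0)).
  by apply: bigcupT_measurable => n; case: (choice.unpickle _).
apply/seteqP; split => [x [g _ Fg]|x [n _]].
  by exists (choice.pickle g) => //; rewrite choice.pickleK.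
by case: (choice.unpickle _) => // g Fg; exists g.
Qed.

(** For each mesh take the countable union of the grid cells that meet [A]. A point lying in all
    these unions is approximated by points of [A], hence belongs to it. *)
Lemma seq_closed_measurable (A : set pt) : seq_closed A -> measurable A.
Proof.
move=> cA.
pose cell m (g : d.-tuple int) : set pt :=
  [set x | forall i, `[(tnth g i)%:~R / m.+1%:R, ((tnth g i)%:~R + 1) / m.+1%:R[%classic (tnth x i)].
pose G m (g : d.-tuple int) := if `[< exists2 y, A y & cell m g y >] then cell m g else set0.
rewrite (_ : A = \bigcap_(m in [set: nat]) \bigcup_g G m g).
  apply: bigcapT_measurable => m; apply: countable_bigcup_measurable => g.
  rewrite /G; case: ifP => // _; exact: (measurable_box (fun i => measurable_itv _)).
apply/seteqP; split => [x Ax m _|x Hx].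
  pose g : d.-tuple int := [tuple Num.floor (tnth x i * m.+1%:R) | i < d].
  have xg : cell m g x.
    move=> i; rewrite /= in_itv/= tnth_mktuple ler_pdivrMr// ltr_pdivlMr//.
    have := floor_itv (tnth x i * m.+1%:R); rewrite intrD => /andP[-> h].
    by rewrite h.
  exists g => //; rewrite /G ifT//; apply/asboolP; by exists x.
have Hd m : exists2 y, A y & eudist x y <= d%:R * m.+1%:R^-1.
  have [g _] := Hx m I; rewrite /G; case: ifP => // /asboolP[y Ay yg] xg.
  exists y => //; apply: eudist_le_max => i.
  have := xg i; have := yg i; rewrite /= !in_itv/= mulrDl mul1r => /andP[y1 y2] /andP[x1 x2].
  move: (m.+1%:R^-1 : R) x1 x2 y1 y2 => v x1 x2 y1 y2.
  by rewrite ler_norml; apply/andP; split; lra.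
apply: cA => m.
have : 0 < (m.+1%:R : R)^-1 / (d%:R + 1) by rewrite divr_gt0 ?invr_gt0// ltr_wpDl.
move=> /invS_small[N /(_ _ (leqnn N))]; rewrite ltr_pdivlMr ?ltr_wpDl// => HN.
have [y Ay xy] := Hd N; exists y => //; apply: (le_trans xy); apply: le_trans (ltW HN).
have v0 : 0 <= (N.+1%:R : R)^-1 by rewrite invr_ge0.
by rewrite mulrDr mulr1 mulrC lerDl.
Qed.

Lemma eudist_clamp (u c : pt) (a : R) i : eudist u c <= a ->
  - (\sum_j `|tnth u j| + a) <= tnth c i <= \sum_j `|tnth u j| + a.
Proof.
move=> uc; rewrite -ler_norml.
have h1 := le_trans (eudist_coord u c i) uc.
have h2 : `|tnth u i| <= \sum_j `|tnth u j|.
  by rewrite (bigD1 i)//= lerDl sumr_ge0.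
have -> : tnth c i = tnth u i - (tnth u i - tnth c i) by ring.
by rewrite (le_trans (ler_normB _ _))// lerD.
Qed.

Lemma esimplex_add_closed p (S : set pt) : seq_closed [set u | esimplex p 1 (S `|` [set u])].
Proof.
case: p => u /=.
(* A centre of an approximating simplex is within [1 + 1 / (m + 1) <= 2] of [u], so all these
   centres stay in one box. *)
- move=> H; pose b : R := \sum_j `|tnth u j| + 2.
  pose f (x c : pt) := eudist x c.
  have [||c [_ Hc]] := @lipschitz_compact pt (S `|` [set u]) f (- b) b 1.
  + by move=> x c c'; rewrite /f [eudist c c']eudistC; exact: eudist_triangle.
  + move=> m; have [v [c Hc] uv] := H m.
    have uc : eudist u c <= 1 + m.+1%:R^-1.
      rewrite (le_trans (eudist_triangle v _ _))// addrC lerD//.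
      by apply: Hc; right.
    have m1 : (m.+1%:R : R)^-1 <= 1 by rewrite invf_le1// ler1n.
    exists c; split => [i|x [Sx|->//]].
      by apply: eudist_clamp; apply: (le_trans uc); rewrite -lerBrDl (le_trans m1)//; lra.
    by rewrite (le_trans (Hc _ _)) ?lerDl ?invr_ge0//; left.
  + by exists c => x /Hc.
- move=> H.
  have Su x : S x -> eudist x u <= 2 * 1.
    move=> Sx; apply: (@le_by_invS _ _ 1) => N; exists N => //.
    have [v Hv uv] := H N; rewrite mul1r (le_trans (eudist_triangle v _ _))// lerD//.
      by apply: Hv; [left|right].
    by rewrite eudistC.
  have [v Hv _] := H 0%N.
  move=> x y [Sx|->] [Sy|->].
  + by apply: Hv; left.
  + exact: Su.
  + by rewrite eudistC; exact: Su.
  + by rewrite eudistxx mulr1.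
Qed.

Lemma witness_measurable k p q (w : 'I_k.+1 -> pt) : measurable (witness p q w).
Proof.
have mJ (J : set 'I_k.+1) : measurable [set u | esimplex p 1 (w @` J `|` [set u])].
  by apply: seq_closed_measurable; exact: esimplex_add_closed.
case: q.
  rewrite (_ : witness _ _ _ = [set u | esimplex p 1 (w @` setT `|` [set u])])//.
  by apply/seteqP; split => [u [J -> //]|u Hu]; exists setT.
rewrite (_ : witness _ _ _ = \bigcup_(i in [set: 'I_k.+1])
   [set u | esimplex p 1 (w @` [set j | j != i] `|` [set u])]).
  by apply: fin_bigcup_measurable => // i _; exact: mJ.
apply/seteqP; split => [u [_ [i ->] Hu]|u [i _ Hu]]; first by exists i.
by exists [set j | j != i] => //; exists i.
Qed.

End compactness.

Section stability.
Context {R : realType} {d k : nat}.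
Local Notation pt := (d.-tuple R).
Implicit Types (w : 'I_k.+1 -> pt) (J : set 'I_k.+1).

(* By Stewart's identity, the point [v] at distance [s] from [c] on the segment
   towards [c'] gains enough to absorb the perturbation [eta]; a modulus of order
   [sqrt eta] cannot be improved, since two unit balls may be tangent. *)
Lemma cech_recenter (s eta : R) w w' J (c c' : pt) :
  0 < s -> 2 * eta + eta ^+ 2 <= s ^+ 2 -> 0 <= eta ->
  (forall j, J j -> eudist (w j) c <= 1) ->
  (forall j, J j -> eudist (w' j) c' <= 1) ->
  (forall j, eudist (w j) (w' j) <= eta) ->
  exists2 v, (forall j, J j -> eudist (w' j) v <= 1) & eudist c v <= s.
Proof.
move=> s0 etas eta0 wc w'c' ww'; set L := eudist c c'.
have [Ls|sL] := leP L s; first by exists c'.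
have L0 : 0 < L by rewrite (lt_trans s0).
have t01 : 0 <= s / L <= 1.
  by rewrite divr_ge0 ?(ltW s0) ?(ltW L0)//= ler_pdivrMr// mul1r ltW.
exists (vcomb (s / L) c c'); last first.
  rewrite eudistC eudist_vcombx; last by case/andP: t01.
  by rewrite -/L divfK// gt_eqF.
move=> j Jj; rewrite -(@ler_pXn2r _ 2) ?nnegrE ?eudist_ge0// expr1n.
rewrite eudistC eudist_stewart -/L.
have A1 : eudist c (w' j) <= 1 + eta.
  by rewrite (le_trans (eudist_triangle (w j) _ _))// lerD// eudistC wc.
have A2 : eudist c' (w' j) <= 1 by rewrite eudistC w'c'.
have A1' : eudist c (w' j) ^+ 2 <= (1 + eta) ^+ 2.
  by rewrite ler_pXn2r// nnegrE ?eudist_ge0// addr_ge0.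
have A2' : eudist c' (w' j) ^+ 2 <= 1.
  by rewrite -[leRHS](expr1n _ 2) ler_pXn2r// nnegrE ?eudist_ge0.
have tL : s / L * L = s by rewrite divfK// gt_eqF.
move: t01 tL; set t := s / L => /andP[t0 t1] tL.
have B : t * L ^+ 2 >= s ^+ 2.
  have -> : t * L ^+ 2 = s * L by rewrite -tL; ring.
  by rewrite expr2 ler_wpM2l// ltW.
have B' : t * (1 - t) * L ^+ 2 = (1 - t) * (t * L ^+ 2) by ring.
rewrite B'; set E := t * L ^+ 2 in B *.
have T : 0 <= 1 - t by rewrite subr_ge0.
have := ler_wpM2l T B; have := ler_wpM2l T A1'; have := ler_wpM2l t0 A2'.
have := ler_wpM2l T etas.
set X := eudist c _ ^+ 2; set Y := eudist c' _ ^+ 2.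
lra.
Qed.

(** Both inclusions between the regions of [w] and [w'], up to the homothety of centre [c0] and
    ratio [1 - s]. Quantifying over [J] covers [Up] and [Down] at once. The point [c0] depends on
    [w] only, so that a single region serves all nearby feasible [w']. *)
Definition stable_at p (s eta : R) w (c0 : pt) :=
  forall w', esimplex p 1 (range w') -> (forall j, eudist (w j) (w' j) <= eta) ->
  forall J u,
    (esimplex p 1 (w @` J `|` [set u]) -> esimplex p 1 (w' @` J `|` [set vcomb s u c0])) /\
    (esimplex p 1 (w' @` J `|` [set u]) -> esimplex p 1 (w @` J `|` [set vcomb s u c0])).

(** Take for [c0] a common centre of [w]. Pulling [u] and its centre [c] towards [c0] shortens their
    distance to [1 - s], which leaves room [s] for recentring. In the other direction one recentres
    first and then contracts: [(1 - s) * (1 + s) <= 1]. The value [eta = s ^+ 2 / 3] is what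
    [cech_recenter] asks for. *)
Lemma cech_stable (s : R) : 0 < s < 1 -> exists2 eta : R, 0 < eta &
  forall w, esimplex Cech 1 (range w) -> exists c0, stable_at Cech s eta w c0.
Proof.
move=> /andP[s0 s1]; pose eta := s ^+ 2 / 3.
have eta0 : 0 < eta by rewrite divr_gt0// exprn_gt0.
have etas : 2 * eta + eta ^+ 2 <= s ^+ 2.
  have : s ^+ 2 <= 1 by rewrite expr_le1// ltW.
  have : 0 < s ^+ 2 by rewrite exprn_gt0.
  rewrite /eta; set x := s ^+ 2; nra.
have s01 : 0 <= s <= 1 by rewrite !ltW.
exists eta => // w [c0 Hc0]; exists c0 => w' [c0' Hc0'] ww' J u.
have w'w j : eudist (w' j) (w j) <= eta by rewrite eudistC.
have c0w j : eudist c0 (w j) <= 1 by rewrite eudistC; apply: Hc0; exists j.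
have conv c : (forall j, J j -> eudist (w j) c <= 1) ->
    forall j, J j -> eudist (w j) (vcomb s c c0) <= 1.
  move=> Hc j Jj; rewrite eudistC (le_trans (eudist_vcombl _ _ _ s01))//.
  by have := Hc _ Jj; have := c0w j; rewrite [eudist (w j) c]eudistC; nra.
split => -[c Hc].
- have Hc1 := conv c (fun j Jj => Hc _ (or_introl (ex_intro2 _ _ j Jj erefl))).
  have [|v Hv cv] := cech_recenter s0 etas (ltW eta0) Hc1 _ ww' (c' := c0').
    by move=> j _; apply: Hc0'; exists j.
  exists v => x [[j Jj <-]|->]; first exact: Hv.
  rewrite (le_trans (eudist_triangle (vcomb s c c0) _ _))// eudist_vcomb_vcomb//.
  have : eudist u c <= 1 by apply: Hc; right.
  move: cv; set D := eudist _ v; set E := eudist u c; nra.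
- have Hc1 j : J j -> eudist (w' j) c <= 1 by move=> Jj; apply: Hc; left; exists j.
  have [|v Hv cv] := cech_recenter s0 etas (ltW eta0) Hc1 _ w'w (c' := c0).
    by move=> j _; apply: Hc0; exists j.
  exists (vcomb s v c0) => x [[j Jj <-]|->]; first exact: conv Hv j Jj.
  rewrite eudist_vcomb_vcomb//.
  have uv : eudist u v <= 1 + s.
    by rewrite (le_trans (eudist_triangle c _ _))// lerD// Hc//; right.
  nra.
Qed.

Lemma fnorm_sum (I : finType) (n : nat) (F : 'I_n -> I -> R) :
  fnorm (fun i => \sum_(m < n) F m i) <= \sum_(m < n) fnorm (F m).
Proof.
elim: n F => [|n IH] F.
  rewrite big_ord0 (eq_fnorm (g := fun i : I => 0 * 0)); last by move=> i; rewrite big_ord0 mul0r.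
  by rewrite fnormZ normr0 mul0r.
rewrite big_ord_recl; apply: le_trans (lerD (lexx _) (IH _)).
apply: le_trans (fnormD _ _); rewrite le_eqVlt; apply/orP; left; apply/eqP.
by apply: eq_fnorm => i; rewrite big_ord_recl.
Qed.

(** Among the [k.+1] averaged differences the [j]-th vanishes, so the mean is at most
    [2 * k / (k + 1)]. The centroid is thus strictly closer than [2] to every vertex, which is the
    slack used for Rips. *)
Lemma centroid_dist w j : esimplex Rips 1 (range w) ->
  eudist [tuple k.+1%:R^-1 * \sum_(m < k.+1) tnth (w m) i | i < d] (w j) <= 2 - 2 * k.+1%:R^-1.
Proof.
move=> Hw; set K : R := k.+1%:R.
have K0 : K != 0 by rewrite pnatr_eq0.
rewrite eudistE (eq_fnorm (g := fun i => K^-1 * \sum_(m < k.+1) (tnth (w m) i - tnth (w j) i))); last first.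
  move=> i; rewrite tnth_mktuple sumrB sumr_const card_ord -/K mulrBr; congr (_ - _).
  by rewrite -[tnth (w j) i *+ _]mulr_natl mulKf.
rewrite fnormZ ger0_norm ?invr_ge0//.
apply: (@le_trans _ _ (K^-1 * (\sum_(m < k.+1) (if m == j then 0 else 2)))).
  rewrite ler_wpM2l ?invr_ge0//; apply: (le_trans (fnorm_sum _)); apply: ler_sum => m _.
  rewrite -eudistE; case: eqVneq => [->|_]; first by rewrite eudistxx.
  by rewrite -[leRHS]mulr1; apply: Hw; [exists m|exists j].
rewrite (bigD1 j)//= eqxx add0r (eq_bigr (fun=> 2)); last by move=> m /negbTE ->.
rewrite sumr_const cardC1 card_ord /= -[2 *+ k]mulr_natl.
rewrite (_ : k%:R = K - 1); last by rewrite /K -addn1 natrD addrK.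
by rewrite mulrA mulrBr mulVf// mulr1 mulrBl mul1r [_ * 2]mulrC.
Qed.

(** Pulling [u] by [s] towards the centroid lowers the bound on its distance to each vertex by
    [2 * s / (k + 1)], which is [eta]: enough to absorb the perturbation of the vertices. The
    modulus is linear here, unlike for Cech. *)
Lemma rips_stable (s : R) : 0 < s < 1 -> exists2 eta : R, 0 < eta &
  forall w, esimplex Rips 1 (range w) -> exists c0, stable_at Rips s eta w c0.
Proof.
move=> /andP[s0 s1]; pose K : R := k.+1%:R^-1; pose eta := 2 * s * K.
have K0 : 0 < K by rewrite invr_gt0.
have eta0 : 0 < eta by rewrite !mulr_gt0.
have s01 : 0 <= s <= 1 by rewrite !ltW.
exists eta => // w Hw.
exists [tuple k.+1%:R^-1 * \sum_(m < k.+1) tnth (w m) i | i < d] => w' Hw' ww' J u.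
set c0 := [tuple _ | i < d].
have c0w j : eudist c0 (w j) <= 2 - 2 * K by exact: centroid_dist.
have near (z : 'I_k.+1 -> pt) (e : R) j : eudist u (w j) <= 2 + e -> e <= eta ->
    eudist (vcomb s u c0) (w j) <= 2 - 2 * s * K + (1 - s) * e.
  move=> uz ee; rewrite (le_trans (eudist_vcombl _ _ _ s01))//.
  have := c0w j; have T : 0 <= 1 - s by lra.
  move=> /(ler_wpM2l (ltW s0)); have := ler_wpM2l T uz; lra.
have fin (z : 'I_k.+1 -> pt) v : esimplex Rips 1 (range z) ->
    (forall j, J j -> eudist v (z j) <= 2) -> esimplex Rips 1 (z @` J `|` [set v]).
  move=> Hz Hv x y [[j Jj <-]|->] [[m Jm <-]|->].
  + by apply: Hz; [exists j|exists m].
  + by rewrite mulr1 eudistC; exact: Hv.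
  + by rewrite mulr1; exact: Hv.
  + by rewrite eudistxx mulr1.
split => Hu; apply: fin => // j Jj.
- have := near w 0 j; rewrite addr0 mulr0 addr0 => nearj.
  have : eudist (vcomb s u c0) (w j) <= 2 - 2 * s * K.
    by apply: nearj; [rewrite -[leRHS]mulr1; apply: Hu; [right|left; exists j]|exact: ltW].
  move=> h; rewrite (le_trans (eudist_triangle (w j) _ _))//.
  by have := ww' j; rewrite /eta; lra.
- have := near w eta j.
  have uj : eudist u (w j) <= 2 + eta.
    rewrite (le_trans (eudist_triangle (w' j) _ _))// lerD//; last by rewrite eudistC.
    by rewrite -[leRHS]mulr1; apply: Hu; [right|left; exists j].
  move=> /(_ uj (lexx _)) h; apply: (le_trans h).
  have : 0 <= s * eta by rewrite mulr_ge0 ?ltW.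
  by rewrite /eta; lra.
Qed.

Lemma simplex_stable p (s : R) : 0 < s < 1 -> exists2 eta : R, 0 < eta &
  forall w, esimplex p 1 (range w) -> exists c0, stable_at p s eta w c0.
Proof. by case: p; [exact: cech_stable|exact: rips_stable]. Qed.

End stability.

(** * Simplices on the torus *)

Section torus_dist.
Context {R : realType} {d : nat}.
Local Notation pt := (d.-tuple R).
Implicit Types (x y u v c : pt) (z : 'I_d -> int).

Definition vshift x z : pt := [tuple tnth x i + (z i)%:~R | i < d].

Lemma vshiftD x z z' : vshift (vshift x z) z' = vshift x (fun i => z i + z' i).
Proof. by apply/eq_from_tnth => i; rewrite !tnth_mktuple intrD addrA. Qed.

Lemma vshift0 x : vshift x (fun=> 0) = x.
Proof. by apply/eq_from_tnth => i; rewrite tnth_mktuple addr0. Qed.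

Lemma vshiftK x z : vshift (vshift x z) (fun i => - z i) = x.
Proof. by apply/eq_from_tnth => i; rewrite !tnth_mktuple intrN addrK. Qed.

Lemma eudist_vshift2 x y z : eudist (vshift x z) (vshift y z) = eudist x y.
Proof. by rewrite !eudistE; apply: eq_fnorm => i; rewrite !tnth_mktuple; ring. Qed.

Lemma eudist_vshiftl x y z : eudist (vshift x z) y = eudist x (vshift y (fun i => - z i)).
Proof. by rewrite !eudistE; apply: eq_fnorm => i; rewrite !tnth_mktuple intrN; ring. Qed.

Lemma torus_enormE x y z :
  enorm (vadd (vsub x y) [tuple (z i)%:~R | i < d]) = eudist (vshift x z) y.
Proof. by apply: eq_fnorm => i; rewrite !tnth_mktuple; ring. Qed.

Lemma torus_dist_le x y z : torus_dist x y <= eudist (vshift x z) y.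
Proof.
apply: ge_inf; last by exists z => //; exact: torus_enormE.
by exists 0 => _ [z' _ <-]; exact: sqrtr_ge0.
Qed.

Lemma le_fnorm (I : finType) (f g : I -> R) : (forall i, `|f i| <= `|g i|) -> fnorm f <= fnorm g.
Proof.
move=> fg; rewrite ler_wsqrtr// ler_sum// => i _.
by rewrite -[leLHS]real_normK ?num_real// -[leRHS]real_normK ?num_real// ler_pXn2r// nnegrE.
Qed.

Lemma nearest_int (a : R) : exists m : int, forall n : int, `|a + m%:~R| <= `|a + n%:~R|.
Proof.
exists (- Num.floor (a + 2^-1)) => n; rewrite intrN.
have := floor_itv (a + 2^-1); set f := Num.floor _; rewrite intrD => /andP[f1 f2].
have [->|nf] := eqVneq n (- f); first by rewrite intrN.
have : 1 <= `|(n + f)%:~R : R|.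
  by rewrite -intr_norm ler1z -gtz0_ge1 normr_gt0 addr_eq0.
rewrite intrD => H.
have h : `|a - f%:~R| <= 2^-1 by rewrite ler_norml; apply/andP; split; lra.
have : `|n%:~R + f%:~R| <= `|a + n%:~R| + `|a - f%:~R|.
  by apply: le_trans (ler_normB _ _); rewrite le_eqVlt; apply/orP; left; apply/eqP; congr (`|_|); ring.
lra.
Qed.

(** The norm is monotone in the absolute value of each coordinate, so rounding coordinate by
    coordinate minimises it over all translates. Every later use of the toroidal metric goes through
    such a translate. *)
Lemma torus_dist_attained x y : exists z, torus_dist x y = eudist (vshift x z) y.
Proof.
have /choice[z Hz] : forall i : 'I_d, exists m : int, forall n : int,
   `|tnth x i - tnth y i + m%:~R| <= `|tnth x i - tnth y i + n%:~R|.
  by move=> i; exact: nearest_int.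
exists z; apply/eqP; rewrite eq_le torus_dist_le /=.
apply: lb_le_inf; first by exists (eudist (vshift x z) y), z => //; exact: torus_enormE.
move=> _ [z' _ <-]; rewrite torus_enormE !eudistE; apply: le_fnorm => i.
by rewrite !tnth_mktuple ![_ + _ - _]addrAC.
Qed.

Lemma torus_dist_lipr x c c' : torus_dist x c <= torus_dist x c' + eudist c c'.
Proof.
have [z ->] := torus_dist_attained x c'; apply: (le_trans (torus_dist_le _ _ z)).
by rewrite [eudist c c']eudistC eudist_triangle.
Qed.

Lemma torus_dist_lipl x x' c : torus_dist x c <= torus_dist x' c + eudist x x'.
Proof.
have [z ->] := torus_dist_attained x' c; apply: (le_trans (torus_dist_le _ _ z)).
by rewrite addrC -[eudist x x'](eudist_vshift2 _ _ z) eudist_triangle.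
Qed.

Lemma torus_dist_triangle x y c : torus_dist x y <= torus_dist x c + torus_dist y c.
Proof.
have [z ->] := torus_dist_attained x c; have [z' ->] := torus_dist_attained y c.
apply: (le_trans (torus_dist_le _ _ (fun i => z i - z' i))).
rewrite -vshiftD eudist_vshiftl (_ : (fun i => - - z' i) = z'); last by apply/funext => i; rewrite opprK.
by rewrite (le_trans (eudist_triangle c _ _))// lerD// eudistC.
Qed.

Lemma fundamental_shift u : exists z, forall i, 0 <= tnth (vshift u z) i < 1.
Proof.
exists (fun i => - Num.floor (tnth u i)) => i; rewrite tnth_mktuple intrN.
by have := floor_itv (tnth u i); rewrite intrD => /andP[? ?]; apply/andP; split; lra.
Qed.

Lemma cube_shift u : exists z, cube (vshift u z).
Proof.
have [z Hz] := fundamental_shift u; exists z => i.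
by have /andP[-> /ltW ->] := Hz i.
Qed.

(** A nonzero shift in coordinate [i] would put that coordinate of [x] at distance at least [rho]
    from that of [c], more than [t]. *)
Lemma torus_dist_deep x c (rho t : R) : (forall i, rho <= tnth x i <= 1 - rho) ->
  cube c -> t < rho -> torus_dist x c <= t -> eudist x c <= t.
Proof.
move=> xrho cc trho; have [z ->] := torus_dist_attained x c => H.
suff -> : x = vshift x z by [].
apply/eq_from_tnth => i; rewrite tnth_mktuple; suff -> : z i = 0 by rewrite addr0.
have := le_trans (eudist_coord _ _ i) H; rewrite tnth_mktuple ler_norml => /andP[h1 h2].
have /andP[x1 x2] := xrho i; have /andP[c1 c2] := cc i.
have : (-1)%:~R < (z i)%:~R :> R by rewrite intrN; lra.
have : (z i)%:~R < 1%:~R :> R by lra.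
by rewrite !ltr_int; case: (z i) => [[|n]|n]//.
Qed.

End torus_dist.

Section torus_simplex.
Context {R : realType} {d : nat}.
Local Notation pt := (d.-tuple R).
Implicit Types (p : complex_kind) (s : {fset pt}).

Lemma simplex_condS p r s s' : (s `<=` s')%fset -> @simplex_cond R d p r s' -> simplex_cond p r s.
Proof.
move=> /fsubsetP ss'; case: p => /=.
  by move=> [c Hc]; exists c => x xs; apply: Hc; exact: ss'.
by move=> H x y /ss' xs /ss' ys; exact: H.
Qed.

Lemma eudist_vaff (b : pt) (a : R) (x y : pt) : 0 < a ->
  eudist (vaff b a x) (vaff b a y) = a * eudist x y.
Proof.
move=> a0; rewrite !eudistE -[X in X * _]gtr0_norm// -fnormZ; apply: eq_fnorm => i.
by rewrite !tnth_mktuple; ring.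
Qed.

Lemma esimplex_vaff p (r a : R) (b : pt) (S : set pt) : 0 < a ->
  esimplex p r S -> esimplex p (a * r) (vaff b a @` S).
Proof.
move=> a0; have D (x y : pt) := eudist_vaff b x y a0.
case: p => /=.
  move=> [c Hc]; exists (vaff b a c) => _ [x Sx <-].
  by rewrite D ler_pM2l// Hc.
move=> H _ _ [x Sx <-] [y Sy <-].
by rewrite D mulrCA ler_pM2l// H.
Qed.

(** The Euclidean centre, or for Rips the midpoint of the two lifts, is translated back into the
    cube; toroidal distances to it are at most the Euclidean ones before translation. *)
Lemma simplex_cond_lift p (r : R) (S : set pt) s : 
  esimplex p r S -> (forall x, x \in s -> exists z, S (vshift x z)) -> simplex_cond p r s.
Proof.
have wrap (c : pt) : exists2 c', cube c' & forall x z, torus_dist x c' <= eudist (vshift x z) c.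
  have [z cz] := cube_shift c; exists (vshift c z) => // x z'.
  rewrite -(eudist_vshift2 _ _ z) vshiftD; exact: torus_dist_le.
case: p => /=.
  move=> [c Hc] sS; have [c' cc' Hc'] := wrap c; exists c' => x /= /sS[z Sx].
  split => //; exact: le_trans (Hc' _ _) (Hc _ Sx).
move=> H sS x y /sS[z Sx] /sS[z' Sy] _.
have [c' cc' Hc'] := wrap (vcomb 2^-1 (vshift x z) (vshift y z')); exists c'.
have D := H _ _ Sx Sy.
have h01 : 0 <= (2^-1 : R) <= 1 by apply/andP; split; lra.
split; split => //=.
  apply: (le_trans (Hc' _ z)); rewrite eudistC eudist_vcombx; last by case/andP: h01.
  by rewrite mulrC ler_pdivrMr// mulrC.
apply: (le_trans (Hc' _ z')); rewrite eudistC (le_trans (eudist_vcombl _ _ _ h01))//.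
rewrite eudistxx; lra.
Qed.

Lemma rips_torus_dist r s x y : 0 <= r -> @simplex_cond R d Rips r s -> x \in s -> y \in s ->
  torus_dist x y <= 2 * r.
Proof.
move=> r0 H xs ys; have [->|xy] := eqVneq x y.
  apply: (le_trans (torus_dist_le _ _ (fun=> 0))).
  by rewrite vshift0 eudistxx mulr_ge0.
have [c [[_ xc] [_ yc]]] := H x y xs ys (elimN eqP xy).
by rewrite (le_trans (torus_dist_triangle _ _ c))// mulr_natl mulr2n lerD.
Qed.

Lemma small_int_eq0 (m : int) : `|m%:~R : R| < 1 -> m = 0.
Proof.
by rewrite -intr_norm -[1]/(1%:~R) ltr_int => h; apply/eqP; rewrite -normr_eq0; case: m h => -[|?].
Qed.

(* A face of small radius lifts isometrically to R^d. *)
Lemma simplex_cond_unfold p r s : 0 < r -> 6 * r < 1 -> s != fset0 ->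
  (forall x, x \in s -> cube x) -> @simplex_cond R d p r s ->
  exists b, exists L : pt -> pt, [/\ cube b,
    (forall x, exists z, L x = vshift x z),
    (forall x, x \in s -> eudist (L x) b <= 2 * r) &
    esimplex p r (L @` [set` s])].
Proof.
move=> r0 r6 /fset0Pn[x0 x0s] scube Hs.
have Lat (b : pt) : exists L : pt -> pt,
    forall x, (exists z, L x = vshift x z) /\ eudist (L x) b = torus_dist x b.
  have /choice[L HL] : forall x, exists u : pt, (exists z, u = vshift x z) /\ eudist u b = torus_dist x b.
    move=> x; have [z Hz] := torus_dist_attained x b.
    by exists (vshift x z); split; [exists z|].
  by exists L.
case: p Hs => Hs.
  have [c Hc] := Hs; have [L HL] := Lat c.
  have Lc x : x \in s -> eudist (L x) c <= r.
    by move=> xs; rewrite (HL x).2; have [] := Hc _ xs.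
  exists c, L; split.
  - by have [] := Hc _ x0s.
  - by move=> x; exact: (HL x).1.
  - by move=> x /Lc /le_trans; apply; lra.
  - by exists c => _ [x xs <-]; exact: Lc.
have [L HL] := Lat x0.
have Lx0 x : x \in s -> eudist (L x) x0 <= 2 * r.
  by move=> xs; rewrite (HL x).2; apply: rips_torus_dist Hs xs x0s; exact: ltW.
exists x0, L; split => //; first exact: scube.
  by move=> x; exact: (HL x).1.
move=> _ _ [x xs <-] [y ys <-].
have [zx Ex] := (HL x).1; have [zy Ey] := (HL y).1.
have [z Ez] := torus_dist_attained x y.
have Hz : eudist (vshift x z) y <= 2 * r.
  by rewrite -Ez; apply: rips_torus_dist Hs xs ys; exact: ltW.
(* The lifts of [x] and [y] were chosen relative to [x0], and [z] relative to each other. Three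
   distances of at most [2 * r] add up to less than [1], so these integer shifts must be
   consistent. *)
suff E : z = fun i => zx i - zy i.
  rewrite Ex Ey [eudist (vshift x _) _]eudistC eudist_vshiftl eudistC vshiftD -E.
  exact: Hz.
apply/funext => i; apply/eqP; rewrite -subr_eq0; apply/eqP/small_int_eq0.
have := le_trans (eudist_coord _ _ i) Hz.
have := le_trans (eudist_coord _ _ i) (Lx0 _ xs).
have := le_trans (eudist_coord _ _ i) (Lx0 _ ys).
rewrite Ex Ey !tnth_mktuple !intrB !ler_norml ltr_norml => /andP[? ?] /andP[? ?] /andP[? ?].
apply/andP; split; lra.
Qed.

End torus_simplex.

(** * Isolated faces *)

Section isolated.
Context {R : realType} {d : nat}.
Local Notation pt := (d.-tuple R).
Local Open Scope fset_scope.
Implicit Types (X s t : {fset pt}) (p : complex_kind) (q : connectivity).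

(** The counterpart of [kept] for a face given by its vertices instead of an indexed family. *)
Definition kept_face q s s' : Prop :=
  match q with
  | Up => s' = s
  | Down => exists2 y, y \in s & s' = s `\ y
  end.

(* Isolation only depends on which sets of points are simplices. *)
Lemma isolatedP p q X r k s : (0 < k)%N ->
  isolated_face p q X r k s <->
  is_face p X r k s /\
  forall x, x \in X -> x \notin s -> forall s', kept_face q s s' ->
    ~ simplex_cond p r (x |` s').
Proof.
move=> k0; split=> -[fs H]; split => //; have [sX cs ss] := fs.
- move=> x xX xs; have xne y : y \in s -> x != y by move=> ys; apply: contraNneq xs => ->.
  have cxs y : y \in s -> #|` (x |` (s `\ y))| = k.+1.
    move=> ys; rewrite cardfsU1 !inE negb_and xs orbT/=.
    by move: cs; rewrite (cardfsD1 y) ys add1n => -[->].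
  have xsX y : x |` (s `\ y) `<=` X.
    by rewrite fsubUset fsub1set xX/= (fsubset_trans (fsubsetDl _ _)).
  have neq y : s <> x |` (s `\ y).
    by move=> E; move: xs; rewrite E !inE eqxx.
  case: q H => H s' /=.
  (* If [x] completes [s], exchanging any vertex [y] for [x] gives a neighbour, the union of the two
     faces being [s] with [x]. *)
  + move=> -> Hx.
    have [y ys] : exists y, y \in s by apply/fset0Pn; rewrite -cardfs_gt0 cs.
    apply: (H (x |` (s `\ y))).
      split => //; first exact: cxs.
      by apply: simplex_condS Hx; apply: fsetUS; exact: fsubsetDl.
    split => //; rewrite /face_adjacent (_ : s `|` (x |` (s `\ y)) = x |` s); last first.
      by rewrite fsetUCA; congr (_ |` _); apply/fsetUidPl; exact: fsubsetDl.
    split => //; first by rewrite fsubUset fsub1set xX.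
    by rewrite cardfsU1 xs cs.
  + move=> [y ys ->] Hx; apply: (H (x |` (s `\ y))); first by split => //; exact: cxs.
    split => //; rewrite (_ : s `&` (x |` (s `\ y)) = s `\ y); last first.
      apply/fsetP => u; rewrite !inE; case: (eqVneq u x) => [->|_] /=.
        by rewrite (negbTE xs) andbF.
      by rewrite andbC -andbA andbb.
    split; first by rewrite (fsubset_trans (fsubsetDl _ _)).
      by move: cs; rewrite (cardfsD1 y) ys add1n => -[->]; rewrite prednK.
    by apply: simplex_condS ss; exact: fsubsetDl.
- move=> t [tX ct st] [nst]; case: q H => H [+ cst sst].
  + move=> /= _.
    have /fsubsetPn[x xt xs] : ~~ (t `<=` s).
      apply/negP => /fsetUidPl E; rewrite E cs in cst.
      by move/eqP: cst; rewrite ltn_eqF.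
    apply: (H x _ xs s) => //; first by move/fsubsetP: tX; apply.
    by apply: simplex_condS sst; rewrite fsubUset fsub1set !inE xt orbT/= fsubsetUl.
  + move=> _; rewrite prednK// in cst.
    have /fsubsetPn[x xt xs] : ~~ (t `<=` s).
      apply/negP => /fsetIidPr E; rewrite E ct in cst.
      by move/eqP: cst; rewrite eqn_leq ltnn.
    have /fsubsetPn[y ys yt] : ~~ (s `<=` t).
      apply/negP => /fsetIidPl E; rewrite E cs in cst.
      by move/eqP: cst; rewrite eqn_leq ltnn.
    apply: (H x _ xs (s `\ y)) => //; first by move/fsubsetP: tX; apply.
      by exists y.
    have /eqP E : s `&` t == s `\ y.
      rewrite eqEfcard; apply/andP; split.
        apply/fsubsetP => u; rewrite !inE => /andP[us ut]; rewrite us andbT.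
        by apply: contraNneq yt => <-.
      by rewrite cst; move: cs; rewrite (cardfsD1 y) ys add1n => -[->].
    by apply: simplex_condS st; rewrite -E fsubUset fsub1set xt fsubsetIr.
Qed.

Section transfer.
Variables (p : complex_kind) (q : connectivity) (X : {fset pt}) (r r' : R) (k : nat) (phi : pt -> pt).
Hypothesis k0 : (0 < k)%N.
Hypothesis phi_inj : {in X &, injective phi}.
Hypothesis phi_simplex : forall s, s `<=` X -> simplex_cond p r s <-> simplex_cond p r' (phi @` s).

Let mem_phi s x : s `<=` X -> x \in X -> (phi x \in phi @` s) = (x \in s).
Proof.
move=> /fsubsetP sX xX; apply/imfsetP/idP => [[y /= ys] /phi_inj ->//|xs]; first exact: sX.
by exists x.
Qed.

Let phi_face s : s `<=` X -> is_face p X r k s <-> is_face p (phi @` X) r' k (phi @` s).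
Proof.
move=> sX; have sX' := fsubsetP sX.
have cE : #|` phi @` s| = #|` s|.
  by apply: card_in_imfset => x y /= xs ys; apply: phi_inj; exact: sX'.
split=> -[_ c1 c2]; split => //.
- by apply/fsubsetP => _ /imfsetP[x xs ->]; apply: in_imfset; exact: sX'.
- by rewrite cE.
- exact/phi_simplex.
- by rewrite -cE.
- exact/phi_simplex.
Qed.

Let phi_U1 s x : phi @` (x |` s) = phi x |` phi @` s.
Proof.
apply/fsetP => u; rewrite in_fset1U; apply/imfsetP/orP => [[y /=]|].
  rewrite !inE => /orP[/eqP -> ->|ys ->]; first by left.
  by right; exact: in_imfset.
move=> [/eqP ->|/imfsetP[y ys ->]]; first by exists x => //; rewrite !inE eqxx.
by exists y => //; rewrite !inE ys orbT.
Qed.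

Let phi_D1 s y : s `<=` X -> y \in s -> phi @` (s `\ y) = phi @` s `\ phi y.
Proof.
move=> /fsubsetP sX ys; apply/fsetP => u; rewrite in_fsetD1; apply/imfsetP/andP.
  move=> [x /=]; rewrite !inE => /andP[xy xs] ->; split; last exact: in_imfset.
  by apply: contraNneq xy => /phi_inj E; apply/eqP/E; exact: sX.
move=> [uy /imfsetP[x /= xs ux]]; exists x => //; rewrite !inE xs andbT.
by apply: contraNneq uy => xy; rewrite ux xy.
Qed.

Let phi_isolated s : s `<=` X ->
  isolated_face p q X r k s <-> isolated_face p q (phi @` X) r' k (phi @` s).
Proof.
move=> sX; have sX' := fsubsetP sX; rewrite !isolatedP//.
have kept_phi s' : kept_face q s s' -> s' `<=` X /\ kept_face q (phi @` s) (phi @` s').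
  case: q => /= [->//|[y ys ->]]; split; first by rewrite (fsubset_trans (fsubsetDl _ _)).
  by exists (phi y); [exact: in_imfset|exact: phi_D1].
have phi_kept s'' : kept_face q (phi @` s) s'' -> exists2 s', kept_face q s s' & s'' = phi @` s'.
  case: q => /= [->|[_ /imfsetP[y /= ys ->] ->]]; first by exists s.
  by exists (s `\ y); [exists y|rewrite phi_D1].
split=> -[fs H]; split.
- exact/phi_face.
- move=> _ /imfsetP[x /= xX ->]; rewrite mem_phi// => xs s'' /phi_kept[s' s's ->].
  have U : x |` s' `<=` X by rewrite fsubUset fsub1set xX (kept_phi _ s's).1.
  by rewrite -phi_U1 => /(phi_simplex U).2; exact: H.
- exact/phi_face.
- move=> x xX xs s' s's.
  have U : x |` s' `<=` X by rewrite fsubUset fsub1set xX (kept_phi _ s's).1.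
  move=> /(phi_simplex U).1; rewrite phi_U1.
  by apply: (H (phi x)); [exact: in_imfset|rewrite mem_phi|exact: (kept_phi _ s's).2].
Qed.

(** Isolation is combinatorial, so it is transported by an injection that respects simplices both
    ways. The radius may change as well: this is meant for rounding to a grid, where it grows by the
    rounding error. *)
Lemma num_isolated_imfset :
  num_isolated p q X r k = num_isolated p q (phi @` X) r' k.
Proof.
rewrite /num_isolated.
set A := [fset s in fpowerset X | _]; set B := [fset s in fpowerset _ | _].
have AX s : s \in A -> s `<=` X by rewrite !inE/= fpowersetE => /andP[].
have -> : B = (fun s : {fset pt} => phi @` s) @` A.
  apply/fsetP => t; apply/idP/imfsetP => /=.
    rewrite !inE/= fpowersetE => /andP[tX /asboolP it].
    have E : t = phi @` [fset x in X | phi x \in t].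
      apply/fsetP => u; apply/idP/imfsetP => /= [ut|[x]].
        have /imfsetP[x /= xX ux] := fsubsetP tX _ ut.
        by exists x => //; rewrite !inE/= xX -ux.
      by rewrite !inE/= => /andP[xX xt ->].
    exists [fset x in X | phi x \in t] => //.
    have sX : [fset x in X | phi x \in t] `<=` X.
      by apply/fsubsetP => x; rewrite !inE/= => /andP[].
    rewrite !inE/= fpowersetE sX/=; apply/asboolP/phi_isolated => //.
    by rewrite -E.
  move=> [s sA ->]; have sX := AX _ sA.
  move: sA; rewrite !inE/= !fpowersetE sX/= => /asboolP /(phi_isolated sX) iso.
  apply/andP; split; last exact/asboolP.
  by apply/fsubsetP => _ /imfsetP[x xs ->]; apply: in_imfset; exact: (fsubsetP sX).
apply/esym/card_in_imfset => s t /AX sX /AX tX st.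
apply/fsetP => x; have [xX|xX] := boolP (x \in X).
  by rewrite -mem_phi// st mem_phi.
by rewrite (contraNF (fsubsetP sX x) xX) (contraNF (fsubsetP tX x) xX).
Qed.

End transfer.

End isolated.

(** * Measurability of the number of isolated faces *)

Section rounding.
Context {R : realType} {d : nat}.
Local Notation pt := (d.-tuple R).
Implicit Types (x y c : pt).

(** The mesh is [1 / (m + 1)] and the indices run up to [m + 1], a value taken only at the
    coordinate [1] of the closed cube. Outside the cube [inord] may return a default. *)
Definition grid_index (m : nat) x : {ffun 'I_d -> 'I_m.+2} :=
  [ffun i => inord (Num.truncn (tnth x i * m.+1%:R))].

Definition grid_point (m : nat) (a : {ffun 'I_d -> 'I_m.+2}) : pt :=
  [tuple (a i)%:R / m.+1%:R | i < d].

Definition grid_cell (m : nat) (a : {ffun 'I_d -> 'I_m.+2}) : set pt :=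
  [set x | cube x /\ grid_index m x = a].

Definition round m x : pt := grid_point (grid_index m x).

Lemma grid_indexP m x : cube x -> forall i,
  (grid_index m x i)%:R / m.+1%:R <= tnth x i < (grid_index m x i).+1%:R / m.+1%:R.
Proof.
move=> cx i; have /andP[x0 x1] := cx i.
rewrite ler_pdivrMr ?ltr0n// ltr_pdivlMr ?ltr0n// ffunE inordK.
  by apply: truncn_itv; rewrite mulr_ge0.
rewrite ltnS -(ler_nat R) (@le_trans _ _ (tnth x i * m.+1%:R))//.
  by rewrite truncn_le mulr_ge0.
by rewrite -[leRHS]mul1r ler_wpM2r.
Qed.

Lemma measurable_cube : measurable (@cube R d).
Proof.
rewrite (_ : @cube R d = [set x | forall i, `[0, 1]%classic (tnth x i)]).
  exact: (measurable_box (fun=> measurable_itv _)).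
by apply/seteqP; split => x cx i; have := cx i; rewrite /= in_itv.
Qed.

Lemma measurable_grid_cell m a : measurable (@grid_cell m a).
Proof.
rewrite (_ : grid_cell a = @cube R d `&` [set x | forall i,
  `[(a i)%:R / m.+1%:R, (a i).+1%:R / m.+1%:R[%classic (tnth x i)]).
  by apply: measurableI; [exact: measurable_cube|exact: (measurable_box (fun=> measurable_itv _))].
apply/seteqP; split => x [cx].
  by move=> <-; split => // i; rewrite /= in_itv/= grid_indexP.
move=> H; split => //; apply/ffunP => i; apply/val_inj => /=.
have := H i; rewrite /= in_itv/= ler_pdivrMr ?ltr0n// ltr_pdivlMr ?ltr0n// => /truncn_def E.
by rewrite ffunE E inordK.
Qed.

Lemma round_dist m x : cube x -> eudist (round m x) x <= d%:R * m.+1%:R^-1.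
Proof.
move=> cx; apply: eudist_le_max => i; rewrite tnth_mktuple.
have /andP[] := grid_indexP m cx i; rewrite -[(grid_index m x i).+1%:R]natr1 mulrDl mul1r.
move: (m.+1%:R^-1 : R) => v h1 h2.
by rewrite ler_norml; apply/andP; split; lra.
Qed.

Lemma eudist_eq0 x y : eudist x y = 0 -> x = y.
Proof.
move=> xy; apply/eq_from_tnth => i; apply/eqP; rewrite -subr_eq0 -normr_le0 -xy.
exact: eudist_coord.
Qed.

Lemma eventually_all (T : eqType) (s : seq T) (Q : T -> nat -> Prop) :
  (forall x : T, x \in s -> exists N, forall m, (N <= m)%N -> Q x m) ->
  exists N, forall m, (N <= m)%N -> forall x : T, x \in s -> Q x m.
Proof.
elim: s => [|x s IH] H; first by exists 0%N.
have [|N HN] := IH; first by move=> y ys; apply: H; rewrite inE ys orbT.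
have [N' HN'] := H x (mem_head _ _).
exists (maxn N N') => m; rewrite geq_max => /andP[Nm N'm] y.
by rewrite inE => /orP[/eqP ->|]; [exact: HN'|exact: HN].
Qed.

Lemma mesh_small (e : R) : 0 < e -> exists N, forall m : nat, (N <= m)%N ->
  d%:R * m.+1%:R^-1 < e.
Proof.
move=> e0; have d1 : 0 < (d%:R + 1 : R) by rewrite ltr_wpDl.
have [N HN] := invS_small (divr_gt0 e0 d1); exists N => m /HN.
rewrite ltr_pdivlMr// => h; apply: le_lt_trans h.
by rewrite mulrDr mulr1 mulrC lerDl invr_ge0.
Qed.

Lemma round_eventually_neq x y : cube x -> cube y -> x <> y ->
  exists N, forall m, (N <= m)%N -> round m x <> round m y.
Proof.
move=> cx cy xy.
have e0 : 0 < eudist x y / 2.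
  by rewrite divr_gt0// lt_neqAle eudist_ge0 andbT eq_sym; apply/eqP => /eudist_eq0.
have [N HN] := mesh_small e0; exists N => m /HN h E.
have := eudist_triangle (round m x) x y; rewrite {2}E [eudist x (round m x)]eudistC.
have := round_dist m cx; have := round_dist m cy.
by move: h; rewrite ltr_pdivlMr//; move: (d%:R * m.+1%:R^-1 : R) => v; lra.
Qed.

Lemma common_center_round (S : set pt) (r : R) : S `<=` @cube R d ->
  (forall N, exists2 m, (N <= m)%N & exists2 c, cube c &
     forall x, S x -> torus_dist (round m x) c <= r + d%:R * m.+1%:R^-1) ->
  exists2 c, cube c & forall x, S x -> torus_dist x c <= r.
Proof.
move=> Sc H.
have [||c [c1 c2]] := @lipschitz_compact R d pt S (@torus_dist R d) 0 1 r.
- by move=> x c c'; exact: torus_dist_lipr.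
- move=> m'; have e0 : 0 < (m'.+1%:R^-1 : R) / 2 by rewrite divr_gt0// invr_gt0.
  have [N HN] := mesh_small e0; have [m Nm [c cc Hc]] := H N.
  exists c; split => // x Sx; apply: (le_trans (torus_dist_lipl _ (round m x) _)).
  have := HN _ Nm; have := Hc _ Sx; have := round_dist m (Sc _ Sx); rewrite [eudist x _]eudistC.
  rewrite ltr_pdivlMr//.
  move: (d%:R * m.+1%:R^-1 : R) (m'.+1%:R^-1 : R) => v v'; lra.
- by exists c.
Qed.

Lemma simplex_cond_perturb p (r e : R) (phi : pt -> pt) (s : {fset pt}) :
  (forall x, x \in s -> eudist (phi x) x <= e) -> simplex_cond p r s ->
  simplex_cond p (r + e) (phi @` s)%fset.
Proof.
move=> He; have F x c : x \in s -> torus_dist x c <= r -> torus_dist (phi x) c <= r + e.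
  move=> xs xc; apply: (le_trans (torus_dist_lipl _ x _)); apply: lerD => //; exact: He.
case: p => /=.
  move=> [c Hc]; exists c => _ /imfsetP[x /= xs ->].
  by have [cc xc] := Hc x xs; split => //; exact: F.
move=> H _ _ /imfsetP[x /= xs ->] /imfsetP[y /= ys ->] xy.
have [|c [[cc xc] [_ yc]]] := H x y xs ys; first by move=> E; apply: xy; rewrite E.
by exists c; split; split => //; exact: F.
Qed.

(** One direction holds for every [m], the radius being enlarged by the rounding error. Conversely,
    if the rounded set were a simplex for arbitrarily large [m], the centres would accumulate at a
    centre for [s]. The Rips condition bears on distinct points only, so rounding must also keep the
    two points apart. *)
Lemma simplex_cond_round p (r : R) (s : {fset pt}) : (forall x, x \in s -> cube x) ->
  exists N, forall m, (N <= m)%N ->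
    simplex_cond p r s <-> simplex_cond p (r + d%:R * m.+1%:R^-1) (round m @` s)%fset.
Proof.
move=> sc.
have fwd m : simplex_cond p r s -> simplex_cond p (r + d%:R * m.+1%:R^-1) (round m @` s)%fset.
  by apply: simplex_cond_perturb => x xs; apply: round_dist; exact: sc.
have [Hs|Hs] := pselect (simplex_cond p r s).
  by exists 0%N => m _; split => // _; exact: fwd.
suff [N HN] : exists N, forall m, (N <= m)%N -> ~ simplex_cond p (r + d%:R * m.+1%:R^-1) (round m @` s)%fset.
  by exists N => m Nm; split => // /(HN _ Nm).
apply: contrapT => /forallNP HN; apply: Hs.
have {}HN N : exists2 m, (N <= m)%N & simplex_cond p (r + d%:R * m.+1%:R^-1) (round m @` s)%fset.
  have /existsNP[m /not_implyP[Nm /contrapT Hm]] := HN N; by exists m.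
case: p HN {fwd} => HN.
  have [] := @common_center_round [set` s] r.
  - by move=> x /= /sc.
  - move=> N; have [m Nm [c Hc]] := HN N; exists m => //.
    have [[x xs]|nx] := pselect (exists x, x \in s).
      exists c; first by have [] := Hc _ (in_imfset _ (round m) xs).
      by move=> y ys; have [] := Hc _ (in_imfset _ (round m) ys).
    exists [tuple 0 | i < d]; first by move=> i; rewrite tnth_mktuple lexx ler01.
    by move=> y /= ys; exfalso; apply: nx; exists y.
  - by move=> c cc Hc; exists c => x /= /Hc.
move=> x y xs ys xy.
have [N0 HN0] := round_eventually_neq (sc _ xs) (sc _ ys) xy.
have [] := @common_center_round [set x; y] r.
- by move=> z [->|->]; exact: sc.
- move=> N; have [m] := HN (maxn N N0); rewrite geq_max => /andP[Nm N0m] Hm.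
  have [c [[cc xc] [_ yc]]] := Hm _ _ (in_imfset _ (round m) xs) (in_imfset _ (round m) ys) (HN0 _ N0m).
  by exists m => //; exists c => // z [->|->].
- by move=> c cc Hc; exists c; split; split => //; apply: Hc; [left|right].
Qed.

(* Being a simplex is a closed condition: compactness makes the rounded points,
   with the radius enlarged by the rounding error, eventually exact. *)
Lemma num_isolated_round p q (X : {fset pt}) (r : R) k : (0 < k)%N ->
  (forall x, x \in X -> cube x) ->
  exists N, forall m, (N <= m)%N ->
    num_isolated p q X r k =
    num_isolated p q (round m @` X)%fset (r + d%:R * m.+1%:R^-1) k.
Proof.
move=> k0 Xc.
have [N1 HN1] : exists N, forall m, (N <= m)%N -> forall s, s \in fpowerset X ->
    simplex_cond p r s <-> simplex_cond p (r + d%:R * m.+1%:R^-1) (round m @` s)%fset.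
  apply: eventually_all => s; rewrite fpowersetE => /fsubsetP sX.
  by apply: simplex_cond_round => x /sX; exact: Xc.
have [N2 HN2] : exists N, forall m, (N <= m)%N -> forall x, x \in X -> forall y, y \in X ->
    round m x = round m y -> x = y.
  apply: eventually_all => x xX; apply: eventually_all => y yX.
  have [->|/eqP xy] := eqVneq x y; first by exists 0%N.
  have [N HN] := round_eventually_neq (Xc _ xX) (Xc _ yX) xy.
  by exists N => m /HN h /h.
exists (maxn N1 N2) => m; rewrite geq_max => /andP[N1m N2m].
apply: num_isolated_imfset => //; first by move=> x y xX yX; exact: HN2.
by move=> s sX; apply: HN1 => //; rewrite fpowersetE.
Qed.

End rounding.

Section measurability.
Context {R : realType} {d : nat} {dT : measure_display} {T : measurableType dT}.
Local Notation pt := (d.-tuple R).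
Variables (P : probability T R) (lambda : R) (X : T -> {fset pt}).
Hypothesis PX : poisson_process P lambda X.

(** A random element of a finite set, through which the rounded process depends on finitely many
    counts [npoints], the data whose measurability is granted by [poisson_process]. *)
Definition occupied m w : {set {ffun 'I_d -> 'I_m.+2}} :=
  finset (fun a => (0 < npoints X (grid_cell a) w)%N).

Lemma round_occupied m w :
  (round m @` X w)%fset = [fset grid_point a | a in occupied m w]%fset.
Proof.
have occ a : (a \in occupied m w) <-> exists2 x, x \in X w & grid_index m x = a.
  rewrite finset.in_set /npoints cardfs_gt0; split.
    move=> /fset0Pn[x]; rewrite !inE/= => /andP[xX]; rewrite inE => -[_ xa].
    by exists x.
  move=> [x xX xa]; apply/fset0Pn; exists x; rewrite !inE/= xX/= inE; split => //.
  exact: (pp_cube PX) xX.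
apply/fsetP => u; apply/imfsetP/imfsetP => -[].
  by move=> x /= xX ->; exists (grid_index m x) => //; apply/occ; exists x.
by move=> a /= /occ[x xX <-] ->; exists x.
Qed.

Lemma occupied_measurable m (F : {set {ffun 'I_d -> 'I_m.+2}} -> Prop) :
  measurable [set w | F (occupied m w)].
Proof.
rewrite (_ : [set w | _] = \bigcup_(A in [set A | F A])
   \bigcap_(a in [set: {ffun 'I_d -> 'I_m.+2}])
     npoints X (grid_cell a) @^-1` [set n | (0 < n)%N = (a \in A)]).
  apply: fin_bigcup_measurable => [|A _]; first exact: finite_finset.
  apply: fin_bigcap_measurable => [|a _]; first exact: finite_finset.
  rewrite -[X in measurable X]setTI.
  apply: (pp_measurable PX) => //; first exact: measurable_grid_cell.
  by move=> x [].
apply/seteqP; split => w /=.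
  by move=> Fw; exists (occupied m w) => // a _ /=; rewrite finset.in_set.
move=> [A FA HA]; rewrite (_ : occupied m w = A)//.
by apply/setP => a; rewrite finset.in_set; have := HA a I.
Qed.

Lemma num_isolated_measurable p q (r : R) k (M : nat) : (0 < k)%N ->
  measurable [set w | (M <= num_isolated p q (X w) r k)%N].
Proof.
move=> k0.
pose Jm m w := num_isolated p q (round m @` X w)%fset (r + d%:R * m.+1%:R^-1) k.
(* For each [w] the rounded counts are eventually equal to the true one, so the event is the limit
   inferior of the rounded events. *)
rewrite (_ : [set w | _] = \bigcup_N \bigcap_(m in [set m | (N <= m)%N]) [set w | (M <= Jm m w)%N]).
  apply: bigcupT_measurable => N; apply: bigcap_measurable => [|m _]; first by exists N => /=.
  rewrite /Jm (_ : [set w | _] = [set w | (M <= num_isolated p q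
     [fset grid_point a | a in occupied m w]%fset (r + d%:R * m.+1%:R^-1) k)%N]).
    exact: (occupied_measurable (fun A => (M <= num_isolated p q
     [fset grid_point a | a in A]%fset (r + d%:R * m.+1%:R^-1) k)%N)).
  by apply/seteqP; split => w /=; rewrite round_occupied.
have ev w := num_isolated_round p q r k0 (fun x => @pp_cube _ _ _ _ _ _ _ PX w x).
apply/seteqP; split => w /=.
  by move=> Mw; have [N HN] := ev w; exists N => // m Nm /=; rewrite /Jm -HN.
move=> [N _ HN]; have [N' HN'] := ev w.
rewrite (HN' (maxn N N')) ?leq_maxr//; exact: (HN (maxn N N') (leq_maxl _ _)).
Qed.

End measurability.

(** * Poisson counts and torus images *)

Section independence.
Context {R : realType} {dT : measure_display} {T : measurableType dT} (P : probability T R).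
Context {I : finType} (E : I -> set T) (p : I -> R).
Hypothesis mE : forall i, measurable (E i).
Hypothesis indep : forall A : {set I}, P (\bigcap_(i in [set i | i \in A]) E i) = (\prod_(i in A) p i)%:E.

(** Independence passes to complements. The induction runs over the list of complemented events,
    from [P (F \ E x) = P F - P (F & E x)]; the set [A] of events kept as they are must be
    arbitrary, since the last term moves [x] into it. *)
Lemma independent_compl : P (\bigcap_(i in [set: I]) ~` E i) = (\prod_i (1 - p i))%:E.
Proof.
have mcap (A : {set I}) : measurable (\bigcap_(i in [set i | i \in A]) E i).
  by apply: fin_bigcap_measurable => //; exact: finite_finset.
have mcapC (s : seq I) : measurable (\bigcap_(i in [set` s]) ~` E i).
  by apply: fin_bigcap_measurable => [|i _]; [exact: finite_finset|exact: measurableC].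
have gen (s : seq I) : uniq s -> forall A : {set I}, (forall i, i \in s -> i \notin A) ->
    P (\bigcap_(i in [set i | i \in A]) E i `&` \bigcap_(i in [set` s]) ~` E i) =
    ((\prod_(i in A) p i) * \prod_(i <- s) (1 - p i))%:E.
  elim: s => [_ A _|x s IH /= /andP[xs us] A sA].
    rewrite big_nil mulr1 -indep; congr (P _).
    by apply/seteqP; split => [w []//|w Hw]; split.
  set F := \bigcap_(i in [set i | i \in A]) E i `&` \bigcap_(i in [set` s]) ~` E i.
  have mF : measurable F by exact: measurableI.
  have sA' i : i \in s -> i \notin A by move=> si; apply: sA; rewrite inE si orbT.
  have xA : x \notin A by apply: sA; rewrite inE eqxx.
  have -> : \bigcap_(i in [set i | i \in A]) E i `&` \bigcap_(i in [set` x :: s]) ~` E i = F `\` E x.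
    apply/seteqP; split => w.
      move=> [HA Hs]; split; last by apply: Hs; rewrite /= inE eqxx.
      by split => // i /= si; apply: Hs; rewrite /= inE si orbT.
    move=> [[HA Hs] Ex]; split => // i /=; rewrite inE => /orP[/eqP ->//|si].
    exact: Hs.
  have -> : (P (F `\` E x) = P F - P (F `&` E x))%E.
    rewrite measureD//; exact: le_lt_trans (probability_le1 _ mF) (ltry _).
  rewrite (IH us A sA') (_ : F `&` E x =
     \bigcap_(i in [set i | i \in x |: A]) E i `&` \bigcap_(i in [set` s]) ~` E i).
    rewrite IH//; last first.
      move=> i si; rewrite !inE negb_or sA'// andbT; apply: contraNneq xs => <-//.
    rewrite big_setU1//= big_cons -EFinB; congr EFin; ring.
  apply/seteqP; split => w.
    move=> [[HA Hs] Ex]; split => // i /=; rewrite !inE => /orP[/eqP ->//|]; exact: HA.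
  move=> [HA Hs]; split; last by apply: HA; rewrite /= !inE eqxx.
  by split => // i /= iA; apply: HA; rewrite /= !inE iA orbT.
have := gen (index_enum I) (index_enum_uniq _) finset.set0 _.
rewrite big_set0 mul1r => <-; last by move=> i _; rewrite inE.
congr (P _); apply/seteqP; split => w.
  by move=> H; split => [i /=|i _]; [rewrite inE|exact: H].
by move=> [_ H] i _; apply: H; rewrite /= mem_index_enum.
Qed.

Lemma independent_compl_bound (p0 : R) : (forall i, p0 <= p i <= 1) ->
  (P (\bigcap_(i in [set: I]) ~` E i) <= (expR (- (#|I|%:R * p0)))%:E)%E.
Proof.
move=> Hp; rewrite independent_compl lee_fin.
rewrite -mulrN expRM_natl -prodr_const ler_prod// => i _.
have /andP[h1 h2] := Hp i; rewrite subr_ge0 h2/=.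
apply: (le_trans (expR_ge1Dx (- p i))).
by rewrite ler_expR lerN2.
Qed.

End independence.

Section poisson_facts.
Context {R : realType} {d : nat} {dT : measure_display} {T : measurableType dT}.
Local Notation pt := (d.-tuple R).
Variables (P : probability T R) (lambda : R) (X : T -> {fset pt}).
Hypothesis PX : poisson_process P lambda X.

Lemma npoints_measurable (B : set pt) (D : set nat) : measurable B -> B `<=` @cube R d ->
  measurable (npoints X B @^-1` D).
Proof. by move=> mB Bc; rewrite -[X in measurable X]setTI; apply: (pp_measurable PX). Qed.

Lemma poisson_void (B : set pt) : 0 <= lambda -> measurable B -> B `<=` @cube R d ->
  P (npoints X B @^-1` [set 0%N]) = (expR (- (lambda * fine (lebesgue_tuple B))))%:E.
Proof.
move=> l0 mB Bc; rewrite (pp_poisson PX)//.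
set r := lambda * _; have r0 : 0 <= r.
  by rewrite mulr_ge0// fine_ge0// lebesgue_tupleE measure_ge0.
rewrite /poisson_prob; case: ifPn => [rp|].
  by rewrite esum_set1 ?lee_fin ?poisson_pmf_ge0// /poisson_pmf rp expr0 fact0 invr1 !mul1r.
(* At rate [0] the law is the Dirac measure at [0], in agreement with [expR 0 = 1]. *)
rewrite -leNgt => rn; have -> : r = 0 by apply/eqP; rewrite eq_le rn r0.
by rewrite oppr0 expR0 diracE mem_set.
Qed.

Lemma poisson_one (B : set pt) : measurable B -> B `<=` @cube R d ->
  0 < lambda * fine (lebesgue_tuple B) ->
  P (npoints X B @^-1` [set 1%N]) =
  (lambda * fine (lebesgue_tuple B) * expR (- (lambda * fine (lebesgue_tuple B))))%:E.
Proof.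
move=> mB Bc r0; rewrite (pp_poisson PX)//.
rewrite /poisson_prob r0 esum_set1 ?lee_fin ?poisson_pmf_ge0//.
by rewrite /poisson_pmf r0 expr1 (_ : 1`! = 1%N)// invr1 mulr1.
Qed.

Lemma pp_independent_fin (I : finType) (B : I -> set pt) (D : I -> set nat) :
  (forall i, measurable (B i)) -> (forall i, B i `<=` @cube R d) ->
  (forall i j, i != j -> B i `&` B j = set0) ->
  P (\bigcap_(i in [set: I]) npoints X (B i) @^-1` D i) =
  (\prod_i P (npoints X (B i) @^-1` D i))%E.
Proof.
move=> mB Bc dB.
rewrite (big_enum_val (fun i => P (npoints X (B i) @^-1` D i))) /=.
rewrite -(pp_independent PX (B := fun j : 'I_#|I| => B (enum_val j)) _ _ _ (fun j => D (enum_val j))).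
- congr (P _); apply/seteqP; split => w Hw i _; first exact: Hw.
  by have := Hw (enum_rank i) Logic.I; rewrite enum_rankK.
- by move=> j; exact: mB.
- by move=> j; exact: Bc.
- by move=> i j ij; apply: dB; apply: contra ij => /eqP /enum_val_inj ->.
Qed.

Lemma pp_independent_blocks (I J : finType) (B : I * J -> set pt) (D : J -> set nat) (p0 : R) :
  (forall i, measurable (B i)) -> (forall i, B i `<=` @cube R d) ->
  (forall i j, i != j -> B i `&` B j = set0) ->
  (forall i, p0%:E <= \prod_j P (npoints X (B (i, j)) @^-1` D j))%E ->
  (P (\bigcap_(i in [set: I]) ~` \bigcap_(j in [set: J]) npoints X (B (i, j)) @^-1` D j)
   <= (expR (- (#|I|%:R * p0)))%:E)%E.
Proof.
move=> mB Bc dB Hp.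
pose N ij (DD : set nat) := npoints X (B ij) @^-1` DD.
have mN ij DD : measurable (N ij DD) by exact: npoints_measurable.
pose E i := \bigcap_(j in [set: J]) N (i, j) (D j).
have fP (A : set T) : measurable A -> (fine (P A))%:E = P A.
  by move=> mA; rewrite fineK// fin_num_measure.
have Pall (A : {set I}) : P (\bigcap_(i in [set i | i \in A]) E i) =
    (\prod_(i in A) \prod_j P (N (i, j) (D j)))%E.
  (* Blocks outside [A] receive the trivial constraint, so the product formula over the full index
     set [I * J] yields the one for every subfamily. *)
  pose DA (ij : I * J) := if ij.1 \in A then D ij.2 else [set: nat].
  have -> : \bigcap_(i in [set i | i \in A]) E i = \bigcap_(ij in [set: I * J]) npoints X (B ij) @^-1` DA ij.
    apply/seteqP; split => w Hw.
      move=> [i j] _; rewrite /DA /=; case: ifPn => // iA; exact: Hw.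
    move=> i /= iA j _; have := Hw (i, j) Logic.I; by rewrite /DA /= iA.
  rewrite pp_independent_fin// [RHS]big_mkcond/=.
  rewrite (eq_bigr (fun ij => P (N (ij.1, ij.2) (DA (ij.1, ij.2))))); last by case.
  rewrite -(pair_bigA _ (fun i j => P (N (i, j) (DA (i, j)))))/=.
  apply: eq_bigr => i _; rewrite /DA /=; case: ifPn => // iA.
  by rewrite big1// => j _; rewrite /N preimage_setT probability_setT.
have PE i : P (E i) = (\prod_j P (N (i, j) (D j)))%E.
  have := Pall (finset.set1 i); rewrite big_set1 => <-; congr (P _).
  apply/seteqP; split => w Hw.
    by move=> j /=; rewrite finset.in_set1 => /eqP ->.
  by apply: Hw; rewrite /= finset.in_set1.
have mE i : measurable (E i) by apply: fin_bigcap_measurable => //; exact: finite_finset.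
apply: (@independent_compl_bound _ _ _ P _ E (fun i => fine (P (E i))) mE).
- move=> A; rewrite Pall -prodEFin; apply: eq_bigr => i _.
  by rewrite fP// PE.
- move=> i; rewrite -!lee_fin fP// PE Hp -PE; exact: probability_le1.
Qed.

End poisson_facts.

Section wrap.
Context {R : realType} {d : nat}.
Local Notation pt := (d.-tuple R).

(** The projection of [S] to the torus, with all representatives in the closed cube. *)
Definition torus_image (S : set pt) : set pt := [set x | cube x /\ exists z, S (vshift x z)].

Lemma vshift_vaff (x : pt) z : vshift x z = vaff [tuple (z i)%:~R | i < d] 1 x.
Proof. by apply/eq_from_tnth => i; rewrite !tnth_mktuple mul1r addrC. Qed.

Lemma measurable_vshift (S : set pt) z : measurable S -> measurable [set x | S (vshift x z)].
Proof.
move=> mS; rewrite (_ : [set x | _] = [set x | S (vaff [tuple (z i)%:~R | i < d] 1 x)]).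
  exact: measurable_vaff_preimage.
by apply/seteqP; split => x /=; rewrite vshift_vaff.
Qed.

Lemma lebesgue_tuple_vshift (S : set pt) z : measurable S ->
  lebesgue_tuple [set x | S (vshift x z)] = lebesgue_tuple S.
Proof.
move=> mS; rewrite (_ : [set x | _] = [set x | S (vaff [tuple (z i)%:~R | i < d] 1 x)]).
  by rewrite lebesgue_tuple_vaff// invr1 expr1n mul1e.
by apply/seteqP; split => x /=; rewrite vshift_vaff.
Qed.

Lemma torus_image_cube (S : set pt) : torus_image S `<=` @cube R d.
Proof. by move=> x []. Qed.

Let shift_of (n : nat) : option (d.-tuple int) := @pickle_inv (d.-tuple int) n.

Let torus_image_pieceE (S F : set pt) : torus_image S `&` F =
  \bigcup_(n in [set: nat]) (if shift_of n is Some z then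
     [set x | F x /\ cube x /\ S (vshift x (tnth z))] else set0).
Proof.
apply/seteqP; split => x.
  move=> [[cx [z Sz]] Fx]; exists (choice.pickle [tuple z i | i < d]) => //.
  rewrite /shift_of pickleK_inv /=; split => //; split => //.
  by rewrite (_ : tnth _ = z)//; apply/funext => i; rewrite tnth_mktuple.
move=> [n _]; case: shift_of => // z [Fx [cx Sx]]; split => //; split => //.
by exists (tnth z).
Qed.

Lemma measurable_torus_image (S : set pt) : measurable S -> measurable (torus_image S).
Proof.
move=> mS; rewrite -[torus_image S]setIT torus_image_pieceE.
apply: bigcupT_measurable => n; case: shift_of => // z.
rewrite (_ : [set x | _] = @cube R d `&` [set x | S (vshift x (tnth z))]).
  by apply: measurableI; [exact: measurable_cube|exact: measurable_vshift].
by apply/seteqP; split => x; [move=> [_ []]|move=> []].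
Qed.

(* Cutting [S] along the integer translates of [[0,1)^d] and translating the
   pieces back gives disjoint subsets of [torus_image S]. *)
Lemma lebesgue_torus_image (S : set pt) : measurable S ->
  (forall x y, S x -> S y -> forall i, `|tnth x i - tnth y i| < 1) ->
  (lebesgue_tuple S <= lebesgue_tuple (torus_image S))%E.
Proof.
move=> mS diamS.
pose F : set pt := [set x | forall i, `[0, 1[%classic (tnth x i)].
have mF : measurable F by exact: (measurable_box (fun=> measurable_itv _)).
have Fc x : F x -> cube x.
  by move=> Fx i; have := Fx i; rewrite /= in_itv/= => /andP[-> /ltW ->].
(* [W n] is a piece moved into the half-open cube [F], and [V n] the same piece at its original
   place in [S]. The [V n] are disjoint because integer translates of [F] are; the [W n] because two
   points of [S] differ by less than [1] in each coordinate. *)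
pose W n := if shift_of n is Some z then
     [set x | F x /\ cube x /\ S (vshift x (tnth z))] else set0.
pose V n := if shift_of n is Some z then
     [set u | W n (vshift u (fun i => - tnth z i))] else set0.
have mW n : measurable (W n).
  rewrite /W; case: shift_of => // z.
  rewrite (_ : [set x | _] = F `&` [set x | S (vshift x (tnth z))]).
    by apply: measurableI => //; exact: measurable_vshift.
  by apply/seteqP; split => x; [move=> [? []]|move=> [? ?]; do 2 split => //; exact: Fc].
have mV n : measurable (V n).
  by rewrite /V; case: shift_of => // z; exact: measurable_vshift.
have VW n : lebesgue_tuple (V n) = lebesgue_tuple (W n).
  rewrite /V; have := mW n; rewrite /W; case: shift_of => // z mz.
  exact: lebesgue_tuple_vshift.
have tW : trivIset setT W.
  apply/trivIsetP => n m _ _ nm; apply/seteqP; split => // x; rewrite /W.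
  case En: (shift_of n) => [z|]; last by case.
  case Em: (shift_of m) => [z'|]; last by case.
  move=> [[_ [_ Sz]] [_ [_ Sz']]]; move/negP: nm; apply; apply/eqP.
  have zz' : z = z'.
    apply/eq_from_tnth => i; apply/eqP; rewrite -subr_eq0; apply/eqP.
    apply: (@small_int_eq0 R); have := diamS _ _ Sz Sz' i.
    by rewrite !tnth_mktuple intrB (_ : _ + _ - _ = (tnth z i)%:~R - (tnth z' i)%:~R)//; ring.
  have := @pickle_invK (d.-tuple int) n; have := @pickle_invK (d.-tuple int) m.
  by move: En Em; rewrite /shift_of => -> -> /= <- <-; rewrite zz'.
have tV : trivIset setT V.
  apply/trivIsetP => n m _ _ nm; apply/seteqP; split => // u; rewrite /V.
  case En: (shift_of n) => [z|]; last by case.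
  case Em: (shift_of m) => [z'|]; last by case.
  rewrite /W En Em /= => -[[Fz _] [Fz' _]]; move/negP: nm; apply; apply/eqP.
  have zz' : z = z'.
    apply/eq_from_tnth => i; apply/eqP; rewrite -subr_eq0; apply/eqP.
    apply: (@small_int_eq0 R); have := Fz i; have := Fz' i.
    rewrite /= !in_itv/= !tnth_mktuple !intrN intrB => /andP[? ?] /andP[? ?].
    by rewrite ltr_norml; apply/andP; split; lra.
  have := @pickle_invK (d.-tuple int) n; have := @pickle_invK (d.-tuple int) m.
  by move: En Em; rewrite /shift_of => -> -> /= <- <-; rewrite zz'.
have SV : S = \bigcup_(n in [set: nat]) V n.
  apply/seteqP; split => u.
    move=> Su; have [z Hz] := fundamental_shift u.
    pose z' : d.-tuple int := [tuple - z i | i < d].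
    exists (choice.pickle z') => //; rewrite /V /W /shift_of pickleK_inv /=.
    have -> : (fun i => - tnth z' i) = z by apply/funext => i; rewrite tnth_mktuple opprK.
    have -> : tnth z' = fun i => - z i by apply/funext => i; rewrite tnth_mktuple.
    have Fz : F (vshift u z) by move=> i; rewrite /= in_itv/=; exact: Hz.
    by rewrite vshiftK; split => //; split => //; exact: Fc.
  move=> [n _]; rewrite /V /W; case: shift_of => // z [_ [_]].
  by have := vshiftK u (fun i => - tnth z i); rewrite (_ : (fun i => - - tnth z i) = tnth z) => [->//|]; apply/funext => i; rewrite opprK.
rewrite [in leLHS]SV lebesgue_tupleE measure_bigcup//.
have HVW n : lebesgue_tuple_measure d (V n) = lebesgue_tuple_measure d (W n).
  by rewrite -!lebesgue_tupleE.
rewrite (eq_eseriesr (fun n _ => HVW n)).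
rewrite -(@measure_bigcup _ _ _ (lebesgue_tuple_measure d) setT W)//.
apply: le_measure; rewrite ?inE//; first exact: bigcupT_measurable.
  exact: measurable_torus_image.
by move=> x Wx; have := torus_image_pieceE S F; move=> /seteqP[_ /(_ x Wx) []].
Qed.

End wrap.

(** * The constant [m] as an infimum of witness volumes *)

Section witness_constant.
Context {R : realType} {d k : nat}.
Local Notation pt := (d.-tuple R).
Implicit Types w : 'I_k.+1 -> pt.

Lemma esimplex_vaff_iff p (b : pt) (r a : R) (S : set pt) : 0 < a ->
  esimplex p (a * r) (vaff b a @` S) <-> esimplex p r S.
Proof.
move=> a0; split; last exact: esimplex_vaff.
have ai0 : 0 < a^-1 by rewrite invr_gt0.
move=> /(esimplex_vaff (vaff (vzero d) (- a^-1) b) ai0).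
rewrite mulKf ?gt_eqF// image_comp.
rewrite (_ : _ @` S = S)//; apply/seteqP; split => [_ [x Sx <-]|x Sx] /=; last exists x => //;
rewrite (_ : vaff _ _ _ = x)//; apply/eq_from_tnth => i; rewrite !tnth_mktuple;
by field; rewrite gt_eqF.
Qed.

Lemma witness_vaff p q w (b : pt) u :
  witness p q (fun j => vaff b 1 (w j)) (vaff b 1 u) <-> witness p q w u.
Proof.
have E J : (fun j => vaff b 1 (w j)) @` J `|` [set vaff b 1 u] = vaff b 1 @` (w @` J `|` [set u]).
  by rewrite image_setU image_set1 image_comp.
split=> -[J qJ H]; exists J => //; move: H; rewrite E -[X in esimplex p X (vaff _ _ @` _)]mul1r.
  by rewrite esimplex_vaff_iff.
by rewrite esimplex_vaff_iff.
Qed.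

(** [mconst] ranges over shapes whose first vertex is the origin; translation by the opposite of
    [w ord0] reaches this case without changing the volume. *)
Lemma mconst_le_witness p q w : esimplex p 1 (range w) ->
  (mconst d k p q <= lebesgue_tuple (witness p q w))%E.
Proof.
move=> hw.
pose b := vaff (vzero d) (-1) (w ord0).
pose w' j := vaff b 1 (w j).
pose y i := w' (lift ord0 i).
have Ey : cons_origin y = w'.
  apply/funext => i; rewrite /cons_origin; case: unliftP => [j ->//|->].
  by apply/eq_from_tnth => l; rewrite !tnth_mktuple; ring.
have hw' : esimplex p 1 (range w').
  rewrite (_ : range w' = vaff b 1 @` range w); last by rewrite image_comp.
  by rewrite -[X in esimplex _ X]mul1r esimplex_vaff_iff.
have Ay : Aset p y by rewrite /Aset /= Ey; exact/h_condE.
suff <- : lebesgue_tuple (Qset p q (cons_origin y)) = lebesgue_tuple (witness p q w).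
  by apply: ereal_inf_lbound; exists y.
rewrite Qset_witness// Ey.
have <- : [set u | witness p q w' (vaff b 1 u)] = witness p q w.
  by apply/seteqP; split => u /=; rewrite witness_vaff.
by rewrite lebesgue_tuple_vaff ?invr1 ?expr1n ?mul1e//; exact: witness_measurable.
Qed.

Lemma mconst_approx p q (m e : R) : mconst d k p q = m%:E -> 0 < e ->
  exists w, esimplex p 1 (range w) /\ (lebesgue_tuple (witness p q w) < (m + e)%:E)%E.
Proof.
move=> Em e0.
have : @mconst R d k p q \is a fin_num by rewrite Em.
move=> /(lb_ereal_inf_adherent e0)[_ [y Ay <-]].
rewrite [X in (_ < X + _)%E](_ : _ = m%:E); last exact: Em.
rewrite -EFinD => H; exists (cons_origin y); split.
  exact/h_condE.
by rewrite -Qset_witness.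
Qed.

End witness_constant.

(** * The supercritical bound *)

Section void_region.
Context {R : realType} {d k : nat}.
Local Notation pt := (d.-tuple R).
Implicit Types w y : 'I_k.+1 -> pt.

(** Grid points might form infeasible shapes, for which stability says nothing. Each grid cell of
    shapes is therefore represented by a feasible shape in it, when there is one. *)
Lemma config_net p (L e : R) : 0 < L -> 0 < e ->
  exists (G : finType) (y : G -> 'I_k.+1 -> pt),
    (forall g, esimplex p 1 (range (y g))) /\
    forall w, esimplex p 1 (range w) -> (forall j i, - L <= tnth (w j) i <= L) ->
      exists g, forall j, eudist (y g j) (w j) <= e.
Proof.
move=> L0 e0; pose a := (2 * L)^-1; have a0 : 0 < a by rewrite invr_gt0 mulr_gt0.
(* [t] maps the box of half-side [L] onto the unit cube, so that [grid_index] applies. *)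
pose t : pt -> pt := vaff [tuple 2^-1 | i < d] a.
have [m /(_ _ (leqnn m)) Hm] := @mesh_small R d (a * e / 2) (divr_gt0 (mulr_gt0 a0 e0) (ltr0Sn _ 1)).
pose gi (w : 'I_k.+1 -> pt) : {ffun 'I_k.+1 -> {ffun 'I_d -> 'I_m.+2}} :=
  [ffun j => grid_index m (t (w j))].
pose inbox w := forall j i, - L <= tnth (w j) i <= L.
have tcube w : inbox w -> forall j, cube (t (w j)).
  move=> wb j i; rewrite tnth_mktuple tnth_mktuple; have /andP[h1 h2] := wb j i.
  have aL : a * L = 2^-1 by rewrite /a invfM -mulrA mulVf ?mulr1// gt_eqF.
  by apply/andP; split; nra.
have close w w' : inbox w -> inbox w' -> gi w = gi w' -> forall j, eudist (w j) (w' j) <= e.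
  move=> wb wb' /ffunP E j; have := E j; rewrite !ffunE => Ej.
  have Er : round m (t (w j)) = round m (t (w' j)) by rewrite /round Ej.
  have := eudist_triangle (round m (t (w j))) (t (w j)) (t (w' j)).
  rewrite {2}Er [eudist (t (w j)) (round _ _)]eudistC eudist_vaff// => h.
  have h1 := round_dist m (tcube _ wb j); have h2 := round_dist m (tcube _ wb' j).
  rewrite -(ler_pM2l a0); move: Hm h h1 h2; rewrite ltr_pdivlMr//.
  by move: (d%:R * m.+1%:R^-1 : R) => v; lra.
have /choice[y Hy] : forall g, exists y, esimplex p 1 (range y) /\
    forall w, esimplex p 1 (range w) -> inbox w -> gi w = g -> forall j, eudist (y j) (w j) <= e.
  move=> g; have [[y [sy [yb yg]]]|no] := pselect (exists y, esimplex p 1 (range y) /\ inbox y /\ gi y = g).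
    by exists y; split => // w sw wb wg; apply: close => //; rewrite yg wg.
  (* A cell without feasible shapes gets the shape concentrated at the origin, which is feasible and
     never called upon. *)
  exists (fun=> vzero d); split; last first.
    by move=> w sw wb wg; exfalso; apply: no; exists w.
  case: p {no} => /=; first by exists (vzero d) => _ [_ _ <-]; rewrite eudistxx.
  by move=> _ _ [_ _ <-] [_ _ <-]; rewrite eudistxx mulr1.
exists {ffun 'I_k.+1 -> {ffun 'I_d -> 'I_m.+2}}, y; split => [g|w sw wb]; first exact: (Hy g).1.
by exists (gi w); exact: (Hy (gi w)).2.
Qed.

Definition sup_box (x : pt) (e : R) : set pt :=
  [set u | forall i, `[tnth x i - e, tnth x i + e]%classic (tnth u i)].

Lemma measurable_sup_box x e : measurable (sup_box x e).
Proof. exact: (measurable_box (fun=> measurable_itv _)). Qed.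

Lemma lebesgue_sup_box x e : 0 <= e -> lebesgue_tuple (sup_box x e) = ((2 * e) ^+ d)%:E.
Proof.
move=> e0; rewrite (@lebesgue_tuple_box _ _ (fun i => `[tnth x i - e, tnth x i + e]%classic)); last first.
  by move=> i; exact: measurable_itv.
rewrite (eq_bigr (fun=> (2 * e)%:E)); last first.
  move=> i _; rewrite lebesgue_measure_itv /= lte_fin.
  case: ifPn => [_|]; first by rewrite -EFinB; congr EFin; ring.
  rewrite -leNgt => h; congr EFin; have -> : e = 0 by apply/eqP; rewrite eq_le e0 andbT; lra.
  by rewrite mulr0.
by rewrite prodEFin prodr_const card_ord.
Qed.

Lemma lebesgue_tupleU_le (A B : set pt) : measurable A -> measurable B ->
  (lebesgue_tuple (A `|` B) <= lebesgue_tuple A + lebesgue_tuple B)%E.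
Proof. by move=> mA mB; rewrite lebesgue_tupleE; exact: measureU2. Qed.

Lemma lebesgue_tuple_bigcup_le (I : finType) (F : I -> set pt) : (forall i, measurable (F i)) ->
  (lebesgue_tuple (\bigcup_(i in [set: I]) F i) <= \sum_i lebesgue_tuple (F i))%E.
Proof.
move=> mF.
have -> : \bigcup_(i in [set: I]) F i = \big[setU/set0]_(i <- index_enum I) F i.
  rewrite -bigcup_seq; apply/seteqP; split => x [i _ Fx]; exists i => //=.
  by rewrite mem_index_enum.
elim: (index_enum I) => [|i s IH]; first by rewrite !big_nil lebesgue_tupleE measure0.
rewrite !big_cons; apply: (le_trans (lebesgue_tupleU_le _ _)) => //.
  by apply: bigsetU_measurable => j _.
by rewrite leeD2l.
Qed.

(* The image of the witness region of [w] under the homothety of centre [c0] and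
   ratio [1 - s]. *)
Definition inflated p q (s : R) w (c0 : pt) : set pt :=
  [set v | witness p q w (vaff (vaff (vzero d) (- (s / (1 - s))) c0) (1 - s)^-1 v)].

(** The vertices of the face are points of the process too and may lie in its own region; the boxes,
    which contain every vertex within [e] of its model, are cut out so that the region can be
    void. *)
Definition void_region p q s e w c0 : set pt :=
  inflated p q s w c0 `\` \bigcup_(j in [set: 'I_k.+1]) sup_box (w j) e.

Lemma measurable_inflated p q s w c0 : measurable (inflated p q s w c0).
Proof. by apply: measurable_vaff_preimage; exact: witness_measurable. Qed.

Lemma measurable_void_region p q s e w c0 : measurable (void_region p q s e w c0).
Proof.
apply: measurableD; first exact: measurable_inflated.
by apply: fin_bigcup_measurable => // j _; exact: measurable_sup_box.
Qed.

Lemma lebesgue_void_region p q s e w c0 (m : R) : s < 1 -> 0 <= e ->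
  esimplex p 1 (range w) -> mconst d k p q = m%:E ->
  (((1 - s) ^+ d * m - k.+1%:R * (2 * e) ^+ d)%:E <= lebesgue_tuple (void_region p q s e w c0))%E.
Proof.
move=> s1 e0 hw Em.
have s1' : 0 < 1 - s by rewrite subr_gt0.
have h1 : (((1 - s) ^+ d * m)%:E <= lebesgue_tuple (inflated p q s w c0))%E.
  rewrite lebesgue_tuple_vaff ?invr_gt0//; last exact: witness_measurable.
  rewrite invrK EFinM lee_pmul2l ?lte_fin ?exprn_gt0// -Em; exact: mconst_le_witness.
set U := \bigcup_(j in [set: 'I_k.+1]) sup_box (w j) e.
have mU : measurable U by apply: fin_bigcup_measurable => // j _; exact: measurable_sup_box.
have h2 : (lebesgue_tuple U <= (k.+1%:R * (2 * e) ^+ d)%:E)%E.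
  apply: (le_trans (lebesgue_tuple_bigcup_le _)); first by move=> j; exact: measurable_sup_box.
  rewrite (eq_bigr (fun=> ((2 * e) ^+ d)%:E)); last by move=> j _; exact: lebesgue_sup_box.
  by rewrite sumEFin lee_fin sumr_const card_ord [leRHS]mulr_natl.
rewrite EFinB leeBlDr//; apply: (le_trans h1).
apply: (@le_trans _ _ (lebesgue_tuple (void_region p q s e w c0 `|` U))).
  rewrite lebesgue_tupleE; apply: le_measure; rewrite ?inE.
  - exact: measurable_inflated.
  - by apply: measurableU => //; exact: measurable_void_region.
  - by move=> v Hv; have [Uv|nUv] := pselect (U v); [right|left].
apply: (le_trans (lebesgue_tupleU_le _ _)) => //; first exact: measurable_void_region.
by rewrite leeD2l.
Qed.

Lemma kept_nonempty q (J : set 'I_k.+1) : (0 < k)%N -> kept q J -> exists j, J j.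
Proof.
move=> k0; case: q => [->|[i ->]]; first by exists ord0.
have [i0|i0] := eqVneq i ord0; last by exists ord0; rewrite /= eq_sym.
by exists ord_max; rewrite i0 /= -val_eqE/= -lt0n.
Qed.

(** Two steps of length at most [2], through some kept vertex; for [k > 0] there is one even after a
    vertex has been dropped. *)
Lemma witness_bounded p q w u j : (0 < k)%N -> esimplex p 1 (range w) -> witness p q w u ->
  eudist u (w j) <= 4.
Proof.
move=> k0 hw [J /(kept_nonempty k0)[i Ji] H].
rewrite (le_trans (eudist_triangle (w i) _ _))// (_ : 4 = 2 * 1 + 2 * 1); last by ring.
apply: lerD; first by apply: esimplex_diam H _ _; [right|left; exists i].
by apply: (esimplex_diam hw); [exists i|exists j].
Qed.

Lemma inflated_witness p q s eta w c0 w' v : s < 1 -> stable_at p s eta w c0 ->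
  esimplex p 1 (range w') -> (forall j, eudist (w j) (w' j) <= eta) ->
  inflated p q s w c0 v -> witness p q w' v.
Proof.
move=> s1 st hw' ww' [J qJ H]; exists J => //.
have := (st w' hw' ww' J _).1 H.
rewrite (_ : vcomb s _ _ = v)//; apply/eq_from_tnth => i; rewrite !tnth_mktuple.
by field; rewrite gt_eqF// subr_gt0.
Qed.

Lemma witness_inflated p q s eta w c0 w' v : s < 1 -> stable_at p s eta w c0 ->
  esimplex p 1 (range w') -> (forall j, eudist (w j) (w' j) <= eta) ->
  witness p q w' v -> witness p q w (vcomb s v c0).
Proof.
move=> s1 st hw' ww' [J qJ H]; exists J => //.
exact: (st w' hw' ww' J _).2 H.
Qed.

Lemma void_region_neq p q s e w c0 w' v j : (forall j, eudist (w j) (w' j) <= e) ->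
  void_region p q s e w c0 v -> v <> w' j.
Proof.
move=> ww' [_ nv] E; apply: nv; exists j => // i; rewrite /= in_itv/= E.
have := le_trans (eudist_coord _ _ i) (ww' j).
by rewrite ler_norml => /andP[h1 h2]; apply/andP; split; lra.
Qed.

End void_region.

Section isolated_void.
Context {R : realType} {d k : nat}.
Local Notation pt := (d.-tuple R).
Implicit Types w y : 'I_k.+1 -> pt.

Lemma fset_enumeration (T : choiceType) (s : {fset T}) (n : nat) : #|` s| = n.+1 ->
  exists w : 'I_n.+1 -> T, injective w /\ forall x, x \in s <-> exists j, w j = x.
Proof.
move=> cs; have [x0 x0s] : exists x, x \in s by apply/fset0Pn; rewrite -cardfs_gt0 cs.
have sz : size (enum_fset s) = n.+1 by exact: cs.
exists (fun j : 'I_n.+1 => nth x0 (enum_fset s) j); split.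
  move=> i j /eqP; rewrite nth_uniq ?fset_uniq ?sz// => /eqP; exact: val_inj.
move=> x; split => [xs|[j <-]].
  have ix : (index x (enum_fset s) < n.+1)%N by rewrite -sz index_mem.
  by exists (Ordinal ix); rewrite /= nth_index.
by apply: mem_nth; rewrite sz.
Qed.

(** Together with [face_keptP], the dictionary between [kept] sets of indices and [kept_face] sets
    of vertices. *)
Lemma kept_faceP q (s : {fset pt}) w : injective w -> (forall x, x \in s <-> exists j, w j = x) ->
  forall J : set 'I_k.+1, kept q J -> exists2 s', kept_face q s s' &
    forall x, x \in s' <-> exists2 j, J j & w j = x.
Proof.
move=> wi ws J; case: q => /=.
  move=> ->; exists s => // x; split; first by move=> /ws[j <-]; exists j.
  by move=> [j _ wj]; apply/ws; exists j.
move=> [i ->]; exists (s `\ w i)%fset; first by exists (w i) => //; apply/ws; exists i.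
move=> x; rewrite in_fsetD1; split.
  by move=> /andP[xi /ws[j wj]]; exists j => //=; apply: contraNneq xi => <-; rewrite wj.
move=> [j /= ji wj]; apply/andP; split; last by apply/ws; exists j.
by rewrite -wj; apply: contraNneq ji => /wi ->.
Qed.

Lemma face_keptP q (s : {fset pt}) w : injective w -> (forall x, x \in s <-> exists j, w j = x) ->
  forall s', kept_face q s s' -> exists2 J : set 'I_k.+1, kept q J &
    forall x, x \in s' <-> exists2 j, J j & w j = x.
Proof.
move=> wi ws s'; case: q => /=.
  move=> ->; exists setT => // x; split; first by move=> /ws[j <-]; exists j.
  by move=> [j _ wj]; apply/ws; exists j.
move=> [_ /ws[i <-] ->]; exists [set j | j != i]; first by exists i.
move=> x; rewrite in_fsetD1; split.
  by move=> /andP[xi /ws[j wj]]; exists j => //=; apply: contraNneq xi => <-; rewrite wj.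
move=> [j /= ji wj]; apply/andP; split; last by apply/ws; exists j.
by rewrite -wj; apply: contraNneq ji => /wi ->.
Qed.

Definition normalise (r : R) (b x : pt) : pt := vaff (vaff (vzero d) (- r^-1) b) r^-1 x.

Lemma vaff_normalise (r : R) (b x : pt) : 0 < r -> vaff b r (normalise r b x) = x.
Proof.
move=> r0; apply/eq_from_tnth => i; rewrite !tnth_mktuple.
by field; rewrite gt_eqF.
Qed.

Lemma eudist_normalise (r : R) (b x y : pt) : 0 < r ->
  eudist (normalise r b x) (normalise r b y) = r^-1 * eudist x y.
Proof. by move=> r0; rewrite eudist_vaff// invr_gt0. Qed.

Definition scaled (r : R) (b : pt) (V : set pt) : set pt := [set x | V (normalise r b x)].

Lemma measurable_scaled r b (V : set pt) : measurable V -> measurable (scaled r b V).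
Proof. exact: measurable_vaff_preimage. Qed.

Lemma lebesgue_scaled r b (V : set pt) : 0 < r -> measurable V ->
  lebesgue_tuple (scaled r b V) = ((r ^+ d)%:E * lebesgue_tuple V)%E.
Proof. by move=> r0 mV; rewrite lebesgue_tuple_vaff ?invr_gt0// invrK. Qed.

(** Lift the face, rescale it by [r] around the grid point near its base, and pick the net shape
    closest to the result. By stability any process point in the region of the net shape is a
    witness for the true shape, and would break isolation. *)
Lemma isolated_void p q (s eta e r : R) (G : Type) (y : G -> 'I_k.+1 -> pt) (c0 : G -> pt)
    (m : nat) (Y S : {fset pt}) :
  (0 < k)%N -> s < 1 -> e <= eta -> 0 < r -> 6 * r < 1 -> m.+1%:R^-1 <= r ->
  (forall w, esimplex p 1 (range w) ->
     (forall j i, - (d%:R + 2) <= tnth (w j) i <= d%:R + 2) ->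
     exists g, forall j, eudist (y g j) (w j) <= e) ->
  (forall g, stable_at p s eta (y g) (c0 g)) ->
  (forall x, x \in Y -> cube x) ->
  isolated_face p q Y r k S ->
  exists (c : {ffun 'I_d -> 'I_m.+2}) (g : G), forall x, x \in Y ->
    ~ torus_image (scaled r (grid_point c) (void_region p q s e (y g) (c0 g))) x.
Proof.
move=> k0 s1 ee r0 r6 mr net st Yc /(isolatedP _ _ _ _ _ k0)[[SY cS simS] iso].
have S0 : S != fset0 by rewrite -cardfs_gt0 cS.
have SY' := fsubsetP SY.
have [b [L [cb Lz Lb simL]]] := simplex_cond_unfold r0 r6 S0 (fun x xS => Yc _ (SY' _ xS)) simS.
have [w [wi wS]] := fset_enumeration cS.
have wS' j : w j \in S by apply/wS; exists j.
pose xc := round m b.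
pose w' j := normalise r xc (L (w j)).
have vw' j : vaff xc r (w' j) = L (w j) by exact: vaff_normalise.
have hw' : esimplex p 1 (range w').
  rewrite -(esimplex_vaff_iff p xc 1 _ r0) mulr1.
  apply: esimplexS simL => _ [_ [j _ <-] <-]; exists (w j); first exact: wS'.
  by rewrite vw'.
(* In units of [r]: [2] for the distance of a lifted vertex to [b], and [d] for rounding [b], the
   mesh being at most [r]. *)
have bound j i : - (d%:R + 2) <= tnth (w' j) i <= d%:R + 2.
  have h1 := round_dist m cb; have h2 := Lb _ (wS' j).
  have h3 : d%:R * m.+1%:R^-1 <= d%:R * r by rewrite ler_wpM2l.
  have h4 : eudist (L (w j)) xc <= (d%:R + 2) * r.
    rewrite (le_trans (eudist_triangle b _ _))// [eudist b xc]eudistC.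
    move: h1 h3; rewrite -/xc; move: (d%:R * m.+1%:R^-1 : R) => v; lra.
  have := le_trans (eudist_coord _ _ i) h4; rewrite -vw' tnth_mktuple addrAC subrr add0r.
  by rewrite normrM (gtr0_norm r0) mulrC ler_pM2r// ler_norml.
have [g Hg] := net w' hw' bound.
exists (grid_index m b), g => x xY [cx [z Vx]].
set v := normalise r xc (vshift x z) in Vx.
have vv : vaff xc r v = vshift x z by exact: vaff_normalise.
have Wv : witness p q w' v.
  by apply: (inflated_witness s1 (st g) hw' _ Vx.1) => j; exact: le_trans (Hg j) ee.
(* A vertex might be seen through another integer translate. Witnesses are within [4 * r < 1] of the
   lifted vertices, so the two lifts of this vertex coincide, and the excised boxes rule this
   out. *)
have xS : x \notin S.
  apply/negP => /wS[j wjx].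
  apply: (void_region_neq (j := j) (v := v) Hg Vx).
  suff E : vshift x z = L (w j) by rewrite /v /w' E.
  have [zj Ej] := Lz (w j); rewrite Ej wjx; congr vshift.
  have := witness_bounded j k0 hw' Wv; rewrite -(ler_pM2l r0) -(eudist_vaff xc)// vv vw' Ej wjx => h.
  apply/funext => i; apply/eqP; rewrite -subr_eq0; apply/eqP/(@small_int_eq0 R).
  have := le_trans (eudist_coord _ _ i) h; rewrite !tnth_mktuple intrB.
  rewrite (_ : _ + _ - _ = (z i)%:~R - (zj i)%:~R); last by ring.
  by move=> /le_lt_trans; apply; lra.
have [J qJ H] := Wv; have [s' s's Hs'] := kept_faceP wi wS qJ.
apply: (iso x xY xS s' s's).
apply: (@simplex_cond_lift _ _ p r (vaff xc r @` (w' @` J `|` [set v]))).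
  by rewrite -[X in esimplex p X]mulr1; exact: esimplex_vaff.
move=> u; rewrite in_fset1U => /orP[/eqP ->|/Hs'[j Jj <-]].
  by exists z, v; [right|].
have [zj Ej] := Lz (w j); exists zj, (w' j); first by left; exists j.
by rewrite vw'.
Qed.

End isolated_void.

Section upper_bound.
Context {R : realType} {d k : nat} {dT : measure_display} {T : measurableType dT}.
Local Notation pt := (d.-tuple R).
Variables (P : probability T R) (lambda : R) (X : T -> {fset pt}).
Hypothesis PX : poisson_process P lambda X.

Lemma fine_lebesgue_cube (B : set pt) (a : R) : measurable B -> B `<=` @cube R d ->
  (a%:E <= lebesgue_tuple B)%E -> a <= fine (lebesgue_tuple B).
Proof.
move=> mB Bc aB; rewrite -lee_fin fineK//.
rewrite ge0_fin_numE; last by rewrite lebesgue_tupleE measure_ge0.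
apply: (@le_lt_trans _ _ (lebesgue_tuple (@cube R d))).
  by rewrite lebesgue_tupleE; apply: le_measure; rewrite ?inE//; exact: measurable_cube.
rewrite (_ : @cube R d = [set x | forall i, `[0, 1]%classic (tnth x i)]); last first.
  by apply/seteqP; split => x cx i; have := cx i; rewrite /= in_itv.
rewrite (@lebesgue_tuple_box _ _ (fun=> `[0, 1]%classic)); last by move=> i; exact: measurable_itv.
rewrite (eq_bigr (fun=> 1%:E)); last first.
  by move=> i _; rewrite lebesgue_measure_itv /= lte_fin ltr01 sube0.
by rewrite prodEFin ltry.
Qed.

Lemma probability_bigcup_le (I : finType) (F : I -> set T) (a : R) :
  (forall i, measurable (F i)) -> (forall i, P (F i) <= a%:E)%E ->
  (P (\bigcup_(i in [set: I]) F i) <= (#|I|%:R * a)%:E)%E.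
Proof.
move=> mF Fa.
have -> : \bigcup_(i in [set: I]) F i = \big[setU/set0]_(i <- enum I) F i.
  rewrite -bigcup_seq; apply/seteqP; split => x [i _ Fx]; exists i => //=.
  by rewrite mem_enum.
rewrite cardE; elim: (enum I) => [|i s IH]; first by rewrite big_nil measure0 mul0r.
rewrite big_cons /= -natr1 mulrDl mul1r addrC EFinD.
have U2 (A B : set T) : measurable A -> measurable B -> (P (A `|` B) <= P A + P B)%E.
  by move=> mA mB; exact: measureU2.
apply: (le_trans (U2 _ _ _ _)) => //; first by apply: bigsetU_measurable => j _.
exact: leeD.
Qed.

Lemma num_isolated_gt0 p q (Y : {fset pt}) r : (0 < num_isolated p q Y r k)%N ->
  exists S, isolated_face p q Y r k S.
Proof.
rewrite /num_isolated cardfs_gt0 => /fset0Pn[S].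
by rewrite !inE/= => /andP[_ /asboolP]; exists S.
Qed.

(** Union bound over the grid cell of the base point and the net shape: by [isolated_void] an
    isolated face leaves one of these regions empty. *)
Lemma isolated_upper_bound p q (s eta e r v0 : R) (G : finType) (y : G -> 'I_k.+1 -> pt)
    (c0 : G -> pt) (m : nat) :
  0 <= lambda -> (0 < k)%N -> s < 1 -> 0 <= e <= eta -> 0 < r -> 8 * r < 1 -> m.+1%:R^-1 <= r ->
  (forall w, esimplex p 1 (range w) ->
     (forall j i, - (d%:R + 2) <= tnth (w j) i <= d%:R + 2) ->
     exists g, forall j, eudist (y g j) (w j) <= e) ->
  (forall g, esimplex p 1 (range (y g))) ->
  (forall g, stable_at p s eta (y g) (c0 g)) ->
  (forall g, v0%:E <= lebesgue_tuple (void_region p q s e (y g) (c0 g)))%E ->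
  (P [set w | (1 <= num_isolated p q (X w) r k)%N] <=
   ((#|{: {ffun 'I_d -> 'I_m.+2} * G}|)%:R * expR (- (lambda * (r ^+ d * v0))))%:E)%E.
Proof.
move=> l0 k0 s1 /andP[e0 ee] r0 r8 mr net hy st Hv0.
have r6 : 6 * r < 1 by lra.
pose B (cg : {ffun 'I_d -> 'I_m.+2} * G) :=
  torus_image (scaled r (grid_point cg.1) (void_region p q s e (y cg.2) (c0 cg.2))).
have mV g := measurable_void_region p q s e (y g) (c0 g).
have mB cg : measurable (B cg) by apply: measurable_torus_image; exact: measurable_scaled.
have Bc cg : B cg `<=` @cube R d by exact: torus_image_cube.
have vB cg : (lebesgue_tuple (B cg) >= (r ^+ d * v0)%:E)%E.
  apply: (@le_trans _ _ (lebesgue_tuple (scaled r (grid_point cg.1) (void_region p q s e (y cg.2) (c0 cg.2))))).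
    rewrite lebesgue_scaled// EFinM lee_pmul2l ?lte_fin ?exprn_gt0//; exact: Hv0.
  (* The region lies within [4] of a vertex, hence has diameter at most [8] before scaling;
     [8 * r < 1] ensures that no volume is lost by wrapping around the torus. *)
  apply: lebesgue_torus_image; first exact: measurable_scaled.
  move=> a b Va Vb i.
  have eta0 : 0 <= eta by exact: le_trans ee.
  have W u : scaled r (grid_point cg.1) (void_region p q s e (y cg.2) (c0 cg.2)) u ->
      eudist (normalise r (grid_point cg.1) u) (y cg.2 ord0) <= 4.
    move=> Vu; apply: (witness_bounded _ k0 (hy _)).
    by apply: (inflated_witness s1 (st cg.2) (hy _) _ Vu.1) => j; rewrite eudistxx.
  have h : eudist (normalise r (grid_point cg.1) a) (normalise r (grid_point cg.1) b) <= 8.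
    rewrite (le_trans (eudist_triangle (y cg.2 ord0) _ _))// (_ : 8 = 4 + 4); last by ring.
    by apply: lerD; [exact: W|rewrite eudistC; exact: W].
  apply: (le_lt_trans (eudist_coord _ _ i)).
  by move: h; rewrite eudist_normalise// mulrC ler_pdivrMr// => /le_lt_trans; apply.
apply: (@le_trans _ _ (P (\bigcup_(cg in [set: {ffun 'I_d -> 'I_m.+2} * G]) npoints X (B cg) @^-1` [set 0%N]))).
  apply: le_measure; rewrite ?inE.
  - exact: (num_isolated_measurable PX).
  - by apply: fin_bigcup_measurable => // cg _; exact: (npoints_measurable PX).
  move=> w /= /num_isolated_gt0[S iS].
  have [c [g Hcg]] := isolated_void k0 s1 ee r0 r6 mr net st (fun x => @pp_cube _ _ _ _ _ _ _ PX w x) iS.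
  exists (c, g) => //=; apply/eqP; rewrite cardfs_eq0; apply/eqP/fsetP => x.
  rewrite !inE/=; apply/negP => /andP[xX]; rewrite inE; exact: Hcg.
apply: probability_bigcup_le => cg; first exact: (npoints_measurable PX).
rewrite (poisson_void PX)// lee_fin ler_expR lerN2 ler_wpM2l//.
exact: fine_lebesgue_cube.
Qed.

End upper_bound.

(** * The subcritical bound *)

Section configurations.
Context {R : realType} {d k : nat}.
Local Notation pt := (d.-tuple R).
Implicit Types w y : 'I_k.+1 -> pt.

(** A near-optimal shape may lie on the boundary of the feasible set. Contraction by [1 - t] gains
    [t] on distances to the Cech centre and [2 * t] on Rips diameters, which pays for moving every
    vertex by [t]. The total displacement from [w] is at most [2 * t + t <= eta]. *)
Lemma robust_config p w (eta : R) : 0 < eta -> esimplex p 1 (range w) ->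
  exists (w1 : 'I_k.+1 -> pt) (kappa : R), 0 < kappa /\
    forall w', (forall j, eudist (w1 j) (w' j) <= kappa) ->
      esimplex p 1 (range w') /\ forall j, eudist (w j) (w' j) <= eta.
Proof.
move=> eta0 hw; pose t := Num.min 2^-1 (eta / 3).
have t0 : 0 < t by rewrite lt_min invr_gt0 ltr0n divr_gt0.
have t1 : t <= 2^-1 by rewrite ge_min lexx.
have te : 3 * t <= eta by rewrite mulrC -ler_pdivlMr// ge_min lexx orbT.
have t01 : 0 <= t <= 1 by apply/andP; split; lra.
have [c [cw H]] : exists c, (forall j, eudist (w j) c <= 2) /\
    forall w', (forall j, eudist (vcomb t (w j) c) (w' j) <= t) -> esimplex p 1 (range w').
  case: p hw => /= [[c Hc]|H].
    have wc j : eudist (w j) c <= 1 by apply: Hc; exists j.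
    exists c; split => [j|w' Hw']; first by rewrite (le_trans (wc j))// ler1n.
    exists c => _ [j _ <-]; rewrite (le_trans (eudist_triangle (vcomb t (w j) c) _ _))// [eudist (w' j) _]eudistC.
    have := Hw' j; have := eudist_vcombl (w j) c c t01; rewrite eudistxx; have := wc j; nra.
  exists (w ord0); split => [j|w' Hw' _ _ [j _ <-] [i _ <-]].
    by rewrite -[leRHS]mulr1; apply: H; [exists j|exists ord0].
  have h : eudist (vcomb t (w j) (w ord0)) (vcomb t (w i) (w ord0)) <= (1 - t) * 2.
    rewrite eudist_vcomb_vcomb// ler_wpM2l ?subr_ge0//; first by lra.
    by rewrite -[leRHS]mulr1; apply: H; [exists j|exists i].
  rewrite (le_trans (eudist_triangle (vcomb t (w j) (w ord0)) _ _))// [eudist (w' j) _]eudistC.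
  have := eudist_triangle (vcomb t (w i) (w ord0)) (vcomb t (w j) (w ord0)) (w' i).
  have := Hw' i; have := Hw' j; lra.
exists (fun j => vcomb t (w j) c), t; split => // w' Hw'; split; first exact: H.
move=> j; rewrite (le_trans (eudist_triangle (vcomb t (w j) c) _ _))//.
rewrite eudistC eudist_vcombx; last by case/andP: t01.
have := Hw' j; have := cw j; nra.
Qed.

(** Half-open, so that boxes with distinct corners in the lattice of mesh [rho] are disjoint. *)
Definition corner_box (a : pt) (rho : R) : set pt :=
  [set u | forall i, `[tnth a i, tnth a i + rho[%classic (tnth u i)].

Lemma measurable_corner_box a rho : measurable (corner_box a rho).
Proof. exact: (measurable_box (fun=> measurable_itv _)). Qed.

Lemma lebesgue_corner_box a rho : 0 < rho -> lebesgue_tuple (corner_box a rho) = (rho ^+ d)%:E.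
Proof.
move=> rho0; rewrite (@lebesgue_tuple_box _ _ (fun i => `[tnth a i, tnth a i + rho[%classic)); last first.
  by move=> i; exact: measurable_itv.
rewrite (eq_bigr (fun=> rho%:E)); last first.
  move=> i _; rewrite lebesgue_measure_itv /= lte_fin ltrDl rho0.
  by rewrite -EFinB; congr EFin; ring.
by rewrite prodEFin prodr_const card_ord.
Qed.

(* The corners are multiples of [rho] whose residues modulo [k + 1] are
   distinct, so that the boxes are disjoint. *)
Lemma disjoint_corner_boxes w (kappa rho0 : R) : (0 < d)%N -> 0 < kappa -> 0 < rho0 ->
  exists (a : 'I_k.+1 -> pt) (rho : R), [/\ 0 < rho <= rho0,
    (forall j u, corner_box (a j) rho u -> eudist (w j) u <= kappa) &
    forall j j', j != j' -> corner_box (a j) rho `&` corner_box (a j') rho = set0].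
Proof.
move=> d0 kappa0 rho00.
pose K : R := k.+1%:R; have K0 : 0 < K by rewrite ltr0n.
have D0 : 0 < (d%:R + 1 : R) by rewrite ltr_wpDl.
(* In each coordinate the box and [w j] share an interval of length [K * rho], hence a Euclidean
   error of at most [d * K * rho], to be kept below [kappa]. *)
pose rho := Num.min (kappa / (d%:R + 1) / K) rho0.
have rhop : 0 < rho by rewrite lt_min rho00 andbT !divr_gt0.
have rhok : d%:R * (K * rho) <= kappa.
  have : rho <= kappa / (d%:R + 1) / K by rewrite ge_min lexx.
  rewrite ler_pdivlMr// ler_pdivlMr// => h.
  have : 0 <= rho * K by rewrite mulr_ge0// ltW.
  move: h; nra.
pose f (j : 'I_k.+1) (i : 'I_d) := Num.floor (tnth (w j) i / (K * rho)).
pose N (j : 'I_k.+1) (i : 'I_d) : int := f j i * (k.+1)%:Z + j%:Z.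
have NR j i : (N j i)%:~R = K * (f j i)%:~R + j%:R :> R by rewrite intrD intrM mulrC.
exists (fun j => [tuple rho * (N j i)%:~R | i < d]), rho; split.
- by rewrite rhop ge_min lexx orbT.
- move=> j u Hu; apply: le_trans rhok; apply: eudist_le_max => i.
  have := Hu i; rewrite /= in_itv/= tnth_mktuple NR => /andP[u1 u2].
  have := floor_itv (tnth (w j) i / (K * rho)); rewrite -/(f j i) intrD => /andP[].
  rewrite ler_pdivlMr ?mulr_gt0// ltr_pdivrMr ?mulr_gt0// => w1 w2.
  have j0 : 0 <= (j : nat)%:R :> R by [].
  have jk : (j : nat)%:R + 1 <= K by rewrite natr1 ler_nat.
  have j0' : 0 <= rho * (j : nat)%:R by rewrite mulr_ge0// ltW.
  have jk' : rho * ((j : nat)%:R + 1) <= rho * K by rewrite ler_pM2l.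
  by rewrite ler_norml; apply/andP; split; lra.
- move=> j j' jj'; apply/seteqP; split => // u [Hu Hu'].
  have i : 'I_d by exact: Ordinal d0.
  have := Hu i; have := Hu' i; rewrite /= !in_itv/= !tnth_mktuple => /andP[u1 u2] /andP[u3 u4].
  have l1 : (N j i)%:~R < (N j' i)%:~R + 1%:~R :> R.
    by rewrite -(ltr_pM2l rhop); lra.
  have l2 : (N j' i)%:~R < (N j i)%:~R + 1%:~R :> R.
    by rewrite -(ltr_pM2l rhop); lra.
  move: l1 l2; rewrite -!intrD !ltr_int /N => l1 l2.
  move/negP: jj'; apply; apply/eqP/val_inj => /=.
  have E : f j i * (k.+1)%:Z + j%:Z = f j' i * (k.+1)%:Z + j'%:Z by move: l1 l2; lia.
  have := congr1 (fun z => (z %% k.+1)%Z) E; rewrite !modzMDl !modz_nat => -[].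
  by rewrite !modn_small.
Qed.

(* Away from the boundary of the cube, torus and Euclidean distances agree. *)
Lemma deep_esimplex p r (S : {fset pt}) x0 : 0 < r -> x0 \in S ->
  (forall i, 8 * r <= tnth x0 i <= 1 - 8 * r) -> (forall x, x \in S -> cube x) ->
  simplex_cond p r S -> esimplex p r [set` S].
Proof.
move=> r0 x0S deep Sc.
have near (u c : pt) (a t : R) : (forall i, a <= tnth u i <= 1 - a) -> eudist u c <= t ->
    forall i, a - t <= tnth c i <= 1 - (a - t).
  move=> Hu uc i; have := le_trans (eudist_coord _ _ i) uc; have := Hu i.
  by rewrite ler_norml => /andP[? ?] /andP[? ?]; apply/andP; split; lra.
case: p => H.
  have [c Hc] := H; have [cc _] := Hc _ x0S.
  have x0c : eudist x0 c <= r by apply: (torus_dist_deep deep cc _ (Hc _ x0S).2); lra.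
  have dc := near _ _ _ _ deep x0c.
  exists c => x /= xS; rewrite eudistC; apply: (torus_dist_deep dc (Sc _ xS)); first by lra.
  rewrite (le_trans (torus_dist_triangle _ _ c))// -[leRHS]add0r lerD//; last exact: (Hc _ xS).2.
  by rewrite (le_trans (torus_dist_le _ _ (fun=> 0)))// vshift0 eudistxx.
have x0x x : x \in S -> eudist x0 x <= 2 * r.
  move=> xS; apply: (torus_dist_deep deep (Sc _ xS)); first by lra.
  by apply: (rips_torus_dist _ H) => //; exact: ltW.
move=> x y /= xS yS.
apply: (torus_dist_deep (near _ _ _ _ deep (x0x _ xS)) (Sc _ yS)); first by lra.
by apply: (rips_torus_dist _ H) => //; exact: ltW.
Qed.

(** By the second half of stability, every witness of the actual shape lies in the enlarged region
    of the model [w]. That region holds no process point outside the boxes, and each box holds only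
    its vertex. The depth of [b] lets the argument be carried out in Euclidean space. *)
Lemma isolated_of_place p q (s eta r Lam rho : R) w c0 (a : 'I_k.+1 -> pt) (b : pt) (Y : {fset pt}) (x : 'I_k.+1 -> pt) :
  (0 < k)%N -> s < 1 -> 0 < r -> stable_at p s eta w c0 ->
  (forall w', (forall j, corner_box (a j) rho (w' j)) ->
     esimplex p 1 (range w') /\ forall j, eudist (w j) (w' j) <= eta) ->
  (forall j j', j != j' -> corner_box (a j) rho `&` corner_box (a j') rho = set0) ->
  (forall j u, corner_box (a j) rho u -> forall i, `|tnth u i| <= Lam) ->
  (forall i, (Lam + 8) * r <= tnth b i <= 1 - (Lam + 8) * r) ->
  (forall u, u \in Y -> cube u) ->
  (forall j u, u \in Y /\ scaled r b (corner_box (a j) rho) u <-> u = x j) ->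
  (forall u, u \in Y -> ~ scaled r b
     ([set v | witness p q w (vcomb s v c0)] `\` \bigcup_(j in [set: 'I_k.+1]) corner_box (a j) rho) u) ->
  isolated_face p q Y r k [fset x j | j in 'I_k.+1]%fset.
Proof.
move=> k0 s1 r0 st rob dis bnd bdeep Yc uniq void.
have xY j : x j \in Y by have [] := (uniq j (x j)).2 erefl.
have xb j : corner_box (a j) rho (normalise r b (x j)) by have [] := (uniq j (x j)).2 erefl.
pose w' j := normalise r b (x j).
have [hw' ww'] := rob w' xb.
have xi : injective x.
  move=> j j' E; apply/eqP/negP => /negP /dis /seteqP[/(_ (w' j)) + _]; apply.
  by split; [exact: xb|rewrite /w' E; exact: xb].
have xS u : u \in [fset x j | j in 'I_k.+1]%fset <-> exists j, x j = u.
  split=> [/imfsetP[j _ ->]|[j <-]]; first by exists j.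
  by apply/imfsetP; exists j.
have vx j : vaff b r (w' j) = x j by exact: vaff_normalise.
apply/isolatedP => //; split.
  split.
  - by apply/fsubsetP => u /xS[j <-].
  - by rewrite card_imfset//= -cardE card_ord.
  - apply: (@simplex_cond_lift _ _ p r (vaff b r @` range w')).
      by rewrite -[X in esimplex p X]mulr1; exact: esimplex_vaff.
    by move=> u /xS[j <-]; exists (fun=> 0); exists (w' j); [exists j|rewrite vshift0].
move=> u uY uS s' s's Hs'.
have [J qJ HJ] := face_keptP xi xS s's.
have [j0 Jj0] := kept_nonempty k0 qJ.
have xdeep i : 8 * r <= tnth (x j0) i <= 1 - 8 * r.
  rewrite -vx tnth_mktuple; have := bnd _ _ (xb j0) i; rewrite -/(w' _) ler_norml => /andP[h1 h2].
  have /andP[b1 b2] := bdeep i.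
  by apply/andP; split; nra.
have x0s : x j0 \in (u |` s')%fset by rewrite in_fset1U; apply/orP; right; apply/HJ; exists j0.
have sc v : v \in (u |` s')%fset -> cube v.
  by rewrite in_fset1U => /orP[/eqP ->|/HJ[j _ <-]]; apply: Yc.
have es := deep_esimplex r0 x0s xdeep sc Hs'.
apply: (void u uY); split.
  apply: (witness_inflated s1 st hw' ww'); exists J => //.
  rewrite -(esimplex_vaff_iff p b 1 _ r0) mulr1; apply: esimplexS es.
  move=> _ [v [[j Jj <-]|->] <-] /=; rewrite in_fset1U; apply/orP; [right|left].
    by apply/HJ; exists j.
  by rewrite vaff_normalise.
move=> [j _ uj]; move/negP: uS; apply; apply/xS; exists j.
by apply/esym/(uniq j u); split.
Qed.

End configurations.

Section places.
Context {R : realType} {d k : nat} {dT : measure_display} {T : measurableType dT}.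
Local Notation pt := (d.-tuple R).
Variables (P : probability T R) (lambda : R) (X : T -> {fset pt}).
Hypothesis PX : poisson_process P lambda X.

Definition place_center (K : nat) (i : {ffun 'I_d -> 'I_K}) : pt :=
  [tuple ((i l)%:R * 2 + 1) / (2 * K%:R) | l < d].

Lemma place_center_deep K (i : {ffun 'I_d -> 'I_K}) l :
  (2 * K%:R)^-1 <= tnth (place_center i) l <= 1 - (2 * K%:R)^-1.
Proof.
have K0 : (0 < K)%N by exact: leq_ltn_trans (ltn_ord (i l)).
have K0' : 0 < 2 * (K%:R : R) by rewrite mulr_gt0// ltr0n.
rewrite tnth_mktuple [((i l)%:R * 2 + 1) / _]mulrDl div1r; set h : R := (2 * K%:R)^-1.
have h0 : 0 < h by rewrite invr_gt0.
have i0 : 0 <= ((i l : nat)%:R : R) by [].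
have iK : (i l : nat)%:R + 1 <= K%:R :> R by rewrite natr1 ler_nat.
have Kh : 2 * K%:R * h = 1 by rewrite /h mulfV// gt_eqF.
apply/andP; split; nra.
Qed.

Lemma place_center_sep K (i i' : {ffun 'I_d -> 'I_K}) (x : pt) (h : R) : h <= (2 * K%:R)^-1 ->
  (forall l, `|tnth x l - tnth (place_center i) l| < h) ->
  (forall l, `|tnth x l - tnth (place_center i') l| < h) -> i = i'.
Proof.
move=> hK Hi Hi'; apply/ffunP => l; apply/val_inj => /=.
have K0 : (0 < K)%N by exact: leq_ltn_trans (ltn_ord (i l)).
have K0' : 0 < 2 * (K%:R : R) by rewrite mulr_gt0// ltr0n.
have := lt_le_trans (Hi l) hK; have := lt_le_trans (Hi' l) hK.
rewrite !tnth_mktuple [((i l)%:R * 2 + 1) / _]mulrDl [((i' l)%:R * 2 + 1) / _]mulrDl div1r; set g : R := (2 * K%:R)^-1.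
have g0 : 0 < g by rewrite invr_gt0.
rewrite !ltr_norml => /andP[a1 a2] /andP[b1 b2].
have u1 : ((i l : nat)%:R : R) < (i' l : nat)%:R + 1 by rewrite -(ltr_pM2r g0); lra.
have u2 : ((i' l : nat)%:R : R) < (i l : nat)%:R + 1 by rewrite -(ltr_pM2r g0); lra.
by move: u1 u2; rewrite !natr1 !ltr_nat; lia.
Qed.

Lemma tnth_normalise r (b x : pt) l : 0 < r -> tnth x l - tnth b l = r * tnth (normalise r b x) l.
Proof. by move=> r0; rewrite -{1}(vaff_normalise b x r0) tnth_mktuple; ring. Qed.

Lemma npoints_one (B : set pt) w : npoints X B w = 1%N ->
  exists x, forall u, u \in X w /\ B u <-> u = x.
Proof.
move=> /eqP/cardfs1P[x E]; exists x => u.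
have := congr1 (fun A : {fset pt} => u \in A) E; rewrite in_fset1 !inE/= => Eu.
split=> [[uX uB]|->].
  by apply/eqP; rewrite -Eu uX; rewrite inE.
have := congr1 (fun A : {fset pt} => x \in A) E; rewrite in_fset1 eqxx !inE/= => /andP[xX xB].
by split => //; rewrite inE in xB.
Qed.

Lemma npoints_zero (B : set pt) w : npoints X B w = 0%N -> forall u, u \in X w -> ~ B u.
Proof.
move=> /eqP; rewrite cardfs_eq0 => /eqP E u uX uB.
have := congr1 (fun A : {fset pt} => u \in A) E; rewrite !inE/= uX/=.
by rewrite mem_set.
Qed.

(** Fewer than [M] isolated faces means that one of [M] groups of [Q] places has no good place,
    which independence bounds by [exp (- Q * p0)]. Regions of different places are disjoint, so the
    groups produce distinct faces. *)
Lemma isolated_lower_bound p q (s eta r Lam rho Wbar : R) (w : 'I_k.+1 -> pt) c0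
    (a : 'I_k.+1 -> pt) (K M Q : nat) :
  (0 < d)%N -> (0 < k)%N -> s < 1 -> 0 < r -> 0 < rho -> 0 < lambda ->
  stable_at p s eta w c0 ->
  (forall w', (forall j, corner_box (a j) rho (w' j)) ->
     esimplex p 1 (range w') /\ forall j, eudist (w j) (w' j) <= eta) ->
  (forall j j', j != j' -> corner_box (a j) rho `&` corner_box (a j') rho = set0) ->
  (forall j u, corner_box (a j) rho u -> forall i, `|tnth u i| <= Lam) ->
  (forall u, witness p q w (vcomb s u c0) -> forall i, `|tnth u i| <= Lam) ->
  (lebesgue_tuple [set v | witness p q w (vcomb s v c0)] <= Wbar%:E)%E ->
  (0 < K)%N -> (Lam + 8) * r <= (2 * K%:R)^-1 ->
  1 <= lambda * (r ^+ d * rho ^+ d) ->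
  (M * Q <= K ^ d)%N ->
  (P [set t | (num_isolated p q (X t) r k < M)%N] <=
   (M%:R * expR (- (Q%:R * expR (- (lambda * (r ^+ d * (Wbar + k.+1%:R * rho ^+ d)))))))%:E)%E.
Proof.
move=> d0 k0 s1 r0 rho0 l0 st rob dis bndbox bndW WbarH K0 LamK lam1 MQ.
pose W := [set v | witness p q w (vcomb s v c0)].
have mW : measurable W.
  rewrite (_ : W = [set v | witness p q w (vaff (vaff (vzero d) s c0) (1 - s) v)]).
    by apply: measurable_vaff_preimage; exact: witness_measurable.
  apply/seteqP; split => v; rewrite /W /=;
  by rewrite (_ : vcomb s v c0 = vaff (vaff (vzero d) s c0) (1 - s) v)//;
    apply/eq_from_tnth => i; rewrite !tnth_mktuple; ring.
pose U := \bigcup_(j in [set: 'I_k.+1]) corner_box (a j) rho.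
have mU : measurable U by apply: fin_bigcup_measurable => // j _; exact: measurable_corner_box.
(* Index [ord0] is the region to be void, the others are the boxes to hold one vertex each;
   subtracting [U] makes the family disjoint, as independence requires. *)
pose V (o : 'I_k.+2) := if unlift ord0 o is Some j then corner_box (a j) rho else W `\` U.
have mV o : measurable (V o).
  by rewrite /V; case: unlift => [j|]; [exact: measurable_corner_box|exact: measurableD].
have bndV o u : V o u -> forall i, `|tnth u i| <= Lam.
  by rewrite /V; case: unlift => [j|]; [exact: bndbox|move=> [Wu _]; exact: bndW].
have disV o o' : o != o' -> V o `&` V o' = set0.
  move=> oo'; apply/seteqP; split => // u; rewrite /V.
  case: (unliftP ord0 o) oo' => [j ->|->] oo'; case: (unliftP ord0 o') oo' => [j' ->|->] oo' [].
  - have jj' : j != j' by apply: contra oo' => /eqP ->.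
    by move=> h1 h2; have /seteqP[/(_ u (conj h1 h2))] := dis _ _ jj'.
  - by move=> ju [_]; apply; exists j.
  - by move=> [_ nu] ju; apply: nu; exists j'.
  - by rewrite eqxx in oo'.
pose PL := {ffun 'I_d -> 'I_K}.
pose B (io : PL * 'I_k.+2) := scaled r (place_center io.1) (V io.2).
have mB io : measurable (B io) by exact: measurable_scaled.
have near io u : B io u -> forall l, `|tnth u l - tnth (place_center io.1) l| < (Lam + 8) * r.
  move=> Bu l; rewrite (tnth_normalise _ _ _ r0) normrM (gtr0_norm r0) mulrC ltr_pM2r//.
  by rewrite (le_lt_trans (bndV _ _ Bu l))// ltrDl.
have Bc io : B io `<=` @cube R d.
  move=> u Bu l; have := lt_le_trans (near io u Bu l) LamK; have := place_center_deep io.1 l.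
  by rewrite ltr_norml => /andP[? ?] /andP[? ?]; apply/andP; split; lra.
have disB io io' : io != io' -> B io `&` B io' = set0.
  move=> ne; apply/seteqP; split => // u [Bu Bu'].
  have Ei := place_center_sep LamK (near _ _ Bu) (near _ _ Bu').
  case: io ne Bu Ei => i o ne Bu /= Ei; case: io' ne Bu' Ei => i' o' ne Bu' /= Ei.
  subst i'; have oo' : o != o' by apply: contra ne => /eqP ->.
  have /seteqP[+ _] := disV _ _ oo'; move=> /(_ (normalise r (place_center i) u)); apply.
  by split; [exact: Bu|exact: Bu'].
pose D (o : 'I_k.+2) : set nat := if unlift ord0 o is Some j then [set 1%N] else [set 0%N].
pose c (o : 'I_k.+2) : R := if unlift ord0 o is Some j then lambda * (r ^+ d * rho ^+ d) else lambda * (r ^+ d * Wbar).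
have PB io : ((expR (- c io.2))%:E <= P (npoints X (B io) @^-1` D io.2))%E.
  have vB : lebesgue_tuple (B io) = ((r ^+ d)%:E * lebesgue_tuple (V io.2))%E.
    exact: lebesgue_scaled.
  have rd0 : 0 < r ^+ d by rewrite exprn_gt0.
  rewrite /c /D; case: (unliftP ord0 io.2) => [j|] Eo.
    have E : fine (lebesgue_tuple (B io)) = r ^+ d * rho ^+ d.
      by rewrite vB Eo /V liftK lebesgue_corner_box// -EFinM.
    rewrite (poisson_one PX)//; last first.
      by rewrite E; exact: lt_le_trans lam1.
    (* The mean [t] of a box is at least [1], so [t * exp (- t)] is bounded below by [exp (- t)]. *)
    by rewrite lee_fin E ler_peMl// expR_ge0.
  rewrite (poisson_void PX)//; last exact: ltW.
  rewrite lee_fin ler_expR lerN2; apply: ler_wpM2l; first exact: ltW.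
  have le1 : (lebesgue_tuple (B io) <= (r ^+ d * Wbar)%:E)%E.
    rewrite vB EFinM lee_pmul2l ?lte_fin//; apply: le_trans WbarH.
    rewrite Eo /V unlift_none lebesgue_tupleE; apply: le_measure; rewrite ?inE//.
      exact: measurableD.
  rewrite -lee_fin fineK// ge0_fin_numE; last by rewrite lebesgue_tupleE measure_ge0.
  exact: le_lt_trans le1 (ltry _).
set p0 := expR (- (lambda * _)).
have Hp0 i : (p0%:E <= \prod_o P (npoints X (B (i, o)) @^-1` D o))%E.
  have fP (A : set T) : measurable A -> P A = (fine (P A))%:E.
    by move=> mA; rewrite fineK// fin_num_measure.
  rewrite (eq_bigr (fun o => (fine (P (npoints X (B (i, o)) @^-1` D o)))%:E)); last first.
    by move=> o _; apply: fP; exact: (npoints_measurable PX).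
  rewrite prodEFin lee_fin; apply: (@le_trans _ _ (\prod_(o < k.+2) expR (- c o))).
    rewrite -expR_sum ler_expR sumrN lerN2 big_ord_recl /= /c unlift_none.
    rewrite (eq_bigr (fun=> lambda * (r ^+ d * rho ^+ d))); last by move=> j _; rewrite liftK.
    by rewrite sumr_const card_ord -[_ *+ k.+1]mulr_natl le_eqVlt; apply/orP; left; apply/eqP; ring.
  apply: ler_prod => o _; rewrite expR_ge0/= -lee_fin -fP; last exact: (npoints_measurable PX).
  exact: (PB (i, o)).
(* Group [g] consists of the places numbered [g * Q + b]; the default [pl0] is never reached, since
   [M * Q] does not exceed the number [K ^ d] of places. *)
pose pl0 : PL := [ffun=> Ordinal K0].
pose f (g : 'I_M) (b : 'I_Q) : PL := nth pl0 (enum PL) (g * Q + b).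
have f_lt (g : 'I_M) (b : 'I_Q) : (g * Q + b < size (enum PL))%N.
  rewrite -cardE card_ffun !card_ord; apply: leq_trans MQ.
  by have := ltn_ord g; have := ltn_ord b; nia.
have f_inj g b g' b' : f g b = f g' b' -> g = g' /\ b = b'.
  move=> /eqP; rewrite nth_uniq ?enum_uniq ?f_lt// => /eqP E.
  have Q0 : (0 < Q)%N by exact: leq_ltn_trans (ltn_ord b).
  have Eg : (g : nat) = g'.
    have := congr1 (fun n => n %/ Q)%N E; rewrite !divnMDl// !divn_small//.
    by rewrite !addn0.
  split; apply/val_inj => //=; by move: E; rewrite Eg => /addnI.
pose E (i : PL) := \bigcap_(o in [set: 'I_k.+2]) npoints X (B (i, o)) @^-1` D o.
have mE i : measurable (E i).
  by apply: fin_bigcap_measurable => // o _; exact: (npoints_measurable PX).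
have face t i : E i t -> exists S, isolated_face p q (X t) r k S /\
    exists2 u, u \in S & forall u', u' \in S -> exists o, B (i, o) u'.
  move=> Et.
  have /choice[x Hx] : forall j : 'I_k.+1, exists x, forall u, u \in X t /\ B (i, lift ord0 j) u <-> u = x.
    move=> j; apply: npoints_one; have := Et (lift ord0 j) Logic.I.
    by rewrite /D liftK.
  have zero : forall u, u \in X t -> ~ B (i, ord0) u.
    apply: npoints_zero; have := Et ord0 Logic.I; by rewrite /D unlift_none.
  exists [fset x j | j in 'I_k.+1]%fset; split.
    apply: (@isolated_of_place _ _ _ p q s eta r Lam rho w c0 a (place_center i)) => //.
    - move=> l; have /andP[h1 h2] := place_center_deep i l; apply/andP; split; lra.
    - by move=> u; exact: (pp_cube PX).
    - by move=> j u; have := Hx j u; rewrite /B /= /V liftK.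
    - by move=> u uX; have := zero u uX; rewrite /B /= /V unlift_none.
  exists (x ord0); first by apply/imfsetP; exists ord0.
  move=> u' /imfsetP[j _ ->]; exists (lift ord0 j).
  by have [] := (Hx j (x j)).2 erefl.
apply: (@le_trans _ _ (P (\bigcup_(g in [set: 'I_M]) \bigcap_(b in [set: 'I_Q]) ~` E (f g b)))).
  have mcap g : measurable (\bigcap_(b in [set: 'I_Q]) ~` E (f g b)).
    by apply: fin_bigcap_measurable => // b _; exact: measurableC.
  apply: le_measure; rewrite ?inE.
  - rewrite (_ : [set t | _] = ~` [set t | (M <= num_isolated p q (X t) r k)%N]).
      by apply: measurableC; exact: (num_isolated_measurable PX).
    by apply/seteqP; split => t /=; rewrite ltnNge => /negP.
  - by apply: fin_bigcup_measurable => // g _.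
  move=> t /= JM; apply: contrapT => none.
  have /choice[b Hb] : forall g : 'I_M, exists b : 'I_Q, E (f g b) t.
    move=> g; apply: contrapT => nb; apply: none; exists g => // b _ Eb; apply: nb; by exists b.
  have /choice[S HS] : forall g : 'I_M, exists S, isolated_face p q (X t) r k S /\
    exists2 u, u \in S & forall u', u' \in S -> exists o, B (f g (b g), o) u'.
    by move=> g; exact: face.
  move: JM; rewrite ltnNge => /negP; apply.
  have Sinj : injective S.
    move=> g g' ES; case: (HS g) => _ [u uS H]; case: (HS g') => _ [u0 _ H'].
    have [l1 Bo] := H u uS.
    have [l2 Bo'] : exists o, B (f g' (b g'), o) u by apply: H'; rewrite -ES.
    by have /f_inj[] := place_center_sep LamK (near _ _ Bo) (near _ _ Bo').
  have cS : #|` [fset S g | g in 'I_M]%fset| = M by rewrite card_imfset//= -cardE card_ord.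
  rewrite -[X in (X <= _)%N]cS /num_isolated; apply: fsubset_leq_card.
  apply/fsubsetP => _ /imfsetP[g _ ->]; have [iS _] := HS g.
  have [[SX _ _] _] := iS.
  by rewrite !inE/= fpowersetE SX/=; exact/asboolP.
rewrite [leRHS](_ : _ = (#|'I_M|%:R * expR (- (Q%:R * p0)))%:E); last by rewrite card_ord.
apply: probability_bigcup_le => g.
  by apply: fin_bigcap_measurable => // b _; exact: measurableC.
have := @pp_independent_blocks _ _ _ _ _ _ _ PX 'I_Q 'I_k.+2 (fun bo => B (f g bo.1, bo.2)) D p0.
rewrite card_ord; apply => //.
- move=> [b o] [b' o'] /= ne; apply: disB; apply: contra ne => /eqP[/f_inj[_ -> ->]]//.
- by move=> b; have := Hp0 (f g b).
Qed.

End places.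

(** * Asymptotics *)

Section asymptotics.
Context {R : realType}.

Lemma ln_nat_large (A : R) : exists N, forall n : nat, (N <= n)%N -> A <= ln n%:R.
Proof.
exists (Num.truncn (expR A)).+1 => n Nn.
have h : expR A <= n%:R by rewrite (le_trans (ltW (truncnS_gt _)))// ler_nat.
by rewrite -(@ler_expR R) lnK// posrE (lt_le_trans (expR_gt0 A)).
Qed.

(** One term of the exponential series serves both limits: [ln n / n] to zero and [n^a / ln n] to
    infinity. *)
Lemma expR_ge_sqr (x : R) : 0 <= x -> x ^+ 2 / 2 <= expR x.
Proof.
move=> x0; have := expR_ge1Dxn 1 x0; rewrite (_ : 2`! = 2)%N//.
by apply: le_trans; rewrite lerDr.
Qed.

Lemma bernoulli_le (d : nat) (s : R) : 0 <= s <= 1 -> 1 - d%:R * s <= (1 - s) ^+ d.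
Proof.
move=> /andP[s0 s1]; elim: d => [|d IH]; first by rewrite expr0 mul0r subr0.
rewrite exprS -natr1; have d0 : 0 <= d%:R * s * s by rewrite !mulr_ge0.
have : (1 - s) * (1 - d%:R * s) <= (1 - s) * (1 - s) ^+ d by rewrite ler_wpM2l// subr_ge0.
by apply: le_trans; lra.
Qed.

Lemma ereal_cvg_eps (u : nat -> \bar R) (l : R) :
  (forall e, 0 < e -> exists N, forall n, (N <= n)%N -> exists2 x, u n = x%:E & `|l - x| <= e) ->
  u n @[n --> \oo] --> l%:E.
Proof.
move=> H; apply/fine_cvgP; split.
  have [N HN] := H 1 ltr01; exists N => // n /= /HN[x -> _].
  by [].
apply/cvgrPdist_le => e e0; have [N HN] := H e e0; exists N => // n /= /HN[x -> h].
by [].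
Qed.

(** From [(ln n)^2 / 2 <= n] one gets [r n ^+ d <= 2 * c / (m * ln n)]. *)
Lemma radius_small (d : nat) (c m : R) (r : nat -> R) (rho : R) : (0 < d)%N ->
  0 < c -> 0 < m -> (forall n, (2 <= n)%N -> 0 < r n) ->
  (forall n, (2 <= n)%N -> n%:R * m * r n ^+ d = c * ln n%:R) -> 0 < rho ->
  exists N, forall n, (N <= n)%N -> r n < rho.
Proof.
move=> d0 c0 m0 r0 E rho0.
have rd0 : 0 < rho ^+ d by rewrite exprn_gt0.
have [N HN] := ln_nat_large (2 * c / (m * rho ^+ d) + 1); exists (maxn N 2) => n.
rewrite geq_max => /andP[/HN Ln n2].
have n0 : 0 < (n%:R : R) by rewrite ltr0n ltnW.
have L0 : 0 < ln (n%:R : R).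
  by apply: lt_le_trans Ln; rewrite ltr_wpDl// divr_ge0// ?mulr_ge0// ltW// mulr_gt0.
rewrite -(@ltr_pXn2r _ d) ?nnegrE ?(ltW rho0) ?(ltW (r0 _ n2))//.
have nL : ln n%:R ^+ 2 / 2 <= (n%:R : R).
  by apply: le_trans (expR_ge_sqr (ltW L0)) _; rewrite lnK// posrE.
have nm0 : 0 < n%:R * m by rewrite mulr_gt0.
rewrite -(ltr_pM2l nm0) E//.
have h : 2 * c / (m * rho ^+ d) < ln n%:R by apply: lt_le_trans Ln; rewrite ltrDl.
rewrite ltr_pdivrMr ?mulr_gt0// in h.
rewrite -mulrA; apply: (@lt_le_trans _ _ (ln n%:R ^+ 2 / 2 * (m * rho ^+ d))); last first.
  by rewrite ler_pM2r// mulr_gt0.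
have := h; rewrite -(ltr_pM2l L0); set q := m * _; set L := ln _.
by move=> hh; rewrite expr2; lra.
Qed.

End asymptotics.

(** * The two regimes *)

Section regimes.
Context {R : realType} {d k : nat}.
Local Notation pt := (d.-tuple R).

(** The scaling hypothesis at [n = 2] already forces [mconst] to be finite and positive, its
    right-hand side being a positive real and [r 2] positive. *)
Lemma mconst_pos p q (r : nat -> R) (c : R) : 0 < c -> (forall n, (2 <= n)%N -> 0 < r n) ->
  (forall n, (2 <= n)%N ->
      n%:R%:E * mconst d k p q * (r n ^+ d)%:E = (c * ln n%:R)%:E)%E ->
  exists m : R, [/\ mconst d k p q = m%:E, 0 < m &
    forall n, (2 <= n)%N -> n%:R * m * r n ^+ d = c * ln n%:R].
Proof.
move=> c0 r0 H; have := H 2%N isT; have rd0 : 0 < r 2%N ^+ d by rewrite exprn_gt0// r0.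
case E : (mconst d k p q) => [m| |].
- move=> H2; exists m; split => //; last first.
    by move=> n n2; have := H n n2; rewrite E -!EFinM => -[].
  move: H2; rewrite -!EFinM => -[H2].
  have : 0 < 2 * m * r 2%N ^+ d by rewrite H2 mulr_gt0// ln_gt0// ltr1n.
  by rewrite pmulr_lgt0// pmulr_rgt0.
- by rewrite gt0_muley ?lte_fin// gt0_mulye ?lte_fin.
- by rewrite gt0_muleNy ?lte_fin// gt0_mulNye ?lte_fin.
Qed.

Section process.
Context (p : complex_kind) (q : connectivity) (dT : nat -> measure_display)
    (T : forall n, measurableType (dT n)) (P : forall n, probability (T n) R)
    (X : forall n, T n -> {fset pt}) (r : nat -> R) (c m eps : R).
Hypothesis d2 : (2 <= d)%N.
Hypothesis k0 : (0 < k)%N.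
Hypothesis PX : forall n, (1 <= n)%N -> poisson_process (P n) n%:R (@X n).
Hypothesis eps01 : 0 < eps < 1.
Hypothesis r0 : forall n, (2 <= n)%N -> 0 < r n.
Hypothesis m0 : 0 < m.
Hypothesis Em : mconst d k p q = m%:E.

Lemma supercritical : c = 1 + eps ->
  (forall n, (2 <= n)%N -> n%:R * m * r n ^+ d = c * ln n%:R) ->
  forall e, 0 < e -> exists N, forall n, (N <= n)%N ->
    (2 <= n)%N /\ (P n [set w | (1 <= num_isolated p q (@X n w) (r n) k)%N] <= e%:E)%E.
Proof.
move=> Ec E e e0; have /andP[ep0 ep1] := eps01.
have d0 : (0 < d)%N by exact: leq_trans d2.
have d0R : 0 < (d%:R : R) by rewrite ltr0n.
have c0 : 0 < c by rewrite Ec addr_gt0.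
(* By Bernoulli [(1 - s) ^+ d >= 1 - eps / 4]; a further [eps / 4] is granted to the excised boxes
   through [ee]. *)
pose s := eps / (4 * d%:R).
have s0 : 0 < s by rewrite divr_gt0// mulr_gt0.
have ds : d%:R * s = eps / 4 by rewrite /s; field; rewrite gt_eqF.
have s1 : s < 1.
  have : s <= d%:R * s by rewrite ler_peMl// ?ler1n// ltW.
  rewrite ds; lra.
have [|eta eta0 stab] := @simplex_stable R d k p s; first by rewrite s0.
pose K : R := k.+1%:R; have K0 : 0 < K by rewrite ltr0n.
pose ee := Num.min eta (Num.min 2^-1 (eps * m / (8 * K))).
have ee0 : 0 < ee by rewrite !lt_min eta0 invr_gt0 ltr0n divr_gt0// mulr_gt0.
have ee_eta : ee <= eta by rewrite ge_min lexx.
have ee_half : ee <= 2^-1 by rewrite !ge_min lexx orbT.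
have ee_m : 8 * K * ee <= eps * m.
  by rewrite mulrC -ler_pdivlMr ?mulr_gt0// !ge_min lexx !orbT.
pose v0 := (1 - s) ^+ d * m - K * (2 * ee) ^+ d.
(* [(1 + eps) * (1 - eps / 2) >= 1] as [eps < 1]: what is left of the volume still gives a void
   probability of at most [1 / n]. *)
have cv0 : m <= c * v0.
  have h1 : (1 - eps / 4) * m <= (1 - s) ^+ d * m.
    by rewrite ler_pM2r// -ds bernoulli_le// !ltW.
  have h2 : (2 * ee) ^+ d <= 2 * ee.
    rewrite -[leRHS]expr1; apply: ler_wiXn2l => //; first by rewrite mulr_ge0// ltW.
    by lra.
  have h3 : K * (2 * ee) ^+ d <= K * (2 * ee) by rewrite ler_pM2l.
  have h4 : (1 - eps / 4) * m - eps * m / 4 <= v0 by rewrite /v0; lra.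
  apply: (@le_trans _ _ (c * ((1 - eps / 4) * m - eps * m / 4))); last by rewrite ler_pM2l.
  rewrite Ec [leRHS](_ : _ = m * ((1 + eps) * (1 - eps / 2))); last by field.
  by rewrite ler_peMr ?(ltW m0)//; nra.
have [G [y [hy net]]] := @config_net R d k p (d%:R + 2) ee (ltr_wpDl (ler0n _ _) (ltr0Sn _ 1)) ee0.
have /choice[c0' st] : forall g, exists c0, stable_at p s eta (y g) c0 by move=> g; exact: stab.
have Hv0 g := lebesgue_void_region (c0' g) s1 (ltW ee0) (hy g) Em.
pose C : R := #|G|%:R * 3 ^+ d * m / c.
have h80 : 0 < 8^-1 :> R by rewrite invr_gt0.
have [N1 HN1] := radius_small d0 c0 m0 r0 E h80.
have [N2 HN2] := ln_nat_large (C / e + 1).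
exists (maxn (maxn N1 N2) 2) => n; rewrite !geq_max => /andP[/andP[/HN1 r8 /HN2 Ln] n2].
split => //; have rn0 := r0 n2.
have n0 : 0 < (n%:R : R) by rewrite ltr0n ltnW.
have C0 : 0 <= C by rewrite divr_ge0 ?(ltW c0)// !mulr_ge0// ?exprn_ge0// ltW.
have L0 : 0 < ln (n%:R : R) by apply: lt_le_trans Ln; rewrite ltr_wpDl// divr_ge0// ltW.
set L := ln (n%:R : R) in Ln L0.
have rd0 : 0 < r n ^+ d by rewrite exprn_gt0.
(* The mesh [1 / (mm + 1)] is at most [r n], while the index range [mm.+2] stays below [3 / r n]. *)
pose mm := Num.truncn (r n)^-1.
have mm1 : (mm.+1%:R : R)^-1 <= r n.
  by rewrite -[leRHS]invrK lef_pV2 ?posrE ?invr_gt0// ltW// truncnS_gt.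
have n1 : (1 <= n)%N by exact: ltnW.
have h8 : 8 * r n < 1 by move: r8; lra.
have eer : 0 <= ee <= eta by rewrite ltW.
have B := isolated_upper_bound (PX n1) (ltW n0) k0 s1 eer rn0 h8 mm1 net hy st Hv0.
apply: (le_trans B); rewrite lee_fin card_prod card_ffun !card_ord natrM natrX.
have rL : n%:R * r n ^+ d = c * L / m by rewrite -E//; field; rewrite gt_eqF.
have e1 : expR (- (n%:R * (r n ^+ d * v0))) <= n%:R^-1.
  rewrite -[n%:R in leRHS](@lnK R) ?posrE// -expRN ler_expR lerN2 mulrA rL -/L.
  have -> : c * L / m * v0 = L * (c * v0) / m by ring.
  by rewrite ler_pdivlMr// ler_pM2l.
have e2 : (mm.+2%:R : R) <= 3 / r n.
  rewrite -natr1 -natr1.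
  have : (mm%:R : R) <= (r n)^-1 by rewrite truncn_le invr_ge0 ltW.
  have : 1 <= (r n)^-1 by rewrite invf_ge1//; lra.
  lra.
have e3 : (mm.+2%:R : R) ^+ d <= 3 ^+ d / r n ^+ d.
  have h3r : 0 <= 3 / r n by rewrite divr_ge0// ltW.
  by rewrite -expr_div_n ler_pXn2r ?nnegrE.
apply: (@le_trans _ _ (3 ^+ d / r n ^+ d * #|G|%:R * n%:R^-1)).
  rewrite ler_pM ?expR_ge0 ?mulr_ge0 ?exprn_ge0//.
  by rewrite ler_wpM2r.
(* With [r n ^+ d = c * L / (m * n)] the number of cells cancels the void probability [1 / n], and
   [1 / L] survives. *)
rewrite (_ : _ * _ = C / L); last first.
  have -> : r n ^+ d = c * L / (m * n%:R).
    by rewrite -E//; field; rewrite !gt_eqF.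
  rewrite /C; field; rewrite !gt_eqF//.
rewrite ler_pdivrMr// mulrC -ler_pdivrMr//.
by apply: le_trans Ln; rewrite lerDl.
Qed.

Lemma witness_bounded_coords (w : 'I_k.+1 -> pt) s c0 : s < 1 -> esimplex p 1 (range w) ->
  exists Lam, forall u, witness p q w (vcomb s u c0) -> forall i, `|tnth u i| <= Lam.
Proof.
move=> s1 hw; have s1' : 0 < 1 - s by rewrite subr_gt0.
exists ((\sum_i `|tnth (w ord0) i| + \sum_i `|s * tnth c0 i| + 4) / (1 - s)) => u Hu i.
have := le_trans (eudist_coord _ _ i) (witness_bounded ord0 k0 hw Hu).
rewrite tnth_mktuple => h; rewrite ler_pdivlMr// -(gtr0_norm s1') mulrC -normrM.
have h1 : `|tnth (w ord0) i| <= \sum_i `|tnth (w ord0) i| by rewrite (bigD1 i)//= lerDl sumr_ge0.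
have h2 : `|s * tnth c0 i| <= \sum_i `|s * tnth c0 i| by rewrite (bigD1 i)//= lerDl sumr_ge0.
rewrite (_ : (1 - s) * _ = ((1 - s) * tnth u i + s * tnth c0 i - tnth (w ord0) i)
   + tnth (w ord0) i - s * tnth c0 i); last by ring.
by rewrite (le_trans (ler_normB _ _))// (le_trans (lerD (ler_normD _ _) (lexx _)))//; lra.
Qed.

Lemma subcritical : c = 1 - eps ->
  (forall n, (2 <= n)%N -> n%:R * m * r n ^+ d = c * ln n%:R) ->
  forall M e, 0 < e -> exists N, forall n, (N <= n)%N ->
    (2 <= n)%N /\ (P n [set w | (num_isolated p q (@X n w) (r n) k < M.+1)%N] <= e%:E)%E.
Proof.
move=> Ec E M e e0; have /andP[ep0 ep1] := eps01.
have d0 : (0 < d)%N by exact: leq_trans d2.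
have d0R : 0 < (d%:R : R) by rewrite ltr0n.
have c0 : 0 < c by rewrite Ec subr_gt0.
have em0 : 0 < eps * m by rewrite mulr_gt0.
(* Three losses are budgeted: [eps * m / 8] for the near-minimiser [w], a factor [1 + eps / 8] for
   the homothety, and [eps * m / 8] for the boxes. They leave [c * Theta <= (1 - eps / 2) * m]. *)
have em8 : 0 < eps * m / 8 by rewrite divr_gt0.
have [w [hw Hw]] := mconst_approx Em em8.
pose s := eps / (16 * d%:R).
have s0 : 0 < s by rewrite divr_gt0// mulr_gt0.
have ds : d%:R * s = eps / 16 by rewrite /s; field; rewrite gt_eqF.
have s1 : s < 1.
  have : s <= d%:R * s by rewrite ler_peMl// ?ler1n// ltW.
  rewrite ds; lra.
have s1' : 0 < 1 - s by rewrite subr_gt0.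
have [|eta eta0 stab] := @simplex_stable R d k p s; first by rewrite s0.
have [c1 st] := stab w hw.
have [w1 [kappa [kappa0 rob]]] := robust_config eta0 hw.
pose K : R := k.+1%:R; have K0 : 0 < K by rewrite ltr0n.
pose rho1 := Num.min 1 (eps * m / (8 * K)).
have rho10 : 0 < rho1 by rewrite lt_min ltr01 divr_gt0// mulr_gt0.
have [a [rho [/andP[rho0 rhole] abox adis]]] := disjoint_corner_boxes w1 d0 kappa0 rho10.
have rho_1 : rho <= 1 by apply: (le_trans rhole); rewrite ge_min lexx.
have rho_m : 8 * (K * rho) <= eps * m.
  by rewrite mulrA mulrC -ler_pdivlMr ?mulr_gt0//; apply: (le_trans rhole); rewrite ge_min lexx orbT.
have rhod : K * rho ^+ d <= K * rho.
  by rewrite ler_pM2l// -[leRHS]expr1; apply: ler_wiXn2l => //; exact: ltW.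
have [Lam1 HLam1] := witness_bounded_coords c1 s1 hw.
pose Lam2 := \sum_j \sum_i `|tnth (w1 j) i| + kappa.
have HLam2 j u : corner_box (a j) rho u -> forall i, `|tnth u i| <= Lam2.
  move=> /abox h i; have := le_trans (eudist_coord _ _ i) h => h1.
  have h2 : `|tnth (w1 j) i| <= \sum_j \sum_i `|tnth (w1 j) i|.
    rewrite (bigD1 j)//= (bigD1 i)//= -addrA lerDl addr_ge0// ?sumr_ge0//.
    by move=> j' _; exact: sumr_ge0.
  rewrite (_ : tnth u i = tnth (w1 j) i - (tnth (w1 j) i - tnth u i)); last by ring.
  by rewrite (le_trans (ler_normB _ _))// lerD.
pose Lam := Num.max 0 (Num.max Lam1 Lam2).
have bndW u : witness p q w (vcomb s u c1) -> forall i, `|tnth u i| <= Lam.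
  by move=> /HLam1 h i; rewrite (le_trans (h i))// !le_max lexx !orbT.
have bndbox j u : corner_box (a j) rho u -> forall i, `|tnth u i| <= Lam.
  by move=> /HLam2 h i; rewrite (le_trans (h i))// !le_max lexx !orbT.
have Lam0 : 0 <= Lam by rewrite le_max lexx.
pose H := Lam + 8; have H0 : 0 < H by rewrite ltr_wpDl.
have rob' w' : (forall j, corner_box (a j) rho (w' j)) ->
     esimplex p 1 (range w') /\ forall j, eudist (w j) (w' j) <= eta.
  by move=> Hw'; apply: rob => j; exact: abox.
pose Wbar := ((1 - s)^-1) ^+ d * (m + eps * m / 8).
have WbarH : (lebesgue_tuple [set v | witness p q w (vcomb s v c1)] <= Wbar%:E)%E.
  rewrite (_ : [set v | _] = [set v | witness p q w (vaff (vaff (vzero d) s c1) (1 - s) v)]); last first.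
    apply/seteqP; split => v /=;
    by rewrite (_ : vcomb s v c1 = vaff (vaff (vzero d) s c1) (1 - s) v)//;
      apply/eq_from_tnth => i; rewrite !tnth_mktuple; ring.
  rewrite lebesgue_tuple_vaff//; last exact: witness_measurable.
  by rewrite EFinM lee_pmul2l ?lte_fin ?exprn_gt0 ?invr_gt0// ltW.
pose Theta := Wbar + K * rho ^+ d.
have Theta_le : c * Theta <= (1 - eps / 2) * m.
  have g1 : (1 - s)^-1 ^+ d <= 1 + eps / 8.
    rewrite exprVn -[leRHS]invrK lef_pV2 ?posrE ?exprn_gt0 ?invr_gt0//; last by lra.
    apply: (@le_trans _ _ (1 - d%:R * s)); last by apply: bernoulli_le; rewrite !ltW.
    rewrite ds -[leLHS]div1r ler_pdivrMr; last by lra.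
    nra.
  have g2 : Wbar <= (1 + eps / 8) * (m + eps * m / 8).
    by rewrite ler_pM2r// addr_gt0// divr_gt0.
  have g3 : Theta <= (1 + eps / 8) * (m + eps * m / 8) + eps * m / 8.
    by rewrite /Theta lerD//; lra.
  apply: (@le_trans _ _ (c * ((1 + eps / 8) * (m + eps * m / 8) + eps * m / 8))).
    by rewrite ler_pM2l.
  rewrite Ec [leLHS](_ : _ = ((1 - eps) * ((1 + eps / 8) * (1 + eps / 8) + eps / 8)) * m); last by ring.
  rewrite ler_pM2r//; nra.
pose M1 : R := M.+1%:R; have M10 : 0 < M1 by rewrite ltr0n.
(* From [KK >= (4 * H * r n)^-1] and [r n ^+ d = c * L / (m * n)], the group size [Q] will be at
   least [Bc * n / L - 1]. *)
pose Bc := (4 * H)^-1 ^+ d * m / (c * M1).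
have Bc0 : 0 < Bc by rewrite divr_gt0 ?mulr_gt0// exprn_gt0// invr_gt0 mulr_gt0.
pose aa := eps / 2.
have aa0 : 0 < aa by rewrite divr_gt0.
have H4 : 0 < (4 * H)^-1 by rewrite invr_gt0 mulr_gt0.
have [N1 HN1] := radius_small d0 c0 m0 r0 E H4.
have [N2 HN2] := ln_nat_large (2 * (M1 / e + 1) / (Bc * aa ^+ 2) + 1).
(* From [N3] on, a box contains at least one point on average. *)
have [N3 HN3] := ln_nat_large (m / (c * rho ^+ d)).
exists (maxn (maxn (maxn N1 N2) N3) 2) => n.
rewrite !geq_max => /andP[/andP[/andP[/HN1 rH /HN2 Ln] /HN3 Ln3] n2].
split => //; have rn0 := r0 n2.
have n0 : 0 < (n%:R : R) by rewrite ltr0n ltnW.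
have n1 : (1 <= n)%N by exact: ltnW.
have Baa : 0 < Bc * aa ^+ 2 by rewrite mulr_gt0// exprn_gt0.
have Me0 : 0 < M1 / e by rewrite divr_gt0.
have Me1 : 0 <= 2 * (M1 / e + 1) / (Bc * aa ^+ 2).
  by rewrite divr_ge0 ?(ltW Baa)// mulr_ge0// addr_ge0// ltW.
have L0 : 0 < ln (n%:R : R) by apply: lt_le_trans Ln; rewrite ltr_wpDl.
set L := ln (n%:R : R) in Ln Ln3 L0.
have rd0 : 0 < r n ^+ d by rewrite exprn_gt0.
have rL : n%:R * r n ^+ d = c * L / m by rewrite -E//; field; rewrite gt_eqF.
(* The places fit as long as their number per side is at most [x]; since [x >= 2], truncation keeps
   at least half of it. *)
pose x := (2 * H * r n)^-1.
have x0 : 0 < x by rewrite invr_gt0 !mulr_gt0.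
have x2 : 2 <= x.
  rewrite /x -[leLHS]invrK lef_pV2 ?posrE ?invr_gt0 ?mulr_gt0//.
  move: rH; rewrite -[(4 * H)^-1]div1r ltr_pdivlMr ?mulr_gt0//; lra.
pose KK := Num.truncn x.
have KKx : KK%:R <= x by rewrite truncn_le ltW.
have xKK : x / 2 <= KK%:R.
  have : x < KK.+1%:R by exact: truncnS_gt.
  rewrite -natr1; lra.
have KK0 : (0 < KK)%N by rewrite -(ltr0n R); lra.
have LamK : (Lam + 8) * r n <= (2 * KK%:R)^-1.
  rewrite -[leLHS]invrK lef_pV2 ?posrE ?invr_gt0 ?mulr_gt0 ?ltr0n//.
  have : 2 * KK%:R <= 2 * x by rewrite ler_pM2l.
  by rewrite /x -/H -mulrA invfM mulrA mulfV// mul1r.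
have lam1 : 1 <= n%:R * (r n ^+ d * rho ^+ d).
  rewrite mulrA rL; have rho_d : 0 < rho ^+ d by rewrite exprn_gt0.
  by move: Ln3; rewrite ler_pdivrMr ?mulr_gt0// => h; rewrite mulrAC ler_pdivlMr// mul1r; lra.
pose Q := (KK ^ d %/ M.+1)%N.
have MQ : (M.+1 * Q <= KK ^ d)%N by rewrite mulnC leq_trunc_div.
have B := isolated_lower_bound (PX n1) d0 k0 s1 rn0 rho0 n0 st rob' adis bndbox bndW WbarH KK0 LamK lam1 MQ.
apply: (le_trans B); rewrite lee_fin -/M1 -/K -/Theta.
set p0 := expR (- (n%:R * _)).
have p0_ge : expR (- ((1 - aa) * L)) <= p0.
  rewrite ler_expR lerN2 mulrA rL.
  have -> : c * L / m * Theta = L * (c * Theta) / m by ring.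
  by rewrite ler_pdivrMr// mulrAC [leRHS]mulrC ler_pM2l.
have Q_ge : Bc * n%:R / L - 1 <= Q%:R.
  have q1 : (KK ^ d)%:R / M1 < Q%:R + 1 :> R.
    rewrite ltr_pdivrMr// natr1 /M1 -natrM ltr_nat; exact: ltn_ceil.
  have q2 : Bc * n%:R / L <= (KK ^ d)%:R / M1.
    have -> : Bc * n%:R / L = (4 * H)^-1 ^+ d / r n ^+ d / M1.
      have -> : r n ^+ d = c * L / (m * n%:R) by rewrite -E//; field; rewrite !gt_eqF.
      by rewrite /Bc; field; rewrite !gt_eqF// ?exprn_gt0//.
    rewrite ler_pM2r ?invr_gt0// natrX -expr_div_n.
    rewrite ler_pXn2r ?nnegrE// ?divr_ge0 ?(ltW H4) ?(ltW rn0)//.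
    apply: le_trans xKK; rewrite /x le_eqVlt; apply/orP; left; apply/eqP.
    by field; rewrite !gt_eqF.
  by rewrite lerBlDr (le_trans q2)// ltW.
have nL : (n%:R : R) = expR L by rewrite lnK// posrE.
(* The product is at least [Bc * n^aa / L - 1]. The quadratic lower bound on [exp (aa * L)] turns
   this into a linear function of [L], which the choice of [N2] makes large. *)
have key : M1 / e <= Q%:R * p0.
  have k1 : (Bc * n%:R / L - 1) * expR (- ((1 - aa) * L)) <= Q%:R * p0.
    apply: (@le_trans _ _ (Q%:R * expR (- ((1 - aa) * L)))).
      by apply: ler_wpM2r => //; exact: expR_ge0.
    by rewrite ler_wpM2l.
  apply: le_trans k1; rewrite mulrBl mul1r.
  have k2 : expR (- ((1 - aa) * L)) <= 1.
    rewrite -[leRHS]expR0 ler_expR oppr_le0; apply: mulr_ge0; last exact: ltW.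
    by rewrite /aa; lra.
  have k3 : Bc * n%:R / L * expR (- ((1 - aa) * L)) = Bc / L * expR (aa * L).
    rewrite nL (_ : aa * L = L + - ((1 - aa) * L)); last by ring.
    by rewrite expRD; ring.
  have k4 : (aa * L) ^+ 2 / 2 <= expR (aa * L) by apply: expR_ge_sqr; rewrite mulr_ge0// ltW.
  have k5 : Bc / L * ((aa * L) ^+ 2 / 2) = Bc * aa ^+ 2 * L / 2.
    by field; rewrite gt_eqF.
  have k6 : Bc * aa ^+ 2 * L / 2 <= Bc / L * expR (aa * L).
    by rewrite -k5 ler_pM2l// divr_gt0.
  have k7 : 2 * (M1 / e + 1) <= Bc * aa ^+ 2 * L.
    rewrite mulrC [leRHS]mulrC -ler_pdivrMr//.
    by apply: le_trans Ln; rewrite [X in X / _]mulrC lerDl.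
  rewrite k3; lra.
(* [exp x >= x] is enough: [M1 * exp (- x) <= e] as soon as [x >= M1 / e]. *)
have h1 : M1 / e <= expR (Q%:R * p0).
  by apply: (le_trans key); apply: le_trans (expR_ge1Dx _); rewrite lerDr.
rewrite expRN ler_pdivrMr ?expR_gt0// mulrC -ler_pdivrMr//.
Qed.

End process.
End regimes.

(** * From probability bounds to limits *)

Lemma fine_probability_near (R : realType) (dT : measure_display) (T : measurableType dT)
    (P : probability T R) (A B : set T) (e : R) : measurable A -> measurable B ->
  A `<=` B -> (P B <= e%:E)%E ->
  (exists2 x, P A = x%:E & `|0 - x| <= e) /\ (exists2 x, P (~` A) = x%:E & `|1 - x| <= e).
Proof.
move=> mA mB AB PBe; have fA : P A \is a fin_num by exact: fin_num_measure.
have PAe : (P A <= e%:E)%E.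
  by apply: le_trans PBe; apply: le_measure; rewrite ?inE.
have h : `|fine (P A)| <= e.
  by rewrite ger0_norm ?fine_ge0// -lee_fin fineK.
split; first by exists (fine (P A)); rewrite ?fineK// sub0r normrN.
exists (1 - fine (P A)); last by rewrite opprB addrCA subrr addr0.
by rewrite probability_setC// EFinB fineK.
Qed.

Theorem theorem1p1 (R : realType) (d k : nat) (p : complex_kind)
    (q : connectivity) (dT : nat -> measure_display)
    (T : forall n, measurableType (dT n)) (P : forall n, probability (T n) R)
    (X : forall n, T n -> {fset d.-tuple R}) (eps : R) (r : nat -> R) :
  (2 <= d)%N -> (1 <= k)%N ->
  (forall n, (1 <= n)%N -> poisson_process (P n) n%:R (X n)) ->
  0 < eps < 1 ->
  (forall n, (2 <= n)%N -> 0 < r n) ->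
  let J n w := num_isolated p q (X n w) (r n) k in
  ((forall n, (2 <= n)%N ->
      n%:R%:E * mconst d k p q * (r n ^+ d)%:E
        = ((1 - eps) * ln n%:R)%:E)%E ->
    P n [set w | J n w = 0%N] @[n --> \oo] --> 0%E) /\
  ((forall n, (2 <= n)%N ->
      n%:R%:E * mconst d k p q * (r n ^+ d)%:E
        = ((1 + eps) * ln n%:R)%:E)%E ->
    P n [set w | J n w = 0%N] @[n --> \oo] --> 1%E) /\
  ((forall n, (2 <= n)%N ->
      n%:R%:E * mconst d k p q * (r n ^+ d)%:E
        = ((1 - eps) * ln n%:R)%:E)%E ->
    forall M : nat, P n [set w | (M <= J n w)%N] @[n --> \oo] --> 1%E).
Proof.
move=> d2 k0 PX eps01 r0 J; have /andP[ep0 ep1] := eps01.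
have mJ n M : (1 <= n)%N -> measurable [set w | (M <= J n w)%N].
  by move=> n1; exact: (num_isolated_measurable (PX n n1)).
have ltJ n M : [set w | (J n w < M)%N] = ~` [set w | (M <= J n w)%N].
  by apply/seteqP; split => w /=; rewrite ltnNge => /negP.
have J0 n : [set w | J n w = 0%N] = [set w | (J n w < 1)%N].
  by apply/seteqP; split => w /=; rewrite ltnS leqn0 => /eqP.
have mltJ n M : (1 <= n)%N -> measurable [set w | (J n w < M)%N].
  by move=> n1; rewrite ltJ; apply: measurableC; exact: mJ.
have sub : (forall n, (2 <= n)%N ->
      n%:R%:E * mconst d k p q * (r n ^+ d)%:E = ((1 - eps) * ln n%:R)%:E)%E ->
    forall M e, 0 < e -> exists N, forall n, (N <= n)%N ->
    (2 <= n)%N /\ (P n [set w | (J n w < M.+1)%N] <= e%:E)%E.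
  move=> H; have c0 : 0 < 1 - eps by rewrite subr_gt0.
  have [m [Em m0 E]] := mconst_pos c0 r0 H.
  exact: (subcritical d2 k0 PX eps01 r0 m0 Em erefl E).
split; [|split].
- move=> H; apply: ereal_cvg_eps => e e0; have [N HN] := sub H 0%N e e0.
  exists N => n /HN[n2 Pn]; rewrite J0.
  have m1 := mltJ n 1%N (ltnW n2).
  exact: (fine_probability_near m1 m1 (fun _ => id) Pn).1.
- move=> H; have c0 : 0 < 1 + eps by rewrite addr_gt0.
  have [m [Em m0 E]] := mconst_pos c0 r0 H.
  have super := supercritical d2 k0 PX eps01 r0 m0 Em erefl E.
  apply: ereal_cvg_eps => e e0; have [N HN] := super e e0.
  exists N => n /HN[n2 Pn]; rewrite J0 ltJ.
  have m1 := mJ n 1%N (ltnW n2).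
  exact: (fine_probability_near m1 m1 (fun _ => id) Pn).2.
- move=> H M; apply: ereal_cvg_eps => e e0; have [N HN] := sub H M e e0.
  exists N => n /HN[n2 Pn].
  have -> : [set w | (M <= J n w)%N] = ~` [set w | (J n w < M)%N] by rewrite ltJ setCK.
  (* The bound [sub] concerns [M.+1]; the inclusion of [J < M] in [J < M.+1] transfers it to every
     [M], including [0]. *)
  apply: (fine_probability_near (mltJ n M (ltnW n2)) (mltJ n M.+1 (ltnW n2)) _ Pn).2.
  by move=> w /= h; apply: ltnW.
Qed.
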